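(* For $\phi\in C_c^\infty(\mathbb{R})$ define $$\widehat{\mathcal{P}_\phi}(z):=\int_{-\infty}^\infty\mathfrak{S}_t(z)\phi(t)\,dt .$$ Then $\widehat{\mathcal{P}_\phi}(z)$, as a function of real $z$, belongs to $L^2(\mathbb{R})$.
   Context: Notation: $\Lambda(n)=\log p$ if $n=p^k$ with $p$ prime and $k\in\mathbb{Z}_{>0}$, and $\Lambda(n)=0$ otherwise; $\Gamma(s)$ is the gamma function; $\Phi(z,s,a)=\sum_{n=0}^\infty (n+a)^{-s}z^n$ is the Hurwitz--Lerch zeta-function; $\zeta(s)$ is the Riemann zeta-function; $Z(s):=\pi^{-s/2}\Gamma(s/2)\zeta(s)$; $\xi(s)=\tfrac12 s(s-1)\pi^{-s/2}\Gamma(s/2)\zeta(s)$. $L^2(\mathbb{R})$ is with respect to Lebesgue measure; $C_c^\infty(\mathbb{R})$ is the space of smooth compactly supported complex-valued functions on $\mathbb{R}$. The Riemann hypothesis is not assumed. Put $E(z):=\xi(1/2-iz)+\xi'(1/2-iz)$ and $\Theta(z):=\overline{E(\bar z)}/E(z)$ (a meromorphic function). For $t\ge0$ and $z\in\mathbb{C}$ define the meromorphic function of $z$ $$\begin{aligned}\mathfrak{P}_t(z):={}&\frac{4(e^{t/2}-1)}{1-2iz}+\frac{4(e^{-t/2}-1)}{1+2iz}-\sum_{n\le e^t}\frac{\Lambda(n)}{\sqrt n}\frac{e^{iz(t-\log n)}-1}{iz}\\&+\frac{e^{itz}-1}{iz}\Big[\frac{Z'}{Z}\Big(\frac12-iz\Big)-\frac12\log\pi+\frac12\frac{\Gamma'}{\Gamma}\Big(\frac14+\frac{iz}2\Big)\Big]\\&-\frac1{2iz}\Big[\frac{\Gamma'}{\Gamma}\Big(\frac14\Big)-\frac{\Gamma'}{\Gamma}\Big(\frac14+\frac{iz}2\Big)\Big]\\&-\frac1{2iz}e^{-t/2}\Big[\Phi(e^{-2t},1,1/4)-\Phi(e^{-2t},1,\tfrac12(\tfrac12+iz))\Big],\end{aligned}$$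 where at $t=0$ the last bracket is understood as its limit as $t\to0^+$. For $t\ge 0$ define $$\mathfrak{S}_t(z):=\frac{i(1+\Theta(z))}{2\sqrt\pi}\,\mathfrak{P}_t(z),$$ regarded as a meromorphic function of $z$ (removable singularities removed), and for $t<0$ define $\mathfrak{S}_t(z):=\mathfrak{S}_{-t}(z)$. *)

(* Defs.v *)
From HB Require Import structures.
From mathcomp Require Import all_boot all_order all_algebra.
From mathcomp Require Import complex.
From mathcomp Require Import all_classical all_reals all_analysis.

Set Implicit Arguments.
Unset Strict Implicit.
Unset Printing Implicit Defensive.

Import Order.TTheory GRing.Theory Num.Theory.
Import numFieldNormedType.Exports.

Local Open Scope ring_scope.
Local Open Scope classical_set_scope.

(* [R[i]] packed as a [numClosedFieldType]: the carrier of the packed structure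
   inherits the norm topology that MathComp-Analysis puts on every such field,
   which the bare type [R[i]] does not.  In particular [derive1] below is the
   complex derivative. *)
Definition Cx (R : realType) : numClosedFieldType := R[i].

Definition toC (R : realType) (x : R) : Cx R := (x%:C)%C.

Section SpecialFunctions.
Variable R : realType.
Implicit Types (s z w a : Cx R) (f : Cx R -> Cx R).

Definition cexp z : Cx R :=
  let: (x +i* y)%C := z in (expR x * cos y +i* (expR x * sin y))%C.

(* [x ^ s], meaningful for [0 < x] only *)
Definition rpow (x : R) s : Cx R := cexp (s * toC (ln x)).

(* A meromorphic function is represented by a total function that may take
   arbitrary values on a closed discrete set (division by zero, divergent
   limits).  The punctured limit discards those values: it is the value of the
   meromorphic function at every point which is not a pole, removable
   singularities included. *)
Definition remove_sing f z : Cx R := lim (f w @[w --> z^']).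

Definition logderiv f s : Cx R := derive1 f s / f s.

(* Gauss' product; the limit exists for all s outside {0, -1, -2, ...}. *)
Definition Gamma s : Cx R :=
  lim ((fun n : nat =>
    n`!%:R * rpow n%:R s / \prod_(0 <= k < n.+1) (s + k%:R)) @ \oo).

(* Hasse's series for the analytic continuation of \sum_(n >= 1) n^(-s); the
   series converges for every complex s. *)
Definition zeta s : Cx R :=
  (s - 1)^-1 * lim (series (fun n : nat =>
    n.+1%:R^-1 * \sum_(0 <= k < n.+1)
      (-1) ^+ k * 'C(n, k)%:R * rpow k.+1%:R (1 - s)) @ \oo).

(* The Hurwitz-Lerch function \Phi(z, k, a), only for natural exponents k: this
   spares the choice of a branch of (n + a)^(-s). *)
Definition lerch z (k : nat) a : Cx R :=
  lim (series (fun n : nat => z ^+ n / (n%:R + a) ^+ k) @ \oo).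

Definition vonMangoldt (n : nat) : R :=
  if [pick p : 'I_n.+1 | prime p & [exists k : 'I_n.+1, (0 < k)%N && (n == p ^ k)%N]]
  is Some p then ln p%:R else 0.

Definition Zcompleted s : Cx R := rpow pi (- (s / 2)) * Gamma (s / 2) * zeta s.

(* entire: the singularities at 0, 1 and the negative even integers are removed *)
Definition xi : Cx R -> Cx R :=
  remove_sing (fun s =>
    2^-1 * s * (s - 1) * rpow pi (- (s / 2)) * Gamma (s / 2) * zeta s).

Definition Efun z : Cx R := xi (2^-1 - 'i * z) + derive1 xi (2^-1 - 'i * z).

Definition Theta z : Cx R := (Efun z^*)^* / Efun z.

Definition lerch_bracket_pos (t : R) z : Cx R :=
  let q := toC (expR (- (2 * t))) in
  lerch q 1 (4^-1) - lerch q 1 (2^-1 * (2^-1 + 'i * z)).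

Definition lerch_bracket (t : R) z : Cx R :=
  if t == 0 then lim (lerch_bracket_pos u z @[u --> 0^'+])
  else lerch_bracket_pos t z.

(* [\sum_(1 <= n < (Num.truncn (expR t)).+1)] is the sum over n <= e^t *)
Definition frakP (t : R) z : Cx R :=
  4 * toC (expR (t / 2) - 1) / (1 - 2 * 'i * z)
  + 4 * toC (expR (- (t / 2)) - 1) / (1 + 2 * 'i * z)
  - \sum_(1 <= n < (Num.truncn (expR t)).+1)
      toC (vonMangoldt n / Num.sqrt n%:R)
      * ((cexp ('i * z * toC (t - ln n%:R)) - 1) / ('i * z))
  + (cexp ('i * toC t * z) - 1) / ('i * z)
    * (logderiv Zcompleted (2^-1 - 'i * z) - 2^-1 * toC (ln pi)
       + 2^-1 * logderiv Gamma (4^-1 + 'i * z / 2))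
  - (2 * 'i * z)^-1 * (logderiv Gamma (4^-1) - logderiv Gamma (4^-1 + 'i * z / 2))
  - (2 * 'i * z)^-1 * toC (expR (- (t / 2))) * lerch_bracket t z.

(* [`|t|] encodes the even extension from t >= 0 to all real t *)
Definition frakS (t : R) : Cx R -> Cx R :=
  remove_sing (fun z =>
    'i * (1 + Theta z) / (2 * toC (Num.sqrt pi)) * frakP `|t| z).

End SpecialFunctions.

Section ComplexValued.
Variable R : realType.
Implicit Type f : R -> Cx R.

Local Notation mu := (@lebesgue_measure R).

Definition re_part f : R -> R := fun t => complex.Re (f t).
Definition im_part f : R -> R := fun t => complex.Im (f t).

Definition smooth (g : R -> R) :=
  forall (n : nat) (t : R), derivable (derive1n n g) t 1.

Definition test_function f :=
  [/\ smooth (re_part f), smooth (im_part f)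
    & compact (closure [set t | f t != 0])].

Definition Cintegrable f :=
  mu.-integrable setT (EFin \o re_part f)
  /\ mu.-integrable setT (EFin \o im_part f).

Definition Cintegral f : Cx R :=
  (Rintegral mu setT (re_part f) +i* Rintegral mu setT (im_part f))%C.

Definition in_L2 f :=
  [/\ measurable_fun setT (re_part f), measurable_fun setT (im_part f)
    & (\int[mu]_x ((ComplexField.Normc.normc (f x)) ^+ 2)%:E < +oo)%E].

Definition hatP (phi : R -> Cx R) (z : Cx R) : Cx R :=
  Cintegral (fun t => frakS t z * phi t).

End ComplexValued.

(* Main.v *)
From HB Require Import structures.
Require Import Defs.
From mathcomp Require Import all_boot all_order all_algebra.
From mathcomp Require Import complex.
From mathcomp Require Import all_classical all_reals all_analysis measurable_realfun.
From mathcomp Require Import ring lra zify.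

Set Implicit Arguments.
Unset Strict Implicit.
Unset Printing Implicit Defensive.

Import Order.TTheory GRing.Theory Num.Theory.
Import numFieldNormedType.Exports.

Local Open Scope ring_scope.
Local Open Scope classical_set_scope.

(** Why the transform is square integrable.

Fix T with phi supported in [-T, T]. Everything follows from a pointwise bound
|S_t(x)| <= B (1 + x^2)^(-3/8), valid for all real x and all |t| <= T
([frakS_bound]), together with the continuity of S_t(x) in t and in x: the
transform is then an absolutely convergent integral, it is continuous in x,
and its square is dominated by a constant times (1 + x^2)^(-3/4), which is
integrable.

The bound is not visible on the defining formula, for two reasons: S_t(x) is
the value at x of a meromorphic function which might have a pole, and the
logarithmic derivative of the completed zeta function is not bounded on the
critical line. Both difficulties are cured by the factor 1 + Theta. Put s =
1/2 - iz. The functional equation and the reality of xi give Theta(z) = (xi(s)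
- xi'(s)) / (xi(s) + xi'(s)), hence 1 + Theta = 2 / (1 + xi'/xi), so that (1 +
Theta) xi'/xi = 2 - (1 + Theta): the product of 1 + Theta with the logarithmic
derivative is again expressed through 1 + Theta ([Theta_logderiv]). For z = x
real, xi(s) is real and xi'(s) is imaginary, so 1 + Theta is bounded by 2 and
has no pole; at a zero of xi of order m >= 1 it tends to 0, because xi'/xi has
a simple pole there ([Theta_lim]).

What remains of P_t after this substitution is explicit ([frakS_formula]). The
two rational terms and the functions (e^(izc) - 1)/(iz) are O(1/|x|); the
digamma and Hurwitz-Lerch terms combine into K(q, z), the sum over n of q^n /
((n + 1/4)(n + 1/4 + iz/2)), with q = 1 and q = e^(-2t); and |n + 1/4 + ix/2|
is bounded below by a constant times (n + 1)^(1/4) (1 + x^2)^(3/8)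
([bn_inv_real]), which leaves a convergent sum over n and the decay (1 +
x^2)^(-3/8) in x. The exponent 3/8 is one choice among those below 1/2 and
above 1/4. The sum over n <= e^t is continuous in t since each new term enters
with the value (e^0 - 1)/(iz) = 0.

The analytic continuation and the functional equation of zeta are proved on
the way, from Hasse's series. A function is called entire when it is a locally
uniform limit of polynomials; Cauchy estimates for polynomials, obtained by
averaging over roots of unity, make this class closed under division by z - c,
and this gives derivatives, orders of zeros and the identity theorem. The
reciprocal of Gamma is entire as the limit of the Gauss products
([ent_rGamma]), and so is Hs(s) = (s - 1) zeta(s) as the sum of the Hasse
series ([ent_Hs]), whose terms are finite differences of powers; they are
compared with the differences for a real integer exponent ([hdiff_dom]).

For 1 < a < 2 the functional equation is a computation of the integral of
x^(-a-1) (x/(e^x - 1) - 1 + x/2) over x > 0 in two ways: expanding x/(e^x - 1)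
in powers of 1 - e^(-x) yields Hs(1 - a), and the partial fractions of coth
yield the Dirichlet series of zeta(a) ([fe_series]). The identity theorem
carries it to all complex s ([fe_complex]), and Legendre's duplication formula
turns it into xi(1 - s) = xi(s) ([Xi_sym]). All integrals over x > 0 are
written as integrals over the real line through x = e^y. *)

(** * Complex numbers: modulus, exponential, limits *)

Section ComplexBasics.
Variable R : realType.
Local Notation C := (Cx R).
Implicit Types (z w : C) (x y : R).

(** The modulus as a real number; the norm of [Cx R] takes its values in [Cx
R]. *)
Definition nm (z : C) : R := ComplexField.Normc.normc z.

Lemma normE z : `|z| = toC (nm z). Proof. by []. Qed.

Lemma toC_is_zmod : zmod_morphism (@toC R).
Proof. by move=> x y; rewrite /toC -rmorphB. Qed.
Lemma toC_is_mult : monoid_morphism (@toC R).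
Proof. by split=> [|x y]; rewrite /toC ?rmorph1 ?rmorphM. Qed.
HB.instance Definition _ := GRing.isZmodMorphism.Build R C (@toC R) toC_is_zmod.
HB.instance Definition _ := GRing.isMonoidMorphism.Build R C (@toC R) toC_is_mult.

Lemma toC_inj : injective (@toC R). Proof. by move=> x y []. Qed.
Lemma toC_le x y : (toC x <= toC y) = (x <= y). Proof. exact: lecR. Qed.
Lemma toC_lt x y : (toC x < toC y) = (x < y). Proof. exact: ltcR. Qed.

Lemma nm_ge0 z : 0 <= nm z. Proof. by rewrite -toC_le rmorph0 -normE. Qed.
Lemma nm0 : nm 0 = 0. Proof. by apply: toC_inj; rewrite -normE normr0 rmorph0. Qed.
Lemma nm1 : nm 1 = 1. Proof. by apply: toC_inj; rewrite -normE normr1 rmorph1. Qed.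
Lemma nm_eq0 z : (nm z == 0) = (z == 0).
Proof. by rewrite -(inj_eq toC_inj) -normE rmorph0 normr_eq0. Qed.
Lemma nm_gt0 z : (0 < nm z) = (z != 0).
Proof. by rewrite -toC_lt rmorph0 -normE normr_gt0. Qed.
Lemma nmM z w : nm (z * w) = nm z * nm w.
Proof. by apply: toC_inj; rewrite rmorphM -!normE normrM. Qed.
Lemma nmN z : nm (- z) = nm z.
Proof. by apply: toC_inj; rewrite -!normE normrN. Qed.
Lemma nmD z w : nm (z + w) <= nm z + nm w.
Proof. by rewrite -toC_le rmorphD -!normE ler_normD. Qed.
Lemma nmB z w : nm (z - w) <= nm z + nm w.
Proof. by rewrite -[nm w]nmN; exact: nmD. Qed.
Lemma nm_sym z w : nm (z - w) = nm (w - z).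
Proof. by rewrite -nmN opprB. Qed.
Lemma nm_tri z w : nm z - nm w <= nm (z - w).
Proof. by rewrite lerBlDr -{1}(subrK w z); exact: nmD. Qed.
Lemma nmV z : nm z^-1 = (nm z)^-1.
Proof. by apply: toC_inj; rewrite fmorphV -!normE normfV. Qed.
Lemma nmX z n : nm (z ^+ n) = nm z ^+ n.
Proof. by apply: toC_inj; rewrite rmorphXn -!normE normrX. Qed.
Lemma nm_toC x : nm (toC x) = `|x|.
Proof. by rewrite /nm /toC/= expr0n /= addr0 sqrtr_sqr. Qed.
Lemma nm_nat n : nm n%:R = n%:R.
Proof. by rewrite -(rmorph_nat (@toC R)) nm_toC normr_nat. Qed.
Lemma nmi : nm 'i = 1.
Proof. by apply: toC_inj; rewrite -normE normCi rmorph1. Qed.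
Lemma nm_sum (I : Type) (r : seq I) (P : pred I) (F : I -> C) :
  nm (\sum_(i <- r | P i) F i) <= \sum_(i <- r | P i) nm (F i).
Proof.
elim/big_ind2: _ => [|a b c d h1 h2|//]; first by rewrite nm0.
by apply: le_trans (nmD _ _) _; rewrite lerD.
Qed.
Lemma nm_prod (I : Type) (r : seq I) (P : pred I) (F : I -> C) :
  nm (\prod_(i <- r | P i) F i) = \prod_(i <- r | P i) nm (F i).
Proof. by apply: (big_morph nm nmM nm1). Qed.

Definition ReC (z : C) : R := complex.Re z.
Definition ImC (z : C) : R := complex.Im z.

Lemma ReCD z w : ReC (z + w) = ReC z + ReC w. Proof. by case: z; case: w. Qed.
Lemma ImCD z w : ImC (z + w) = ImC z + ImC w. Proof. by case: z; case: w. Qed.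
Lemma ReCN z : ReC (- z) = - ReC z. Proof. by case: z. Qed.
Lemma ImCN z : ImC (- z) = - ImC z. Proof. by case: z. Qed.
Lemma ReCM z w : ReC (z * w) = ReC z * ReC w - ImC z * ImC w.
Proof. by case: z; case: w. Qed.
Lemma ImCM z w : ImC (z * w) = ReC z * ImC w + ImC z * ReC w.
Proof. by case: z; case: w => *. Qed.
Lemma Re_toC x : ReC (toC x) = x. Proof. by []. Qed.
Lemma Im_toC x : ImC (toC x) = 0. Proof. by []. Qed.
Lemma ReC_i : ReC 'i = 0. Proof. by rewrite -complexiE. Qed.
Lemma ImC_i : ImC 'i = 1. Proof. by rewrite -complexiE. Qed.
Lemma ReC_nat n : ReC n%:R = n%:R. Proof. by rewrite -(rmorph_nat (@toC R)). Qed.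
Lemma ImC_nat n : ImC n%:R = 0. Proof. by rewrite -(rmorph_nat (@toC R)). Qed.
Lemma ReC1 : ReC 1 = 1. Proof. by []. Qed.
Lemma ImC1 : ImC 1 = 0. Proof. by []. Qed.
Lemma ReC0 : ReC 0 = 0. Proof. by []. Qed.
Lemma ImC0 : ImC 0 = 0. Proof. by []. Qed.
Definition ReImE := (ReCD, ImCD, ReCN, ImCN, ReCM, ImCM, Re_toC, Im_toC, ReC_i, ImC_i,
  ReC_nat, ImC_nat, ReC1, ImC1, ReC0, ImC0).

Lemma eqC z w : ReC z = ReC w -> ImC z = ImC w -> z = w.
Proof. by case: z => a b; case: w => c d; rewrite /ReC /ImC /= => -> ->. Qed.
Lemma decompC z : z = toC (ReC z) + 'i * toC (ImC z).
Proof. by apply: eqC; rewrite !ReImE; ring. Qed.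

Lemma nm_sqr z : nm z ^+ 2 = ReC z ^+ 2 + ImC z ^+ 2.
Proof. by case: z => a b; rewrite /nm /= sqr_sqrtr // addr_ge0 // sqr_ge0. Qed.
Lemma Re_le_nm z : `|ReC z| <= nm z.
Proof. by rewrite -toC_le; exact: normc_ge_Re. Qed.
Lemma Im_le_nm z : `|ImC z| <= nm z.
Proof.
have := Re_le_nm (z * 'i); rewrite nmM nmi mulr1; rewrite !ReImE.
by rewrite mulr0 mulr1 sub0r normrN.
Qed.
Lemma nm_le z : nm z <= `|ReC z| + `|ImC z|.
Proof.
rewrite {1}(decompC z); apply: le_trans (nmD _ _) _.
by rewrite nmM nmi mul1r !nm_toC.
Qed.

Lemma ReC_conj z : ReC z^* = ReC z. Proof. by case: z. Qed.
Lemma ImC_conj z : ImC z^* = - ImC z. Proof. by case: z. Qed.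
Lemma nm_conj z : nm z^* = nm z.
Proof. by apply: toC_inj; rewrite -!normE norm_conjC. Qed.
Lemma conj_toC x : (toC x)^* = toC x.
Proof. by apply: eqC; rewrite ?ReC_conj ?ImC_conj ?ReImE ?oppr0. Qed.

Lemma Re_cexp z : ReC (cexp z) = expR (ReC z) * cos (ImC z). Proof. by case: z. Qed.
Lemma Im_cexp z : ImC (cexp z) = expR (ReC z) * sin (ImC z). Proof. by case: z. Qed.
Lemma cexp_toC x : cexp (toC x) = toC (expR x).
Proof. by apply: eqC; rewrite ?Re_cexp ?Im_cexp !ReImE ?cos0 ?sin0 ?mulr1 ?mulr0. Qed.
Lemma cexp0 : cexp (0 : C) = 1.
Proof. by have -> : (0 : C) = toC 0 by []; rewrite cexp_toC expR0 rmorph1. Qed.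
Lemma cexpD z w : cexp (z + w) = cexp z * cexp w.
Proof.
by apply: eqC; rewrite !(Re_cexp, Im_cexp, ReImE) expRD ?cosD ?sinD; ring.
Qed.
Lemma nm_cexp z : nm (cexp z) = expR (ReC z).
Proof.
apply/eqP; rewrite -(@eqrXn2 _ 2) ?nm_ge0 ?expR_ge0 // nm_sqr Re_cexp Im_cexp.
by rewrite !exprMn -mulrDr cos2Dsin2 mulr1.
Qed.
Lemma cexp_neq0 z : cexp z != 0.
Proof. by rewrite -nm_gt0 nm_cexp expR_gt0. Qed.
Lemma cexpN z : cexp (- z) = (cexp z)^-1.
Proof.
apply: (mulIf (cexp_neq0 z)); rewrite -cexpD addNr cexp0 mulVf //; exact: cexp_neq0.
Qed.
Lemma cexp_conj z : cexp z^* = (cexp z)^*.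
Proof.
by apply: eqC; rewrite !(ReC_conj, ImC_conj, Re_cexp, Im_cexp) ?cosN ?sinN ?mulrN.
Qed.
Lemma cexpMn z n : cexp (z *+ n) = cexp z ^+ n.
Proof. by elim: n => [|n IH]; rewrite ?cexp0 // mulrS cexpD IH exprS. Qed.

Lemma rpowD x (s t : C) : rpow x (s + t) = rpow x s * rpow x t.
Proof. by rewrite /rpow mulrDl cexpD. Qed.
Lemma rpowN x (s : C) : rpow x (- s) = (rpow x s)^-1.
Proof. by rewrite /rpow mulNr cexpN. Qed.
Lemma nm_rpow x (s : C) : nm (rpow x s) = expR (ReC s * ln x).
Proof. by rewrite nm_cexp; rewrite !ReImE mulr0 subr0. Qed.
Lemma rpow_conj x (s : C) : rpow x s^* = (rpow x s)^*.
Proof. by rewrite /rpow -cexp_conj rmorphM /= conj_toC. Qed.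
Lemma rpow_toC x y : rpow x (toC y) = toC (expR (y * ln x)).
Proof. by rewrite /rpow -(rmorphM (@toC R)) cexp_toC. Qed.

Lemma nbhsC_P (z : C) (P : set C) :
  (nbhs z P) <-> exists2 e : R, 0 < e & forall w, nm (w - z) < e -> P w.
Proof.
split.
  move=> /nbhs_ballP [e /= e0 He].
  exists (ReC e).
    by move: e0; rewrite ltcE => /andP[_].
  move=> w wz; apply: He; rewrite /ball /=.
  rewrite distrC normE; have -> : e = toC (ReC e).
    by apply: eqC => //; rewrite ReImE; exact: ger0_Im (ltW e0).
  by rewrite toC_lt.
move=> [e e0 He]; apply/nbhs_ballP; exists (toC e) => /=.
  by rewrite -(rmorph0 (@toC R)) toC_lt.
by move=> w; rewrite /ball /= distrC normE toC_lt => /He.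
Qed.

Lemma cvgC_P (T : Type) (F : set_system T) {FF : Filter F} (f : T -> C) (l : C) :
  (f x @[x --> F] --> l) <-> forall e : R, 0 < e -> \forall x \near F, nm (f x - l) < e.
Proof.
split=> [fl e e0|H].
  apply: (fl [set w | nm (w - l) < e]); apply/nbhsC_P; by exists e.
move=> P /nbhsC_P [e e0 HP]; have := H e e0.
by apply: filterS => x /= /HP.
Qed.

Lemma cvg_seqC (u : nat -> C) (l : C) :
  (u n @[n --> \oo] --> l) <-> forall e : R, 0 < e -> exists N, forall n, (N <= n)%N -> nm (u n - l) < e.
Proof.
rewrite cvgC_P; split=> H e e0.
  by have [N _ HN] := H e e0; exists N.
by have [N HN] := H e e0; exists N.
Qed.

Lemma cvg_punctC (f : C -> C) (z l : C) :
  (f w @[w --> z^'] --> l) <->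
  forall e : R, 0 < e -> exists2 d : R, 0 < d & forall w, w != z -> nm (w - z) < d -> nm (f w - l) < e.
Proof.
rewrite cvgC_P; split=> H e e0.
  have := H e e0; rewrite /dnbhs /within /= => /nbhsC_P [d d0 Hd].
  by exists d => // w wz /Hd; apply.
have [d d0 Hd] := H e e0.
by rewrite /dnbhs /within /=; apply/nbhsC_P; exists d => // w ? ?; apply: Hd.
Qed.

(** Bridge to the removal of singularities: an epsilon-delta limit at a
punctured point determines the value. *)
Lemma lim_punctC (f : C -> C) (z l : C) :
  (forall e : R, 0 < e -> exists2 d : R, 0 < d & forall w, w != z -> nm (w - z) < d -> nm (f w - l) < e)
  -> remove_sing f z = l.
Proof. by move/cvg_punctC => /cvg_lim; apply; exact: norm_hausdorff. Qed.

Lemma lim_seqC (u : nat -> C) (l : C) :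
  (u n @[n --> \oo] --> l) -> lim (u @ \oo) = l.
Proof. by move/cvg_lim; apply; exact: norm_hausdorff. Qed.

End ComplexBasics.

(** * A telescoping rate of convergence and the mean value inequality *)

Section RealCurves.
Variable R : realType.
Local Notation C := (Cx R).

Definition root4 (x : R) : R := Num.sqrt (Num.sqrt x).
Lemma root4_ge0 x : 0 <= root4 x. Proof. exact: sqrtr_ge0. Qed.
Lemma root4_gt0 x : 0 < x -> 0 < root4 x. Proof. by move=> x0; rewrite !sqrtr_gt0. Qed.
Lemma root4K x : 0 <= x -> root4 x ^+ 4 = x.
Proof.
move=> x0; rewrite -[4%N]/(2 * 2)%N exprM /root4 sqr_sqrtr ?sqrtr_ge0 //.
by rewrite sqr_sqrtr.
Qed.
Lemma root4_le x y : x <= y -> root4 x <= root4 y.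
Proof. by move=> xy; rewrite !ler_wsqrtr. Qed.
Lemma root4_ge1 x : 1 <= x -> 1 <= root4 x.
Proof. by move=> x1; have := root4_le x1; rewrite /root4 !sqrtr1. Qed.

(** (n + 1)^(-1/4), the common rate of convergence of all series and products
below. It is built from square roots, it tends to 0, and its increments
dominate tau n / (n + 1), so every such bound on the terms of a series gives a
rate on its tails. *)
Definition tau (n : nat) : R := (root4 n.+1%:R)^-1.
Lemma tau_gt0 n : 0 < tau n.
Proof. by rewrite invr_gt0 root4_gt0 // ltr0n. Qed.
Lemma tau_noninc m n : (m <= n)%N -> tau n <= tau m.
Proof.
by move=> mn; rewrite lef_pV2 ?posrE ?root4_gt0 ?ltr0n // root4_le // ler_nat.
Qed.
Lemma tau0 : tau 0 = 1.
Proof. by rewrite /tau /root4 !sqrtr1 invr1. Qed.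
Lemma tau_small (e : R) : 0 < e -> exists N, forall n, (N <= n)%N -> tau n < e.
Proof.
move=> e0; exists (Num.truncn (e^-1 ^+ 4)).
move=> n Nn; rewrite -[e]invrK ltf_pV2 ?posrE ?root4_gt0 ?ltr0n ?invr_gt0 //.
rewrite -(@ltr_pXn2r _ 4) ?nnegrE ?root4_ge0 ?invr_ge0 ?(ltW e0) // root4K //.
by apply: lt_le_trans (truncnS_gt _) _; rewrite ler_nat ltnS.
Qed.

(** With a = (n+1)^(1/4) and b = (n+2)^(1/4), b^4 - a^4 = 1 bounds b - a from
below. *)
Lemma tau_telescope n : tau n / n.+1%:R <= 32 * (tau n - tau n.+1).
Proof.
rewrite /tau; set a := root4 n.+1%:R; set b := root4 n.+2%:R.
have a1 : 1 <= a by rewrite root4_ge1 // ler1n.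
have b1 : 1 <= b by rewrite root4_ge1 // ler1n.
have ab : a <= b by rewrite root4_le // ler_nat.
have a4 : n.+1%:R = a ^+ 4 by rewrite root4K.
have b4 : b ^+ 4 = a ^+ 4 + 1 by rewrite root4K // -a4 -natr1.
have b2a : b <= 2 * a.
  rewrite -(@ler_pXn2r _ 4) ?nnegrE //; [|lra..].
  rewrite b4 exprMn; have : 1 <= a ^+ 4 by rewrite exprn_ege1.
  have -> : (2 : R) ^+ 4 = 16 by ring.
  lra.
rewrite a4.
have -> : a^-1 - b^-1 = (b - a) / (a * b) by field; lra.
have -> : a^-1 / a ^+ 4 = 1 / (a ^+ 5) by field; lra.
have a5 : 0 < a ^+ 5 by rewrite exprn_gt0 //; lra.
rewrite ler_pdivrMr //.
have -> : 32 * ((b - a) / (a * b)) * a ^+ 5 = 32 * (b - a) * a ^+ 4 / b by field; lra.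
rewrite ler_pdivlMr ?mul1r; last lra.
have : (b - a) * (b ^+ 3 + b ^+ 2 * a + b * a ^+ 2 + a ^+ 3) = 1.
  by transitivity (b ^+ 4 - a ^+ 4); [ring|rewrite b4; ring].
set S := (X in _ * X = 1) => HS.
have Sb : S <= 15 * a ^+ 3.
  have h2 : b ^+ 2 <= 4 * a ^+ 2.
    have -> : 4 * a ^+ 2 = (2 * a) ^+ 2 by ring.
    by rewrite ler_pXn2r ?nnegrE //; lra.
  have h3 : b ^+ 3 <= 8 * a ^+ 3.
    have -> : 8 * a ^+ 3 = (2 * a) ^+ 3 by ring.
    by rewrite ler_pXn2r ?nnegrE //; lra.
  have h2' : b ^+ 2 * a <= 4 * a ^+ 3.
    by rewrite [a ^+ 3]exprSr mulrA ler_wpM2r //; lra.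
  have h1' : b * a ^+ 2 <= 2 * a ^+ 3.
    by rewrite [a ^+ 3]exprS mulrA ler_wpM2r // exprn_ge0; lra.
  by rewrite /S; lra.
have h : 1 <= (b - a) * (15 * a ^+ 3).
  rewrite -{1}HS ler_wpM2l //; lra.
have : b <= (2 * a) * ((b - a) * (15 * a ^+ 3)).
  rewrite -[leLHS]mulr1 ler_pM //; lra.
have -> : 2 * a * ((b - a) * (15 * a ^+ 3)) = 30 * ((b - a) * a ^+ 4) by ring.
rewrite -mulrA; set T := (b - a) * a ^+ 4 => h0.
have T0 : 0 <= T by rewrite /T mulr_ge0 // ?exprn_ge0; lra.
by lra.
Qed.

Lemma ccomplete (u : nat -> C) :
  (forall e : R, 0 < e -> exists N, forall m n, (N <= m)%N -> (N <= n)%N -> nm (u m - u n) < e) ->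
  exists l, forall e : R, 0 < e -> exists N, forall n, (N <= n)%N -> nm (u n - l) < e.
Proof.
move=> H.
have cc (p : C -> R) (pB : forall z w, `|p z - p w| <= nm (z - w)) :
    exists l : R, forall e : R, 0 < e -> exists N, forall n, (N <= n)%N -> `|p (u n) - l| < e.
  have : cvg (p (u n) @[n --> \oo]).
    apply/cauchy_cvgP/cauchy_ballP => e e0.
    have [N HN] := H e e0.
    exists ([set x | exists2 n, (N <= n)%N & x = p (u n)], [set x | exists2 n, (N <= n)%N & x = p (u n)]).
      by split; exists N => // n /= Nn; exists n.
    move=> [x y] [[/= m Nm ->] [n Nn ->]]; rewrite /ball /=.
    by apply: le_lt_trans (pB _ _) _; exact: HN.
  move=> /cvg_ex [l Hl]; exists l => e e0.
  have /cvgrPdist_lt /(_ e e0) [N _ HN] := Hl.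
  by exists N => n Nn; rewrite distrC; exact: HN.
have [a Ha] : exists l : R, forall e : R, 0 < e -> exists N, forall n, (N <= n)%N -> `|@ReC R (u n) - l| < e.
  by apply: cc => z w; rewrite -ReCN -ReCD; exact: Re_le_nm.
have [b Hb] : exists l : R, forall e : R, 0 < e -> exists N, forall n, (N <= n)%N -> `|@ImC R (u n) - l| < e.
  by apply: cc => z w; rewrite -ImCN -ImCD; exact: Im_le_nm.
exists (toC a + 'i * toC b) => e e0.
have [N1 H1] := Ha (e / 2) ltac:(lra).
have [N2 H2] := Hb (e / 2) ltac:(lra).
exists (maxn N1 N2) => n; rewrite geq_max => /andP[n1 n2].
have h1 := H1 n n1; have h2 := H2 n n2.
apply: le_lt_trans (nm_le _) _; rewrite !ReImE.
have -> : ReC (u n) - (a + (0 * b - 1 * 0)) = ReC (u n) - a by ring.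
have -> : ImC (u n) - (0 + (0 * 0 + 1 * b)) = ImC (u n) - b by ring.
lra.
Qed.

(** Cauchy's criterion with an explicit rate; the rate makes the later
convergences uniform. *)
Lemma tau_cvg (u : nat -> C) (B : R) :
  (forall n, nm (u n.+1 - u n) <= B * (tau n - tau n.+1)) ->
  exists l, forall n, nm (u n - l) <= B * tau n.
Proof.
move=> H.
have B0 : 0 <= B.
  have := le_trans (nm_ge0 _) (H 0%N).
  have : tau 1 < tau 0.
    rewrite /tau ltf_pV2 ?posrE ?root4_gt0 ?ltr0n // /root4 !ltr_sqrt ?sqrtr_gt0 //.
    by rewrite ltr_nat.
  by move=> h; rewrite pmulr_lge0 // subr_gt0.
have inc m n : (n <= m)%N -> nm (u m - u n) <= B * (tau n - tau m).
  elim: m => [|m IH]; first by rewrite leqn0 => /eqP ->; rewrite !subrr nm0 mulr0.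
  rewrite leq_eqVlt => /predU1P[->|]; first by rewrite !subrr nm0 mulr0.
  rewrite ltnS => /IH h; rewrite -(subrKA (u m)).
  apply: le_trans (nmD _ _) _.
  apply: le_trans (lerD (H m) h) _.
  by lra.
have inc' m n : (n <= m)%N -> nm (u m - u n) <= B * tau n.
  move=> nm_; apply: le_trans (inc _ _ nm_) _; rewrite ler_wpM2l //.
  by have := tau_gt0 m; lra.
have [l Hl] : exists l, forall e : R, 0 < e -> exists N, forall n, (N <= n)%N -> nm (u n - l) < e.
  apply: ccomplete => e e0.
  have [N HN] := @tau_small (e / (B + 1)) ltac:(by rewrite divr_gt0 //; lra).
  have key n : (N <= n)%N -> B * tau n < e.
    move=> /HN; rewrite ltr_pdivlMr; last lra.
    by have := tau_gt0 n; lra.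
  exists N => m n Nm Nn; case: (leqP n m) => h.
    by apply: le_lt_trans (inc' _ _ h) _; exact: key.
  by rewrite nm_sym; apply: le_lt_trans (inc' _ _ (ltnW h)) _; exact: key.
exists l => n; apply/ler_addgt0Pr => e e0.
have [N HN] := Hl e e0.
have -> : u n - l = - (u (maxn n N) - u n) + (u (maxn n N) - l) by ring.
apply: le_trans (nmD _ _) _; rewrite nmN; apply: lerD.
  by apply: inc'; rewrite leq_maxl.
by apply/ltW/HN; rewrite leq_maxr.
Qed.

Lemma tau_cvg_series (u : nat -> C) (B : R) :
  (forall n, nm (u n) <= B * (tau n / n.+1%:R)) ->
  exists l, forall n, nm (series u n - l) <= 32 * B * tau n.
Proof.
move=> H; apply: tau_cvg => n.
rewrite seriesSB.
apply: le_trans (H n) _.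
have B0 : 0 <= B.
  by have := le_trans (nm_ge0 _) (H 0%N); rewrite pmulr_lge0 // divr_gt0 ?tau_gt0.
by rewrite (mulrC 32) -mulrA ler_wpM2l // tau_telescope.
Qed.

Lemma rate_cvg (u : nat -> C) l (B : R) :
  (forall n, nm (u n - l) <= B * tau n) -> u n @[n --> \oo] --> l.
Proof.
move=> H; apply/cvg_seqC => e e0.
have B0 : 0 <= B.
  by have := le_trans (nm_ge0 _) (H 0%N); rewrite pmulr_lge0 // tau_gt0.
have [N HN] := @tau_small (e / (B + 1)) ltac:(by rewrite divr_gt0 //; lra).
exists N => n /HN; rewrite ltr_pdivlMr; last lra.
move=> h; apply: le_lt_trans (H n) _.
by have := tau_gt0 n; lra.
Qed.

Lemma lim_uniqC (u : nat -> C) (l l' : C) :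
  u n @[n --> \oo] --> l -> u n @[n --> \oo] --> l' -> l = l'.
Proof. by move=> /lim_seqC <- /lim_seqC <-. Qed.

Lemma seqcD (u v : nat -> C) (a b : C) : u n @[n --> \oo] --> a -> v n @[n --> \oo] --> b ->
  u n + v n @[n --> \oo] --> a + b.
Proof. by move=> ua vb; exact: (cvgD ua vb). Qed.
Lemma seqcN (u : nat -> C) (a : C) : u n @[n --> \oo] --> a -> - u n @[n --> \oo] --> - a.
Proof. by move=> ua; exact: (cvgN ua). Qed.
Lemma seqcM (u v : nat -> C) (a b : C) : u n @[n --> \oo] --> a -> v n @[n --> \oo] --> b ->
  u n * v n @[n --> \oo] --> a * b.
Proof. by move=> ua vb; exact: (cvgM ua vb). Qed.
Lemma seqcV (u : nat -> C) (a : C) : a != 0 -> u n @[n --> \oo] --> a ->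
  (u n)^-1 @[n --> \oo] --> a^-1.
Proof. by move=> a0 ua; exact: (cvgV a0 ua). Qed.
Lemma seqc_cst (a : C) : (fun=> a) n @[n --> \oo] --> a.
Proof. exact: cvg_cst. Qed.

Lemma drv_eq (f g : R -> R) (y a b : R) : is_derive y 1 f a ->
  (forall t, f t = g t) -> a = b -> is_derive y 1 g b.
Proof. by move=> H /funext <- <-. Qed.
Lemma drvD (f g : R -> R) (y a b : R) : is_derive y 1 f a -> is_derive y 1 g b ->
  is_derive y 1 (fun t => f t + g t) (a + b).
Proof. by move=> H K; exact: (is_deriveD H K). Qed.
Lemma drvB (f g : R -> R) (y a b : R) : is_derive y 1 f a -> is_derive y 1 g b ->
  is_derive y 1 (fun t => f t - g t) (a - b).
Proof. by move=> H K; exact: (is_deriveB H K). Qed.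
Lemma drvM (f g : R -> R) (y a b : R) : is_derive y 1 f a -> is_derive y 1 g b ->
  is_derive y 1 (fun t => f t * g t) (a * g y + f y * b).
Proof.
by move=> H K; apply: (drv_eq (is_deriveM H K)) => //; rewrite /GRing.scale /=; ring.
Qed.
Lemma drvZ (f : R -> R) (c y a : R) : is_derive y 1 f a ->
  is_derive y 1 (fun t => c * f t) (c * a).
Proof. by move=> H; exact: (is_deriveZ c H). Qed.
Lemma drv_comp (f g : R -> R) (y a b : R) : is_derive (g y) 1 f a -> is_derive y 1 g b ->
  is_derive y 1 (fun t => f (g t)) (a * b).
Proof. by move=> H K; exact: (is_derive1_comp H K). Qed.

(** Derivative of a complex curve with real parameter, by components. *)
Definition hasd (h : R -> C) (y : R) (d : C) :=
  is_derive y (1 : R) (fun t => ReC (h t)) (ReC d) /\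
  is_derive y (1 : R) (fun t => ImC (h t)) (ImC d).

Lemma hasd_eq h y d d' : hasd h y d -> d = d' -> hasd h y d'.
Proof. by move=> H <-. Qed.

Lemma hasd_ext h h' y d : (forall t, h t = h' t) -> hasd h y d -> hasd h' y d.
Proof. by move=> /funext <-. Qed.

Lemma hasd_cst c y : hasd (fun=> c) y 0.
Proof. by split; exact: is_derive_cst. Qed.

Lemma hasdD h k y d e : hasd h y d -> hasd k y e -> hasd (fun t => h t + k t) y (d + e).
Proof.
move=> [H1 H2] [K1 K2]; split.
  by apply: (drv_eq (drvD H1 K1)) => [t|]; rewrite ReCD.
by apply: (drv_eq (drvD H2 K2)) => [t|]; rewrite ImCD.
Qed.

Lemma hasdM h k y d e : hasd h y d -> hasd k y e ->
  hasd (fun t => h t * k t) y (d * k y + h y * e).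
Proof.
move=> [H1 H2] [K1 K2]; split.
  apply: (drv_eq (drvB (drvM H1 K1) (drvM H2 K2))) => [t|]; first by rewrite ReCM.
  by rewrite !ReImE; ring.
apply: (drv_eq (drvD (drvM H1 K2) (drvM H2 K1))) => [t|]; first by rewrite ImCM.
by rewrite !ReImE; ring.
Qed.

Lemma hasdZ c h y d : hasd h y d -> hasd (fun t => c * h t) y (c * d).
Proof.
by move=> H; apply: hasd_eq (hasdM (hasd_cst c y) H) _; rewrite mul0r add0r.
Qed.

Lemma hasdB h k y d e : hasd h y d -> hasd k y e -> hasd (fun t => h t - k t) y (d - e).
Proof.
move=> H K; apply: (@hasd_ext (fun t => h t + (-1) * k t)); first by move=> t; ring.
by apply: hasd_eq (hasdD H (hasdZ (-1) K)) _; ring.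
Qed.

Lemma hasd_toC (f : R -> R) (y d : R) : is_derive y 1 f d -> hasd (fun t => toC (f t)) y (toC d).
Proof. by move=> H; split => //=; exact: is_derive_cst. Qed.

Lemma hasd_cexp h y d : hasd h y d -> hasd (fun t => cexp (h t)) y (d * cexp (h y)).
Proof.
move=> [H1 H2]; have E := drv_comp (is_derive_expR (ReC (h y))) H1.
split.
  apply: (drv_eq (drvM E (drv_comp (is_derive_cos (ImC (h y))) H2))) => [t|].
    by rewrite Re_cexp.
  by rewrite !ReImE Re_cexp Im_cexp; ring.
apply: (drv_eq (drvM E (drv_comp (is_derive_sin (ImC (h y))) H2))) => [t|].
  by rewrite Im_cexp.
by rewrite !ReImE Re_cexp Im_cexp; ring.
Qed.

Lemma hasd_rpow (z : C) (f : R -> R) (y d : R) : 0 < f y -> is_derive y 1 f d ->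
  hasd (fun t => rpow (f t) z) y (z * toC (d / f y) * rpow (f y) z).
Proof.
move=> fy H; apply: (@hasd_cexp (fun t => z * toC (ln (f t)))).
apply: hasdZ; apply: hasd_toC.
by apply: (drv_eq (drv_comp (is_derive1_ln fy) H)) => //; rewrite mulrC.
Qed.

(** Project h b - h a on its own direction, which reduces the claim to the
monotonicity of a real function. *)
Lemma mean_value_ineq (h h' : R -> C) (k k' : R -> R) (a b : R) : a <= b ->
  (forall y, a <= y <= b -> hasd h y (h' y)) ->
  (forall y, a <= y <= b -> is_derive y 1 k (k' y)) ->
  (forall y, a <= y <= b -> nm (h' y) <= k' y) ->
  nm (h b - h a) <= k b - k a.
Proof.
move=> ab Hh Hk Hle; set d := h b - h a.
pose f (y : R) := nm d * k y - (ReC d * ReC (h y) + ImC d * ImC (h y)).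
pose f' (y : R) := nm d * k' y - (ReC d * ReC (h' y) + ImC d * ImC (h' y)).
have df y : a <= y <= b -> is_derive y 1 f (f' y).
  move=> yab; have [H1 H2] := Hh _ yab; have K := Hk _ yab.
  exact: (drvB (drvZ (nm d) K) (drvD (drvZ (ReC d) H1) (drvZ (ImC d) H2))).
have f'0 y : a <= y <= b -> 0 <= f' y.
  move=> /Hle h1; rewrite subr_ge0.
  apply: (@le_trans _ _ (nm d * nm (h' y))); last by rewrite ler_wpM2l ?nm_ge0.
  have -> : ReC d * ReC (h' y) + ImC d * ImC (h' y) = ReC (d * (h' y)^*).
    by rewrite ReImE ReC_conj ImC_conj; ring.
  by apply: le_trans (ler_norm _) _; apply: le_trans (Re_le_nm _) _; rewrite nmM nm_conj.
(* Monotonicity, used for f and for the majorant k alone when d = 0. *)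
have MV (g g' : R -> R) : (forall y, a <= y <= b -> is_derive y 1 g (g' y)) ->
   (forall y, a <= y <= b -> 0 <= g' y) -> g a <= g b.
  move=> dg g'0; have [||c] := @MVT_segment _ g g' a b ab.
  - by move=> x; rewrite in_itv /= => /andP[/ltW ? /ltW ?]; apply: dg; apply/andP.
  - by apply: derivable_within_continuous => x; rewrite in_itv /= => /dg [].
  rewrite in_itv /= => cab e; rewrite -subr_ge0 e mulr_ge0 ?subr_ge0 //; exact: g'0.
have := MV f f' df f'0; have := MV k k' Hk _.
have := nm_ge0 d; rewrite le_eqVlt => /predU1P[<-|d0].
  move=> h1 _; rewrite subr_ge0; apply: h1 => y /Hle; apply: le_trans; exact: nm_ge0.
move=> _; rewrite /f -subr_ge0 => h1.
rewrite -(ler_pM2l d0) -subr_ge0; apply: le_trans h1 _; rewrite le_eqVlt; apply/orP; left.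
apply/eqP; rewrite -expr2 nm_sqr /d !ReImE; ring.
Qed.

End RealCurves.

(** * Entire functions as locally uniform limits of polynomials *)

Section Entire.
Variable R : realType.
Local Notation C := (Cx R).
Implicit Types (f g : C -> C) (p q : {poly C}) (z w c : C).

(** Runge-type definition: entire functions are exactly the locally uniform
limits of polynomials. In this form the closure properties are immediate and
Cauchy's estimates need only be shown for polynomials. *)
Definition entire f := forall (r e : R), 0 < e ->
  exists p : {poly C}, forall z, nm z <= r -> nm (f z - p.[z]) <= e.

Lemma poly_bound p (r : R) : exists2 M, 0 < M & forall z, nm z <= r -> nm p.[z] <= M.
Proof.
(* The summand 1 makes the bound positive. *)
exists (1 + \sum_(i < size p) nm p`_i * `|r| ^+ i).
  by apply: ltr_wpDr => //; apply: sumr_ge0 => i _; rewrite mulr_ge0 ?nm_ge0 ?exprn_ge0.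
move=> z zr; rewrite horner_coef; apply: le_trans (nm_sum _ _ _) _.
rewrite ler_wpDl //; apply: ler_sum => i _; rewrite nmM nmX ler_wpM2l ?nm_ge0 //.
have r0 : 0 <= r by apply: le_trans zr; exact: nm_ge0.
by rewrite ger0_norm // lerXn2r ?nnegrE ?nm_ge0.
Qed.

Lemma ent_bound f : entire f -> forall r, exists2 M, 0 < M & forall z, nm z <= r -> nm (f z) <= M.
Proof.
move=> ef r; have [p Hp] := ef r 1 ltr01.
have [M M0 HM] := poly_bound p r; exists (M + 1); first lra.
move=> z zr; rewrite -(subrK p.[z] (f z)); apply: le_trans (nmD _ _) _.
by have := Hp z zr; have := HM z zr; lra.
Qed.

Lemma ent_bound_at f c : entire f ->
  forall r, exists2 M, 0 < M & forall z, nm (z - c) <= r -> nm (f z) <= M.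
Proof.
move=> ef r; have [M M0 HM] := ent_bound ef (r + nm c); exists M => // z zr.
by apply: HM; have := nm_tri z c; lra.
Qed.

Lemma ent_poly p : entire (horner p).
Proof. by move=> r e e0; exists p => z _; rewrite subrr nm0 ltW. Qed.

Lemma ent_ext f g : (forall z, f z = g z) -> entire f -> entire g.
Proof. by move=> /funext ->. Qed.

Lemma ent_cst c : entire (fun=> c).
Proof. by apply: ent_ext (ent_poly c%:P) => z; rewrite hornerC. Qed.
Lemma ent_id : entire id.
Proof. by apply: ent_ext (ent_poly 'X) => z; rewrite hornerX. Qed.

Lemma entD f g : entire f -> entire g -> entire (fun z => f z + g z).
Proof.
move=> ef eg r e e0; have e2 : 0 < e / 2 by lra.
have [p Hp] := ef r _ e2; have [q Hq] := eg r _ e2; exists (p + q) => z zr.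
have -> : f z + g z - (p + q).[z] = (f z - p.[z]) + (g z - q.[z]).
  by rewrite hornerD; ring.
apply: le_trans (nmD _ _) _; have := Hp z zr; have := Hq z zr; lra.
Qed.

Lemma entM f g : entire f -> entire g -> entire (fun z => f z * g z).
Proof.
move=> ef eg r e e0.
have [M M0 HM] := ent_bound ef r; have [N N0 HN] := ent_bound eg r.
pose d := Num.min 1 (e / (M + N + 1)).
have d0 : 0 < d by rewrite lt_min ltr01 /= divr_gt0 //; lra.
have d1 : d <= 1 by rewrite ge_min lexx.
have dd : d * (M + N + 1) <= e by rewrite -ler_pdivlMr ?ge_min ?lexx ?orbT //; lra.
have [p Hp] := ef r _ d0; have [q Hq] := eg r _ d0; exists (p * q) => z zr.
have -> : f z * g z - (p * q).[z] = f z * (g z - q.[z]) + (f z - p.[z]) * g z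
   - (f z - p.[z]) * (g z - q.[z]).
  by rewrite hornerM; ring.
apply: le_trans (nmB _ _) _; apply: le_trans (lerD (nmD _ _) (lexx _)) _; rewrite !nmM.
have h1 := HM z zr; have h2 := HN z zr; have h3 := Hp z zr; have h4 := Hq z zr.
have := ler_pM (nm_ge0 _) (nm_ge0 _) h1 h4; have := ler_pM (nm_ge0 _) (nm_ge0 _) h3 h2.
have := ler_pM (nm_ge0 _) (nm_ge0 _) h3 h4.
have : d * d <= d by rewrite -[leRHS]mulr1 ler_wpM2l // ltW.
lra.
Qed.

Lemma entZ c f : entire f -> entire (fun z => c * f z).
Proof. exact: entM (ent_cst c). Qed.
Lemma entN f : entire f -> entire (fun z => - f z).
Proof. by move=> ef; apply: ent_ext (entZ (-1) ef) => z; rewrite mulN1r. Qed.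
Lemma entB f g : entire f -> entire g -> entire (fun z => f z - g z).
Proof. by move=> ef eg; exact: entD ef (entN eg). Qed.

Lemma ent_sum (I : Type) (r : seq I) (F : I -> C -> C) :
  (forall i, entire (F i)) -> entire (fun z => \sum_(i <- r) F i z).
Proof.
move=> eF; elim: r => [|i r IH].
  by apply: ent_ext (ent_cst 0) => z; rewrite big_nil.
by apply: ent_ext (entD (eF i) IH) => z; rewrite big_cons.
Qed.

Lemma ent_prod (I : Type) (r : seq I) (F : I -> C -> C) :
  (forall i, entire (F i)) -> entire (fun z => \prod_(i <- r) F i z).
Proof.
move=> eF; elim: r => [|i r IH].
  by apply: ent_ext (ent_cst 1) => z; rewrite big_nil.
by apply: ent_ext (entM (eF i) IH) => z; rewrite big_cons.
Qed.

Lemma ent_aff f (a b : C) : entire f -> entire (fun z => f (a * z + b)).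
Proof.
move=> ef r e e0; have [p Hp] := ef (nm a * `|r| + nm b) e e0.
exists (p \Po (a *: 'X + b%:P)) => z zr.
have -> : (p \Po (a *: 'X + b%:P)).[z] = p.[a * z + b].
  by rewrite horner_comp !hornerE.
apply: Hp; apply: le_trans (nmD _ _) _; rewrite lerD2r nmM ler_wpM2l ?nm_ge0 //.
by apply: le_trans zr (ler_norm r).
Qed.

Lemma ent_unif f : (forall (r e : R), 0 < e ->
   exists2 g, entire g & forall z, nm z <= r -> nm (f z - g z) <= e) -> entire f.
Proof.
move=> H r e e0; have e2 : 0 < e / 2 by lra.
have [g eg Hg] := H r _ e2; have [p Hp] := eg r _ e2; exists p => z zr.
rewrite -(subrKA (g z)); apply: le_trans (nmD _ _) _.
by have := Hg z zr; have := Hp z zr; lra.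
Qed.

(** By induction on N along the segment from 0 to z: the derivative of the
remainder of order N + 1 is z times the remainder of order N. *)
Lemma cexp_taylor (z : C) (N : nat) :
  nm (cexp z - \sum_(i < N) z ^+ i / i`!%:R) <= nm z ^+ N / N`!%:R * expR (nm z).
Proof.
pose h N (t : R) := cexp (z * toC t) - \sum_(i < N) (z * toC t) ^+ i / i`!%:R.
have hd t : hasd (fun t => z * toC t) t z.
  by apply: hasd_eq (hasdZ z (hasd_toC (is_derive_id t (1 : R)))) _; rewrite rmorph1 mulr1.
have hp n t : hasd (fun t => (z * toC t) ^+ n.+1 / n.+1`!%:R) t
    (z * ((z * toC t) ^+ n / n`!%:R)).
  elim: n => [|n IH].
    apply: (@hasd_ext _ (fun t => z * toC t)); first by move=> u; rewrite expr1 (_ : 1`! = 1)%N // divr1.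
    by apply: hasd_eq (hd t) _; rewrite expr0 fact0 divr1 mulr1.
  have fn0 : (n.+1`!%:R : C) != 0 by rewrite pnatr_eq0 -lt0n fact_gt0.
  have fn1 : (n`!%:R : C) != 0 by rewrite pnatr_eq0 -lt0n fact_gt0.
  have n1 : (n.+1%:R : C) != 0 by rewrite pnatr_eq0.
  have n2 : (n.+2%:R : C) != 0 by rewrite pnatr_eq0.
  apply: (@hasd_ext _ (fun t => n.+2%:R^-1 * ((z * toC t) ^+ n.+1 / n.+1`!%:R * (z * toC t)))).
    by move=> u; rewrite (factS n.+1) natrM (exprS _ n.+1); field; rewrite fn0 -natrD pnatr_eq0 addn_eq0.
  apply: hasd_eq (hasdZ (n.+2%:R^-1) (hasdM IH (hd t))) _.
  by rewrite (factS n) natrM (exprS _ n) -!natr1; field; rewrite fn1 !natr1 n1 n2.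
have key : forall n t, 0 <= t <= 1 -> nm (h n t) <= nm z ^+ n * t ^+ n / n`!%:R * expR (nm z).
  elim=> [|n IH] t t01.
    rewrite /h big_ord0 subr0 nm_cexp !expr0 fact0 divr1 !mul1r ler_expR.
    apply: le_trans (ler_norm _) _; apply: le_trans (Re_le_nm _) _.
    rewrite nmM nm_toC ger0_norm; last lra.
    by rewrite -[leRHS]mulr1 ler_wpM2l ?nm_ge0 //; lra.
  have hs m y : hasd (fun t => \sum_(i < m.+1) (z * toC t) ^+ i / i`!%:R) y
      (\sum_(i < m) z * ((z * toC y) ^+ i / i`!%:R)).
    elim: m => [|m IHm].
      rewrite big_ord0; apply: (@hasd_ext _ (fun=> 1)); last exact: hasd_cst.
      by move=> u; rewrite big_ord1 expr0 fact0 divr1.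
    rewrite big_ord_recr /=; apply: (hasd_ext _ (hasdD IHm (hp m y))) => u.
    by rewrite [RHS]big_ord_recr.
  have Hd y : hasd (h n.+1) y (z * h n y).
    apply: hasd_eq (hasdB (hasd_cexp (hd y)) (hs n y)) _.
    by rewrite -mulr_sumr -mulrBr.
  pose k (y : R) := nm z ^+ n.+1 * y ^+ n.+1 / n.+1`!%:R * expR (nm z).
  pose k' (y : R) := nm z * (nm z ^+ n * y ^+ n / n`!%:R * expR (nm z)).
  have kd (y : R) : is_derive y 1 k (k' y).
    have D := is_deriveX n.+1 (is_derive_id y (1 : R)).
    apply: (drv_eq (drvZ (nm z ^+ n.+1 / n.+1`!%:R * expR (nm z)) D)) => [u|].
      rewrite /k /= exprfctE; ring.
    have fn1 : (n`!%:R : R) != 0 by rewrite pnatr_eq0 -lt0n fact_gt0.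
    rewrite /k' /GRing.scale /= (factS n) natrM (exprS _ n) -!natr1; field.
    by rewrite fn1 natr1 pnatr_eq0.
  have t0 : 0 <= t by lra.
  have := @mean_value_ineq _ (h n.+1) (fun y => z * h n y) k k' 0 t t0 (fun y _ => Hd y) (fun y _ => kd y).
  have -> : h n.+1 0 = 0.
    rewrite /h rmorph0 mulr0 cexp0 big_ord_recl /= expr0 fact0 divr1 big1 ?addr0 ?subrr //.
    by move=> i _; rewrite expr0n /= mul0r.
  have -> : k 0 = 0 by rewrite /k expr0n /= mulr0 !mul0r.
  rewrite !subr0; apply => y y0t; rewrite nmM ler_wpM2l ?nm_ge0 //; apply: IH; lra.
have := key N 1; rewrite /h rmorph1 !mulr1 expr1n mulr1; apply; lra.
Qed.

Lemma ent_cexp : entire (@cexp R).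
Proof.
move=> r e e0; have r1 : 0 < `|r| + 1 by rewrite ltr_wpDl.
have := cvg_exp_coeff (`|r| + 1).
move/cvgrPdist_lt => /(_ (e / expR (`|r| + 1))) [].
  by rewrite divr_gt0 ?expR_gt0.
move=> N _ /(_ N (leqnn N)); rewrite sub0r normrN ger0_norm; last first.
  exact: exp_coeff_ge0 (ltW r1).
rewrite exp_coeffE /= ltr_pdivlMr ?expR_gt0 // => HN.
exists (\poly_(i < N) (i`!%:R)^-1) => z zr; rewrite horner_poly.
have zr1 : nm z <= `|r| + 1 by have := ler_norm r; lra.
have -> : \sum_(i < N) i`!%:R^-1 * z ^+ i = \sum_(i < N) z ^+ i / i`!%:R.
  by apply: eq_bigr => i _; rewrite mulrC.
apply: le_trans (cexp_taylor _ _) _; apply: le_trans (ltW HN).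
apply: ler_pM; rewrite ?expR_ge0 ?ler_expR //.
  by rewrite mulr_ge0 ?exprn_ge0 ?nm_ge0 ?invr_ge0.
by rewrite mulrC ler_wpM2l ?invr_ge0 // lerXn2r ?nnegrE ?nm_ge0 // ltW.
Qed.

End Entire.

(** * Roots of unity and division by a linear factor *)

Section Roots.
Variable R : realType.
Local Notation C := (Cx R).

Definition uroot (N : nat) : C := cexp ('i * toC (2 * pi / N%:R)).

Lemma urootX N k : uroot N ^+ k = cexp ('i * toC (2 * pi * k%:R / N%:R)).
Proof.
rewrite -cexpMn -[_ *+ k]mulr_natr -mulrA -(rmorph_nat (@toC R)) -(rmorphM (@toC R)).
by congr (cexp (_ * toC _)); ring.
Qed.

Lemma Re_urootX N k : ReC (uroot N ^+ k) = cos (2 * pi * k%:R / N%:R).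
Proof. by rewrite urootX Re_cexp !ReImE !(mul0r, mul1r, mulr0, subr0, expR0, add0r). Qed.

Lemma nm_uroot N : nm (uroot N) = 1.
Proof. by rewrite nm_cexp !ReImE !(mul0r, mul1r, mulr0, subr0, expR0). Qed.

Lemma uroot_unity N : (0 < N)%N -> uroot N ^+ N = 1.
Proof.
move=> N0; rewrite urootX mulfK ?pnatr_eq0 -?lt0n //.
apply: eqC; rewrite ?Re_cexp ?Im_cexp !ReImE !(mul0r, mul1r, mulr0, subr0, expR0, add0r).
  by rewrite mulr_natl cos2pi.
by rewrite mulr_natl sin2pi.
Qed.

Lemma uroot_neq1 N k : (0 < k < N)%N -> uroot N ^+ k != 1.
Proof.
move=> /andP[k0 kN]; apply/eqP => /(congr1 (@ReC R)); rewrite Re_urootX ReImE.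
have N0 : (0 < N%:R :> R) by rewrite ltr0n; apply: leq_trans kN.
set x := 2 * pi * k%:R / N%:R.
have -> : x = (pi * (k%:R / N%:R)) *+ 2 by rewrite /x -mulr_natl; ring.
have s0 : 0 < sin (pi * (k%:R / N%:R) : R).
  apply: sin_gt0_pi; rewrite mulr_gt0 ?pi_gt0 ?divr_gt0 ?ltr0n ?(ltn_trans k0 kN) //=.
  by rewrite -[ltRHS]mulr1 ltr_pM2l ?pi_gt0 // ltr_pdivrMr // mul1r ltr_nat.
rewrite cos_mulr2n -mulr_natl => h.
have := cos2Dsin2 (pi * (k%:R / N%:R) : R).
have : 0 < sin (pi * (k%:R / N%:R) : R) ^+ 2 by rewrite exprn_gt0.
lra.
Qed.

Lemma uroot_sum N k : (0 < k < N)%N -> \sum_(j < N) (uroot N ^+ k) ^+ j = 0.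
Proof.
move=> kN; have := subrX1 (uroot N ^+ k) N.
rewrite exprAC uroot_unity ?expr1n ?subrr; last by lia.
move/esym/eqP; rewrite mulf_eq0 subr_eq0 (negbTE (uroot_neq1 kN)) => /eqP //.
Qed.

(** Average p(r w^j) w^(-jk) over the N-th roots of unity w^j, with N > deg p:
only the coefficient of index k survives. *)
Lemma cauchy0 (p : {poly C}) (r M : R) k : 0 < r ->
  (forall z, nm z <= r -> nm p.[z] <= M) -> nm p`_k * r ^+ k <= M.
Proof.
move=> r0 H; case: (ltnP k (size p)) => ks; last first.
  by rewrite nth_default // nm0 mul0r; apply: le_trans (H 0 _); rewrite ?nm_ge0 ?nm0 ?ltW.
have [n ne] : exists n : nat, n = size p by exists (size p).
have kn : (k < n)%N by rewrite ne.
pose N := n.+1; pose w := uroot N.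
have N0 : 0 < N%:R :> R by rewrite ltr0n.
have key : \sum_(j < N) p.[toC r * w ^+ j] * (w ^+ (N - k)) ^+ j = N%:R * (p`_k * toC r ^+ k).
  under eq_bigr do rewrite horner_coef mulr_suml.
  rewrite exchange_big /= (bigD1 (Ordinal ks)) //= [X in _ + X]big1 ?addr0.
    transitivity (\sum_(j < N) p`_k * toC r ^+ k); last first.
      by rewrite sumr_const card_ord mulr_natl.
    apply: eq_bigr => j _; rewrite exprMn -!mulrA; congr (_ * _); rewrite -[RHS]mulr1; congr (_ * _).
    rewrite -!exprM mulnC -exprD -mulnDl subnKC; last by rewrite /N; lia.
    by rewrite exprM uroot_unity // expr1n.
  move=> i ik; have ik' : nat_of_ord i != k by [].
  transitivity (\sum_(j < N) p`_i * toC r ^+ i * (w ^+ (if (k < i)%N then i - k else N - (k - i))%N) ^+ j).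
    2: rewrite -mulr_sumr uroot_sum ?mulr0 //; have : (i < n)%N by rewrite ne.
    2: move: (nat_of_ord i) ik' => j /eqP jk jn; rewrite /N; case: ifP; lia.
  apply: eq_bigr => j _; rewrite exprMn -!mulrA; congr (_ * (_ * _)).
  rewrite -!exprM mulnC -exprD -mulnDl; have : (i < n)%N by rewrite ne.
  move: (nat_of_ord i) ik' => l /eqP lk ls.
  case: ifP => h.
    have -> : (l + (N - k) = N + (l - k))%N by rewrite /N; lia.
    by rewrite mulnDl exprD exprM uroot_unity // expr1n mul1r.
  by congr (w ^+ (_ * _)); rewrite /N; lia.
have := congr1 (@nm R) key; rewrite !nmM nm_nat nmX nm_toC gtr0_norm // => e.
rewrite -(ler_pM2l N0) -e; apply: le_trans (nm_sum _ _ _) _.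
apply: (@le_trans _ _ (\sum_(j < N) M)); last first.
  by rewrite sumr_const card_ord mulr_natl.
apply: ler_sum => j _; rewrite nmM !nmX nm_uroot !expr1n mulr1; apply: H.
by rewrite nmM nmX nm_uroot expr1n mulr1 nm_toC gtr0_norm.
Qed.

(** On |z| >= r/2 divide; on the smaller disc sum Cauchy's bounds on the
coefficients as a geometric series. *)
Lemma poly_div_bound0 (q : {poly C}) (r M : R) : 0 < r ->
  (forall z, nm z <= r -> nm (z * q.[z]) <= M) ->
  forall z, nm z <= r -> nm q.[z] <= 2 * M / r.
Proof.
move=> r0 H z zr.
have M0 : 0 <= M by apply: le_trans (H 0 _); rewrite ?nm0 ?nm_ge0 ?ltW.
case: (leP (r / 2) (nm z)) => hz.
  have := H z zr; rewrite nmM => h; rewrite ler_pdivlMr // mulrC.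
  have : r / 2 * nm q.[z] <= nm z * nm q.[z] by rewrite ler_wpM2r ?nm_ge0.
  lra.
have Hc k : nm q`_k <= M / r ^+ k.+1.
  rewrite ler_pdivlMr ?exprn_gt0 //.
  have := @cauchy0 ('X * q) r M k.+1 r0; rewrite coefXM /=; apply => w wr.
  by rewrite hornerM hornerX; exact: H.
rewrite horner_coef; apply: le_trans (nm_sum _ _ _) _.
apply: (@le_trans _ _ (\sum_(i < size q) (M / r) * (2^-1) ^+ i)).
  apply: ler_sum => i _; rewrite nmM nmX.
  apply: (@le_trans _ _ (M / r ^+ i.+1 * (r / 2) ^+ i)).
    by apply: ler_pM; rewrite ?nm_ge0 ?exprn_ge0 ?nm_ge0 // lerXn2r ?nnegrE ?nm_ge0 ?ltW ?divr_gt0.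
  rewrite le_eqVlt; apply/orP; left; apply/eqP; rewrite exprS expr_div_n exprVn.
  by field; rewrite !expf_neq0 ?gt_eqF.
rewrite -mulr_sumr; have -> : 2 * M / r = (M / r) * 2 by ring.
rewrite ler_wpM2l ?divr_ge0 ?(ltW r0) //.
have := subrX1 (2^-1 : R) (size q).
have : 0 <= (2^-1 : R) ^+ size q by rewrite exprn_ge0.
set S := \sum_(i < _) _; set T := _ ^+ _; lra.
Qed.

Lemma poly_div_bound (q : {poly C}) (c : C) (r M : R) : 0 < r ->
  (forall z, nm (z - c) <= r -> nm ((z - c) * q.[z]) <= M) ->
  forall z, nm (z - c) <= r -> nm q.[z] <= 2 * M / r.
Proof.
move=> r0 H z zr.
have e w : (q \Po ('X + c%:P)).[w] = q.[w + c] by rewrite horner_comp !hornerE.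
have := @poly_div_bound0 (q \Po ('X + c%:P)) r M r0 _ (z - c) zr.
rewrite e subrK; apply => w wr; rewrite e.
have := H (w + c); rewrite addrK; exact.
Qed.

End Roots.

Section EntireTheory.
Variable R : realType.
Local Notation C := (Cx R).
Implicit Types (f g : C -> C).

Lemma cvg_le_nm (u : nat -> C) (l : C) (B : R) : (forall e : R, 0 < e ->
   exists N, forall n, (N <= n)%N -> nm (u n) <= B + e) ->
  (u n @[n --> \oo] --> l) -> nm l <= B.
Proof.
move=> H /cvg_seqC Hl; apply/ler_addgt0Pr => e e0.
have [N1 H1] := H (e / 2) ltac:(lra); have [N2 H2] := Hl (e / 2) ltac:(lra).
have h1 := H1 (maxn N1 N2) (leq_maxl _ _); have h2 := H2 (maxn N1 N2) (leq_maxr _ _).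
have -> : l = u (maxn N1 N2) - (u (maxn N1 N2) - l) by ring.
apply: le_trans (nmB _ _) _; lra.
Qed.

(** Divide the approximating polynomials by z - c; [poly_div_bound] shows that
the quotients form a Cauchy sequence on discs. The last clause is the
quantitative form, which iterates. *)
Lemma ent_div f c : entire f -> f c = 0 -> exists g, [/\ entire g,
  forall z, f z = (z - c) * g z &
  forall r M, 0 < r -> (forall z, nm (z - c) <= r -> nm (f z) <= M) ->
    forall z, nm (z - c) <= r -> nm (g z) <= 2 * M / r].
Proof.
move=> ef fc.
have /choice [p Hp] : forall n, exists p : {poly C}, forall z,
    nm (z - c) <= n.+1%:R -> nm (f z - p.[z]) <= tau R n.
  move=> n; have [p Hp] := ef (n.+1%:R + nm c) _ (tau_gt0 R n); exists p => z zr.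
  by apply: Hp; have := nm_tri z c; lra.
have /choice [q Hq] : forall n, exists q : {poly C}, forall z,
    (p n).[z] - (p n).[c] = (z - c) * q.[z].
  move=> n; have /factor_theorem [q e] : root (p n - (p n).[c]%:P) c.
    by rewrite rootE !hornerE subrr.
  by exists q => z; rewrite mulrC; have := congr1 (horner^~ z) e; rewrite !hornerE.
have pc n : nm (p n).[c] <= tau R n.
  by have := Hp n c; rewrite subrr nm0 fc sub0r nmN; apply; rewrite ler0n.
have qq (r : R) m n : 0 < r -> r <= m.+1%:R -> r <= n.+1%:R -> forall z, nm (z - c) <= r ->
    nm ((q m).[z] - (q n).[z]) <= 4 * (tau R m + tau R n) / r.
  move=> r0 rm rn z zr.
  suff H w : nm (w - c) <= r -> nm ((w - c) * (q m - q n).[w]) <= 2 * (tau R m + tau R n).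
    by have := poly_div_bound r0 H zr; rewrite hornerD hornerN; lra.
  move=> wr; rewrite hornerD hornerN mulrBr -!Hq.
  have -> : (p m).[w] - (p m).[c] - ((p n).[w] - (p n).[c]) =
    (f w - (p n).[w]) - (f w - (p m).[w]) - ((p m).[c] - (p n).[c]) by ring.
  have h1 := Hp n w ltac:(lra); have h2 := Hp m w ltac:(lra).
  apply: le_trans (nmB _ _) _; have := nmB (f w - (p n).[w]) (f w - (p m).[w]).
  have := nmB (p m).[c] (p n).[c]; have := pc m; have := pc n; lra.
have [L HL] : exists l, forall e : R, 0 < e -> exists N, forall n, (N <= n)%N -> nm ((q n).[c] - l) < e.
  apply: (@ccomplete _ (fun n => (q n).[c])) => e e0.
  have [N HN] := @tau_small R (e / 8) ltac:(lra).
  exists N => m n /HN h1 /HN h2.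
  have := @qq 1 m n ltr01; rewrite !ler1n => /(_ isT isT c).
  rewrite subrr nm0 divr1 => /(_ ler01); lra.
pose g z := if z == c then L else f z / (z - c).
have gq z : (q n).[z] @[n --> \oo] --> (g z : C).
  apply/cvg_seqC; rewrite /g; case: eqP => [-> //|/eqP zc] e e0.
  have zc0 : 0 < nm (z - c) by rewrite nm_gt0 subr_eq0.
  have [N HN] := @tau_small R (e * nm (z - c) / 2) ltac:(by rewrite divr_gt0 // mulr_gt0).
  exists (maxn N (Num.truncn (nm (z - c)))) => n; rewrite geq_max => /andP[n1 n2].
  have zn : nm (z - c) <= n.+1%:R.
    by apply: ltW; apply: lt_le_trans (truncnS_gt _) _; rewrite ler_nat ltnS.
  rewrite -(ltr_pM2l zc0) -nmM mulrBr -Hq mulrCA divff ?mulr1 ?subr_eq0 //.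
  have h1 := Hp n z zn; have h2 := HN n n1; have h3 := pc n.
  have -> : (p n).[z] - (p n).[c] - f z = - (f z - (p n).[z]) - (p n).[c] by ring.
  apply: le_lt_trans (nmB _ _) _; rewrite nmN; lra.
have fg z : f z = (z - c) * g z.
  rewrite /g; case: eqP => [->|/eqP zc]; first by rewrite subrr mul0r fc.
  by rewrite mulrCA divff ?mulr1 ?subr_eq0.
exists g; split => //.
- move=> r e e0; pose r' := `|r| + nm c + 1.
  have r'1 : 1 <= r' by have := nm_ge0 c; have := normr_ge0 r; rewrite /r'; lra.
  have [N HN] := @tau_small R (e / 8) ltac:(lra).
  pose m := maxn N (Num.truncn r').
  have r'm n : (m <= n)%N -> r' <= n.+1%:R.
    rewrite geq_max => /andP[_ h].
    by apply: ltW; apply: lt_le_trans (truncnS_gt _) _; rewrite ler_nat ltnS.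
  exists (q m) => z zr.
  have zr' : nm (z - c) <= r' by have := nmB z c; have := ler_norm r; rewrite /r'; lra.
  rewrite nm_sym; apply: (@cvg_le_nm (fun n => (q m).[z] - (q n).[z])).
    move=> d d0; exists m => n mn.
    have := qq r' m n ltac:(lra) (r'm _ (leqnn _)) (r'm _ mn) z zr'.
    have h1 := HN m (leq_maxl _ _); have h2 := HN n (leq_trans (leq_maxl _ _) mn).
    move=> h; apply: le_trans h _; rewrite ler_pdivrMr; last lra.
    have : e <= (e + d) * r' by rewrite -[leLHS]mulr1 ler_pM //; lra.
    lra.
  by apply: cvgB; [exact: cvg_cst|exact: gq].
- move=> r M r0 HM z zr; apply: (@cvg_le_nm (fun n => (q n).[z]) _ _ _ (gq z)) => e e0.
  have [N HN] := @tau_small R (e * r / 4) ltac:(by rewrite divr_gt0 ?mulr_gt0).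
  exists (maxn N (Num.truncn r)) => n; rewrite geq_max => /andP[n1 n2].
  have rn : r <= n.+1%:R.
    by apply: ltW; apply: lt_le_trans (truncnS_gt _) _; rewrite ler_nat ltnS.
  have := @poly_div_bound _ (q n) c r (M + 2 * tau R n) r0 _ z zr.
  have -> : 2 * (M + 2 * tau R n) / r = 2 * M / r + 4 * tau R n / r by ring.
  have : 4 * tau R n / r <= e by rewrite ler_pdivrMr //; have := HN n n1; lra.
  move=> h h2; apply: le_trans (h2 _) _; last lra.
  move=> w wr; rewrite -Hq.
  have -> : (p n).[w] - (p n).[c] = f w - (f w - (p n).[w]) - (p n).[c] by ring.
  have := nmB (f w - (f w - (p n).[w])) (p n).[c]; have := nmB (f w) (f w - (p n).[w]).
  have := Hp n w ltac:(lra); have := pc n; have := HM w wr; lra.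
Qed.

End EntireTheory.

(** * Complex derivatives, orders of zeros, the identity theorem *)

Section ComplexDerivative.
Variable R : realType.
Local Notation C := (Cx R).
Implicit Types (f g : C -> C) (z w c d : C).

Definition ccont f z := forall e : R, 0 < e ->
  exists2 dl : R, 0 < dl & forall w, nm (w - z) < dl -> nm (f w - f z) < e.

Lemma ccontP f z : ccont f z <-> {for z, continuous f}.
Proof.
split=> [H|/(@cvgC_P R C (nbhs z) _ f (f z)) H].
  apply/(@cvgC_P R C (nbhs z) _ f (f z)) => e /H [dl dl0 Hd]; apply/nbhsC_P; by exists dl.
by move=> e /H /nbhsC_P [dl dl0 Hd]; exists dl.
Qed.

Lemma ccont_cst c z : ccont (fun=> c) z.
Proof. by apply/ccontP; exact: cst_continuous. Qed.
Lemma ccont_id z : ccont id z.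
Proof. by move=> e e0; exists e. Qed.
Lemma ccontD f g z : ccont f z -> ccont g z -> ccont (fun w => f w + g w) z.
Proof. by move=> /ccontP cf /ccontP cg; apply/ccontP; exact: (continuousD cf cg). Qed.
Lemma ccontN f z : ccont f z -> ccont (fun w => - f w) z.
Proof. by move=> /ccontP cf; apply/ccontP; exact: (continuousN cf). Qed.
Lemma ccontB f g z : ccont f z -> ccont g z -> ccont (fun w => f w - g w) z.
Proof. by move=> /ccontP cf /ccontP cg; apply/ccontP; exact: (continuousB cf cg). Qed.
Lemma ccontM f g z : ccont f z -> ccont g z -> ccont (fun w => f w * g w) z.
Proof. by move=> /ccontP cf /ccontP cg; apply/ccontP; exact: (continuousM cf cg). Qed.
Lemma ccontV f z : f z != 0 -> ccont f z -> ccont (fun w => (f w)^-1) z.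
Proof. by move=> f0 /ccontP cf; apply/ccontP; exact: (continuousV f0 cf). Qed.
Lemma ccont_comp f g z : ccont f z -> ccont g (f z) -> ccont (fun w => g (f w)) z.
Proof. by move=> /ccontP cf /ccontP cg; apply/ccontP; exact: (continuous_comp cf cg). Qed.
Lemma ccont_near f g z : (\forall w \near z, f w = g w) -> ccont f z -> ccont g z.
Proof.
move=> H cf e e0; have [d1 d10 H1] := cf e e0; move/nbhsC_P: H => [d2 d20 H2].
exists (Num.min d1 d2); first by rewrite lt_min d10.
move=> w; rewrite lt_min => /andP[w1 w2]; rewrite -(H2 w w2) -(H2 z) ?subrr ?nm0 //.
exact: H1.
Qed.

(** Caratheodory's form of the derivative: the difference quotient extends
continuously. *)
Definition cderiv f z d := exists phi : C -> C,
  [/\ ccont phi z, phi z = d & \forall w \near z, f w - f z = (w - z) * phi w].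

Lemma cderiv_eq f z d d' : cderiv f z d -> d = d' -> cderiv f z d'.
Proof. by move=> H <-. Qed.

Lemma cderiv_ext f g z d : (forall w, f w = g w) -> cderiv f z d -> cderiv g z d.
Proof. by move=> /funext ->. Qed.

Lemma cderiv_near f g z d : (\forall w \near z, f w = g w) -> cderiv f z d -> cderiv g z d.
Proof.
move=> H [phi [c1 c2 c3]]; exists phi; split => //.
have e := nbhs_singleton H; near=> w; rewrite -e.
have -> : g w = f w by symmetry; near: w.
by near: w.
Unshelve. all: by end_near. Qed.

Lemma cderiv_cont f z d : cderiv f z d -> ccont f z.
Proof.
move=> [phi [c1 c2 c3]].
have H : ccont (fun w => f z + (w - z) * phi w) z.
  apply: ccontD (ccont_cst _ _) (ccontM (ccontB (@ccont_id _) (ccont_cst _ _)) c1).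
apply: ccont_near H; near=> w.
have <- : f w - f z = (w - z) * phi w by near: w.
by rewrite addrC subrK.
Unshelve. all: by end_near. Qed.

Lemma cderiv_derive1 f z d : cderiv f z d -> derive1 f z = d.
Proof.
move=> [phi [c1 c2 /nbhsC_P [d1 d10 c3]]].
rewrite /derive1; apply: (@lim_punctC R (fun h => h^-1 *: (f (h + z) - f z)) 0 d) => e e0.
have [dl dl0 H] := c1 _ e0; exists (Num.min d1 dl); first by rewrite lt_min d10.
move=> h h0; rewrite subr0 lt_min => /andP[h1 h2].
have := c3 (h + z); rewrite addrK => /(_ h1) ->.
rewrite /GRing.scale /= mulrA mulVf // mul1r -c2; apply: H.
by rewrite addrK.
Qed.

Lemma cderiv_uniq f z d d' : cderiv f z d -> cderiv f z d' -> d = d'.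
Proof. by move=> /cderiv_derive1 <- /cderiv_derive1 <-. Qed.

Lemma cderiv_cst c z : cderiv (fun=> c) z 0.
Proof.
exists (fun=> 0); split => //; first exact: ccont_cst.
by near=> w; rewrite subrr mulr0.
Unshelve. all: by end_near. Qed.

Lemma cderiv_id z : cderiv id z 1.
Proof.
exists (fun=> 1); split => //; first exact: ccont_cst.
by near=> w; rewrite mulr1.
Unshelve. all: by end_near. Qed.

Lemma cderivD f g z d e : cderiv f z d -> cderiv g z e -> cderiv (fun w => f w + g w) z (d + e).
Proof.
move=> [phi [a1 a2 a3]] [psi [b1 b2 b3]]; exists (fun w => phi w + psi w); split.
- exact: ccontD a1 b1.
- by rewrite a2 b2.
- near=> w; rewrite mulrDr.
  have <- : f w - f z = (w - z) * phi w by near: w.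
  have <- : g w - g z = (w - z) * psi w by near: w.
  by ring.
Unshelve. all: by end_near. Qed.

Lemma cderivM f g z d e : cderiv f z d -> cderiv g z e ->
  cderiv (fun w => f w * g w) z (d * g z + f z * e).
Proof.
move=> [phi [a1 a2 a3]] Hg; have cg := cderiv_cont Hg; have [psi [b1 b2 b3]] := Hg.
exists (fun w => phi w * g w + f z * psi w); split.
- exact: ccontD (ccontM a1 cg) (ccontM (ccont_cst _ _) b1).
- by rewrite a2 b2.
- near=> w; rewrite mulrDr mulrA (mulrCA _ (f z)).
  have <- : f w - f z = (w - z) * phi w by near: w.
  have <- : g w - g z = (w - z) * psi w by near: w.
  by ring.
Unshelve. all: by end_near. Qed.

Lemma cderivZ c f z d : cderiv f z d -> cderiv (fun w => c * f w) z (c * d).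
Proof.
by move=> H; apply: cderiv_eq (cderivM (cderiv_cst c z) H) _; rewrite mul0r add0r.
Qed.

Lemma cderivN f z d : cderiv f z d -> cderiv (fun w => - f w) z (- d).
Proof.
move=> H; rewrite -mulN1r; apply: cderiv_ext (cderivZ (-1) H) => w.
by rewrite mulN1r.
Qed.

Lemma cont_neq0 f z : ccont f z -> f z != 0 -> \forall w \near z, f w != 0.
Proof.
move=> H fz; have [dl dl0 Hd] := H (nm (f z)) ltac:(by rewrite nm_gt0).
apply/nbhsC_P; exists dl => // w /Hd; apply: contraTneq => ->.
by rewrite sub0r nmN ltxx.
Qed.

Lemma cderivV f z d : f z != 0 -> cderiv f z d -> cderiv (fun w => (f w)^-1) z (- d / f z ^+ 2).
Proof.
move=> fz Hf; have cf := cderiv_cont Hf; have [phi [a1 a2 a3]] := Hf.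
exists (fun w => - phi w / (f w * f z)); split.
- apply: ccontM (ccontN a1) (ccontV _ (ccontM cf (ccont_cst _ _))).
  by rewrite mulf_neq0.
- by rewrite a2 expr2.
- near=> w; rewrite mulrA mulrN.
  have <- : f w - f z = (w - z) * phi w by near: w.
  have fw : f w != 0 by near: w; exact: cont_neq0.
  by field; rewrite fz fw.
Unshelve. all: by end_near. Qed.

Lemma cderiv_aff f (a b : C) z d : cderiv f (a * z + b) d ->
  cderiv (fun w => f (a * w + b)) z (a * d).
Proof.
move=> [phi [a1 a2 a3]]; exists (fun w => a * phi (a * w + b)).
have H : ccont (fun w => a * w + b) z.
  exact: ccontD (ccontM (ccont_cst _ _) (@ccont_id _)) (ccont_cst _ _).
split.
- exact: ccontM (ccont_cst _ _) (ccont_comp H a1).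
- by rewrite a2.
- move/nbhsC_P: a3 => [d1 d10 Hd]; have [d2 d20 H'] := H _ d10.
  by apply/nbhsC_P; exists d2 => // w /H' /Hd; set u := f _ => ->; ring.
Qed.

Lemma cderiv_horner (p : {poly C}) z : cderiv (horner p) z p^`().[z].
Proof.
elim/poly_ind: p => [|p c IH].
  by rewrite deriv0 horner0; apply: cderiv_ext (cderiv_cst 0 z) => w; rewrite horner0.
apply: cderiv_ext (cderiv_eq (cderivD (cderivM IH (cderiv_id z)) (cderiv_cst c z)) _) => [w|].
  by rewrite hornerMXaddC.
by rewrite derivMXaddC !hornerE; ring.
Qed.

Lemma ent_cont f z : entire f -> ccont f z.
Proof.
move=> ef; have [g [eg fg _]] := @ent_div _ (fun w => f w - f z) z (entB ef (ent_cst _)) (subrr _).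
have [M M0 HM] := ent_bound_at z eg 1.
move=> e e0; exists (Num.min 1 (e / M)); first by rewrite lt_min ltr01 divr_gt0.
move=> w; rewrite lt_min => /andP[/ltW w1]; rewrite ltr_pdivlMr // fg nmM => h.
by apply: le_lt_trans h; rewrite ler_wpM2l ?nm_ge0 // HM.
Qed.

(** The quotient of f - f(c) by z - c is entire, and its value at c is the
derivative; the bound of [ent_div] becomes Cauchy's estimate. *)
Lemma ent_cderiv f c : entire f -> exists d, cderiv f c d /\
  forall r M, 0 < r -> (forall z, nm (z - c) <= r -> nm (f z) <= M) -> nm d <= 4 * M / r.
Proof.
move=> ef; have [g [eg fg Hg]] := @ent_div _ (fun w => f w - f c) c (entB ef (ent_cst _)) (subrr _).
exists (g c); split.
  by exists g; split => //; [exact: ent_cont|near=> w; rewrite fg].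
move=> r M r0 HM; have := Hg r (2 * M) r0 _ c; rewrite subrr nm0 mulrA -natrM.
apply; last exact: ltW.
move=> z zr; apply: le_trans (nmB _ _) _; have := HM z zr; have := HM c.
by rewrite subrr nm0 (ltW r0) => /(_ isT); lra.
Unshelve. all: by end_near. Qed.

Lemma ent_deriv f : entire f -> exists F, entire F /\ forall z, cderiv f z (F z).
Proof.
move=> ef; have /choice [F HF] : forall c, exists d, cderiv f c d.
  by move=> c; have [d [H _]] := ent_cderiv c ef; exists d.
exists F; split => //; apply: ent_unif => r e e0.
have [p Hp] := ef (r + 1) (e / 4) ltac:(lra).
exists (horner p^`()); first exact: ent_poly.
move=> z zr; have [d [Hd]] := ent_cderiv z (entB ef (ent_poly p)).
have -> : d = F z - p^`().[z].
  by apply: cderiv_uniq Hd _; exact: cderivD (HF z) (cderivN (cderiv_horner p z)).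
move=> /(_ 1 (e / 4) ltr01 _); rewrite divr1 mulrCA divff ?mulr1 ?pnatr_eq0 //; apply.
by move=> w w1; apply: Hp; have := nm_tri w z; lra.
Qed.

(** Cauchy's estimate applied to u_n - f. *)
Lemma ent_deriv_lim (u : nat -> C -> C) f z (du : nat -> C) (d : C) (B : R) :
  (forall n, entire (u n)) -> entire f ->
  (forall n w, nm (w - z) <= 1 -> nm (u n w - f w) <= B * tau R n) ->
  (forall n, cderiv (u n) z (du n)) -> cderiv f z d ->
  du n @[n --> \oo] --> d.
Proof.
move=> eu ef H Hu Hd; apply: (@rate_cvg _ _ _ (4 * B)) => n.
have [d' [Hd' Hb]] := ent_cderiv z (entB (eu n) ef).
have <- : d' = du n - d by apply: cderiv_uniq Hd' _; exact: cderivD (Hu n) (cderivN Hd).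
by have := Hb 1 (B * tau R n) ltr01 (H n); rewrite divr1 mulrA.
Qed.

(** Only the derivative at 0 has to be identified, through the Taylor bound of
order 2 at small real t. *)
Lemma cderiv_cexp z : cderiv (@cexp R) z (cexp z).
Proof.
have [d [Hd _]] := ent_cderiv 0 (@ent_cexp R).
suff d1 : d = 1.
  move: Hd; rewrite d1 => Hd.
  have := @cderiv_aff (@cexp R) 1 (- z) z 1; rewrite mul1r subrr mul1r => /(_ Hd) H.
  apply: cderiv_ext (cderiv_eq (cderivZ (cexp z) H) _); last by rewrite mulr1.
  by move=> w; rewrite mul1r -cexpD addrC subrK.
have [phi [c1 c2 c3]] := Hd.
apply/eqP; rewrite -subr_eq0 -nm_eq0; apply/eqP/le_anti; rewrite nm_ge0 andbT.
apply/ler_addgt0Pr => e e0; rewrite add0r.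
have [d1 d10 H1] := c1 (e / 2) ltac:(lra).
move/nbhsC_P: c3 => [d2 d20 H2].
(* Bounds the exponential factor of the Taylor remainder, since t <= 1. *)
pose E := expR 1 : R; have E0 : 0 < E := expR_gt0 _.
have eE : 0 < e / E by rewrite divr_gt0.
pose t := Num.min (Num.min (d1 / 2) (d2 / 2)) (Num.min 1 (e / E)).
have t0 : 0 < t by rewrite !lt_min eE; lra.
have [t1 t2 t3 t4] : [/\ t <= d1 / 2, t <= d2 / 2, t <= 1 & t <= e / E].
  by rewrite /t !ge_min !lexx !orbT.
have nt : nm (toC t) = t by rewrite nm_toC gtr0_norm.
have := H1 (toC t); rewrite subr0 nt => /(_ ltac:(lra)); rewrite c2 => h1.
have := H2 (toC t); rewrite !subr0 nt cexp0 => /(_ ltac:(lra)) h2.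
have S : \sum_(i < 2) toC t ^+ i / i`!%:R = 1 + toC t :> C.
  by rewrite big_ord_recr big_ord1 /= ?expr0 ?expr1 !divr1.
have := cexp_taylor (toC t) 2; rewrite S nt (_ : 2`! = 2)%N // => h3.
have e3 : expR t <= E by rewrite ler_expR.
have {}h3 : t * nm (phi (toC t) - 1) <= t * (e / 2).
  rewrite -{1}nt -nmM mulrBr mulr1 -h2.
  have -> : cexp (toC t) - 1 - toC t = cexp (toC t) - (1 + toC t) by ring.
  apply: le_trans h3 _; apply: (@le_trans _ _ (t ^+ 2 / 2 * E)).
    by rewrite ler_wpM2l // divr_ge0 // exprn_ge0 // ltW.
  move: t4; rewrite ler_pdivlMr // => t4.
  have : t * (t * E) <= t * e by rewrite ler_wpM2l // ltW.
  by rewrite expr2; lra.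
move: h3; rewrite ler_pM2l // => h3.
have -> : d - 1 = (phi (toC t) - 1) - (phi (toC t) - d) by ring.
by apply: le_trans (nmB _ _) _; lra.
Qed.

Lemma cderiv_cexp_aff (a b : C) z : cderiv (fun w => cexp (a * w + b)) z (a * cexp (a * z + b)).
Proof. exact: cderiv_aff (cderiv_cexp _). Qed.

End ComplexDerivative.

Section Order.
Variable R : realType.
Local Notation C := (Cx R).
Implicit Types (f g : C -> C).

(** If all divisions by z - c succeeded, the bounds of [ent_div] on a large
disc would give |f(z0)| <= 2^(-m) M for every m. *)
Lemma ent_order f c : entire f -> (exists z, f z != 0) ->
  exists m g, [/\ entire g, g c != 0 & forall z, f z = (z - c) ^+ m * g z].
Proof.
move=> ef [z0 fz0]; apply: contrapT => H.
have key m : exists g, [/\ entire g, forall z, f z = (z - c) ^+ m * g z &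
  forall r M, 0 < r -> (forall z, nm (z - c) <= r -> nm (f z) <= M) ->
    forall z, nm (z - c) <= r -> nm (g z) <= (2 / r) ^+ m * M].
  elim: m => [|m [g [eg fg Hg]]].
    by exists f; split => // [z|r M r0 HM z zr]; rewrite expr0 mul1r //; exact: HM.
  have gc : g c = 0.
    by apply: contrapT => /eqP gc; apply: H; exists m, g.
  have [h [eh gh Hh]] := ent_div eg gc; exists h; split => //.
    by move=> z; rewrite fg gh exprSr mulrA.
  move=> r M r0 HM z zr.
  have := Hh r ((2 / r) ^+ m * M) r0 (Hg r M r0 HM) z zr.
  by rewrite exprS; congr (_ <= _); ring.
(* A radius for which 2 |z0 - c| / r is at most 1/2. *)
pose r := 4 * (nm (z0 - c) + 1).
have n0 := nm_ge0 (z0 - c).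
have r0 : 0 < r by rewrite /r; lra.
have [M M0 HM] := ent_bound_at c ef r.
have bnd m : nm (f z0) <= 2^-1 ^+ m * M.
  have [g [_ fg Hg]] := key m.
  have := Hg r M r0 HM z0 ltac:(rewrite /r; lra); rewrite fg nmM nmX => h.
  apply: le_trans (ler_wpM2l _ h) _; first by rewrite exprn_ge0 ?nm_ge0.
  rewrite mulrA -exprMn ler_wpM2r ?(ltW M0) // lerXn2r ?nnegrE //.
    by rewrite mulr_ge0 ?nm_ge0 // divr_ge0 // ltW.
  by rewrite mulrA ler_pdivrMr // /r; lra.
have : 0 < nm (f z0) by rewrite nm_gt0.
apply/negP; rewrite -leNgt; apply/ler_addgt0Pr => e e0; rewrite add0r.
have : (fun m : nat => 2^-1 ^+ m * M : R) @ \oo --> (0 * M : R).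
  by apply: cvgM; [apply: cvg_expr; rewrite ger0_norm //; lra|exact: cvg_cst].
rewrite mul0r => /cvgrPdist_lt /(_ e e0) [N _ /(_ N (leqnn N))] /=.
rewrite sub0r normrN => h; apply: le_trans (bnd N) _.
by apply: le_trans (ler_norm _) _; exact: ltW.
Qed.

(** At x0 factor out (z - x0)^m; the cofactor vanishes at points of the
interval arbitrarily close to x0, against its continuity. *)
Lemma ent_identity f (a b x0 : R) : a < x0 < b -> entire f ->
  (forall x : R, a < x < b -> f (toC x) = 0) -> forall z, f z = 0.
Proof.
move=> /andP[ax xb] ef H z; apply/eqP; apply: contrapT => /negP fz.
have [m [g [eg gc fg]]] := ent_order (toC x0) ef (ex_intro _ z fz).
have /nbhsC_P [dl dl0 Hd] := cont_neq0 (@ent_cont R g (toC x0) eg) gc.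
pose t := Num.min (dl / 2) ((b - x0) / 2).
have t0 : 0 < t by rewrite lt_min; lra.
have [t1 t2] : t <= dl / 2 /\ t <= (b - x0) / 2 by rewrite /t !ge_min !lexx !orbT.
have := H (x0 + t) ltac:(lra); rewrite fg rmorphD /= [X in X ^+ _]addrC addKr.
move/eqP; rewrite mulf_eq0 expf_eq0 -nm_eq0 nm_toC (gtr0_norm t0) (gt_eqF t0) andbF /=.
apply/negP; apply: Hd; rewrite addrC addKr nm_toC gtr0_norm //; lra.
Qed.

End Order.

(** * The reciprocal Gamma function *)

Section GammaProduct.
Variable R : realType.
Local Notation C := (Cx R).
Implicit Types (s z w : C).

(** Convexity of the exponential between 0 and L. *)
Lemma expR_conv (s L : R) : 0 <= s <= 1 -> expR (s * L) <= 1 - s + s * expR L.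
Proof.
move=> /andP[s0 s1]; set E := expR (s * L); have E0 : 0 <= E := expR_ge0 _.
have h1 : E * (1 + (1 - s) * L) <= expR L.
  have -> : expR L = E * expR ((1 - s) * L) by rewrite -expRD; congr expR; ring.
  by rewrite ler_wpM2l // expR_ge1Dx.
have h2 : E * (1 - s * L) <= 1.
  by rewrite -[leRHS](expRxMexpNx_1 (s * L)) ler_wpM2l // expR_ge1Dx.
have := ler_wpM2l s0 h1; have s1' : 0 <= 1 - s by lra.
by have := ler_wpM2l s1' h2; lra.
Qed.

(** The reciprocal of the n-th Gauss product: a polynomial times an
exponential, hence entire, with no exceptional s. *)
Definition rGamma_n (n : nat) s : C :=
  \prod_(0 <= k < n.+1) (s + k%:R) / n`!%:R * rpow n%:R (- s).

Lemma rGamma_nE n s : (n`!%:R * rpow n%:R s / \prod_(0 <= k < n.+1) (s + k%:R)) = (rGamma_n n s)^-1.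
Proof.
by rewrite /rGamma_n rpowN !invfM !invrK; ring.
Qed.

(** The increments of ln; the factor by which consecutive Gauss products
differ is (1 + s/(n+2)) e^(-s ln_step n). *)
Definition ln_step (n : nat) : R := ln n.+2%:R - ln n.+1%:R.

Lemma ln_stepE n : ln_step n = ln (1 + n.+1%:R^-1).
Proof.
rewrite /ln_step -ln_div ?posrE ?ltr0n //; congr ln.
by rewrite -[n.+2%:R]natr1 mulrDl divff ?pnatr_eq0 // div1r.
Qed.

Lemma ln_step_le n : ln_step n <= n.+1%:R^-1.
Proof.
have h : 0 < (n.+1%:R^-1 : R) by rewrite invr_gt0 ltr0n.
by rewrite ln_stepE; apply: le_ln1Dx; apply: lt_trans h; rewrite oppr_lt0.
Qed.

Lemma ln_step_ge n : n.+2%:R^-1 <= ln_step n.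
Proof.
rewrite -[leRHS]opprK lerNr /ln_step opprB -ln_div ?posrE ?ltr0n //.
have -> : (n.+1%:R / n.+2%:R : R) = 1 - n.+2%:R^-1.
  have : 0 < n.+1%:R :> R by rewrite ltr0n.
  rewrite -[n.+2%:R]natr1; move: (n.+1%:R) => m m0; field; lra.
by apply: le_ln1Dx; rewrite ltrN2 invf_lt1 ?ltr0n // ltr1n.
Qed.

Lemma rGamma_nS n s : rGamma_n n.+2 s = rGamma_n n.+1 s *
  ((1 + s * toC n.+2%:R^-1) * cexp (- s * toC (ln_step n))).
Proof.
rewrite /rGamma_n big_nat_recr //= /rpow /ln_step factS natrM rmorphB mulrBr cexpD.
rewrite !mulNr opprK !cexpN fmorphV /= rmorph_nat.
have h1 : (n.+2%:R : C) != 0 by rewrite pnatr_eq0.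
have h2 : (n.+1`!%:R : C) != 0 by rewrite pnatr_eq0 -lt0n fact_gt0.
have h3 := cexp_neq0 (s * toC (ln n.+1%:R)).
have h4 := cexp_neq0 (s * toC (ln n.+2%:R)).
by field; rewrite h2 h3 h4 -natrD pnatr_eq0.
Qed.

Definition ratio_cst (r : R) : R := 2 * r + 2 * r ^+ 2 + 2 * (1 + r) * r ^+ 2 * expR r.

(** The first-order terms of the two factors cancel because ln_step n =
1/(n+2) + O(1/n^2). *)
Lemma rGamma_n_ratio n s r : 1 <= r -> nm s <= r ->
  nm ((1 + s * toC n.+2%:R^-1) * cexp (- s * toC (ln_step n)) - 1) <= ratio_cst r / n.+2%:R ^+ 2.
Proof.
move=> r1 sr; set a := n.+2%:R^-1 : R; set L := ln_step n.
have a0 : 0 < a by rewrite invr_gt0 ltr0n.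
have a1 : a <= 2^-1 by rewrite lef_pV2 ?posrE ?ltr0n // ler_nat.
have La : a <= L := ln_step_ge n.
have an : n.+1%:R^-1 = a / (1 - a) :> R.
  have : 0 < n.+1%:R :> R by rewrite ltr0n.
  rewrite /a -[n.+2%:R]natr1; move: (n.+1%:R) => m m0; field; lra.
have La2 : L - a <= 2 * a ^+ 2.
  have : L <= a / (1 - a) by rewrite -an; exact: ln_step_le.
  have : a / (1 - a) <= a + 2 * a ^+ 2.
    rewrite ler_pdivrMr; last lra.
    have : 0 <= a ^+ 2 * (1 - 2 * a) by rewrite mulr_ge0 ?sqr_ge0 //; lra.
    by rewrite !expr2; lra.
  lra.
have L2a : L <= 2 * a.
  have : a * a <= 2^-1 * a by rewrite ler_wpM2r // ltW.
  by move: La2; rewrite expr2; lra.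
have L0 : 0 <= L by lra.
set rho := cexp (- s * toC L) - (1 - s * toC L).
have S : \sum_(i < 2) (- s * toC L) ^+ i / i`!%:R = 1 - s * toC L :> C.
  by rewrite big_ord_recr big_ord1 /= ?expr0 ?expr1 !divr1 mulNr.
have rhoB : nm rho <= 2 * r ^+ 2 * expR r * a ^+ 2.
  have := cexp_taylor (- s * toC L) 2; rewrite S -/rho (_ : 2`! = 2)%N // => h.
  apply: le_trans h _; rewrite nmM nmN nm_toC (ger0_norm L0).
  have b1 : nm s * L <= r * (2 * a) by apply: ler_pM; rewrite ?nm_ge0.
  have b2 : nm s * L <= r by apply: le_trans b1 _; rewrite -[leRHS]mulr1 ler_wpM2l //; lra.
  have b0 : 0 <= nm s * L by rewrite mulr_ge0 ?nm_ge0.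
  have -> : 2 * r ^+ 2 * expR r * a ^+ 2 = (r * (2 * a)) ^+ 2 / 2 * expR r by field.
  apply: ler_pM; rewrite ?expR_ge0 ?ler_expR ?divr_ge0 ?exprn_ge0 //.
  by rewrite ler_wpM2r // lerXn2r ?nnegrE //; lra.
have -> : (1 + s * toC a) * cexp (- s * toC L) - 1 =
   s * toC (a - L) - s ^+ 2 * toC (a * L) + (1 + s * toC a) * rho.
  by rewrite /rho (rmorphB (@toC R) a L) (rmorphM (@toC R) a L); ring.
have aL : a * L <= 2 * a ^+ 2 by rewrite expr2 mulrCA ler_wpM2l // ltW.
have t1 : nm (s * toC (a - L)) <= r * (2 * a ^+ 2).
  by rewrite nmM nm_toC; apply: ler_pM; rewrite ?nm_ge0 // ler0_norm; lra.
have t2 : nm (s ^+ 2 * toC (a * L)) <= r ^+ 2 * (2 * a ^+ 2).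
  rewrite nmM nm_toC nmX; apply: ler_pM; rewrite ?exprn_ge0 ?nm_ge0 //.
    by rewrite lerXn2r ?nnegrE ?nm_ge0 //; lra.
  by rewrite ger0_norm // mulr_ge0 // ltW.
have t3 : nm ((1 + s * toC a) * rho) <= (1 + r) * (2 * r ^+ 2 * expR r * a ^+ 2).
  rewrite nmM; apply: ler_pM; rewrite ?nm_ge0 //.
  apply: le_trans (nmD _ _) _; rewrite nm1 lerD2l nmM nm_toC gtr0_norm //.
  by rewrite -[leRHS]mulr1; apply: ler_pM; rewrite ?nm_ge0 //; lra.
have -> : ratio_cst r / n.+2%:R ^+ 2 = ratio_cst r * a ^+ 2 by rewrite /a exprVn.
rewrite /ratio_cst; apply: le_trans (nmD _ _) _.
by have := nmB (s * toC (a - L)) (s ^+ 2 * toC (a * L)); lra.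
Qed.

Lemma ratio_cst_ge0 r : 1 <= r -> 0 <= ratio_cst r.
Proof.
by move=> r1; rewrite /ratio_cst !addr_ge0 // ?mulr_ge0 ?exprn_ge0 ?expR_ge0 ?addr_ge0 //; lra.
Qed.

(** The product of the factors 1 + c/k^2 is bounded, since the sum of 1/k^2
over k >= 2 is at most 1. *)
Lemma prod_growth (u : nat -> R) (c : R) : 0 <= c -> (forall n, 0 <= u n) ->
  (forall n, u n.+1 <= u n * (1 + c / n.+2%:R ^+ 2)) -> forall n, u n <= u 0%N * expR c.
Proof.
move=> c0 u0 H.
(* 1/(n+2)^2 is at most the increment of 1 - 1/(n+1). *)
have key n : u n <= u 0%N * expR (c * (1 - n.+1%:R^-1)).
  elim: n => [|n IH]; first by rewrite invr1 subrr mulr0 expR0 mulr1.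
  apply: le_trans (H n) _.
  apply: (@le_trans _ _ (u 0%N * expR (c * (1 - n.+1%:R^-1)) * expR (c / n.+2%:R ^+ 2))).
    apply: ler_pM => //; last exact: expR_ge1Dx.
    by rewrite addr_ge0 // divr_ge0 // exprn_ge0.
  rewrite -mulrA -expRD ler_wpM2l // ler_expR -mulrDr ler_wpM2l //.
  rewrite -[n.+2%:R]natr1; set m := n.+1%:R.
  have m0 : 0 < m :> R by rewrite ltr0n.
  rewrite -subr_ge0; have -> : 1 - (m + 1)^-1 - (1 - m^-1 + ((m + 1) ^+ 2)^-1) =
    (m * (m + 1) ^+ 2)^-1 by field; lra.
  by rewrite invr_ge0 mulr_ge0 ?exprn_ge0; lra.
move=> n; apply: le_trans (key n) _; rewrite ler_wpM2l // ler_expR -[leRHS]mulr1 ler_wpM2l //.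
Qed.

Lemma ent_rpow (x : R) (a b : C) : entire (fun s => rpow x (a * s + b)).
Proof.
apply: ent_ext (ent_aff (a * toC (ln x)) (b * toC (ln x)) (@ent_cexp R)) => s.
by rewrite /rpow; congr cexp; ring.
Qed.

Lemma ent_rGamma_n n : entire (rGamma_n n).
Proof.
apply: entM.
  apply: entM; last exact: ent_cst.
  by apply: ent_prod => i; apply: entD; [exact: ent_id|exact: ent_cst].
by apply: ent_ext (ent_rpow n%:R (-1) 0) => s; rewrite mulN1r addr0.
Qed.

Lemma rGamma_n_bound r : 1 <= r -> exists2 B, 0 < B & forall n s, nm s <= r -> nm (rGamma_n n.+1 s) <= B.
Proof.
move=> r1; have [M M0 HM] := ent_bound (ent_rGamma_n 1) r.
exists (M * expR (ratio_cst r)); first by rewrite mulr_gt0 ?expR_gt0.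
move=> n s sr.
have := @prod_growth (fun n => nm (rGamma_n n.+1 s)) (ratio_cst r) (ratio_cst_ge0 r1) (fun=> nm_ge0 _) _ n.
move=> h; apply: le_trans (h _) _; last by rewrite ler_wpM2r ?expR_ge0 // HM.
move=> k; rewrite rGamma_nS nmM ler_wpM2l ?nm_ge0 //.
set X := _ * cexp _; have -> : X = 1 + (X - 1) by ring.
by apply: le_trans (nmD _ _) _; rewrite nm1 lerD2l; exact: rGamma_n_ratio.
Qed.

Definition rGamma s : C := lim (rGamma_n n.+1 s @[n --> \oo]).

Lemma rGamma_n_rate r : 1 <= r -> exists2 B, 0 < B & forall s, nm s <= r ->
  forall n, nm (rGamma_n n.+1 s - rGamma s) <= B * tau R n.
Proof.
move=> r1; have [B B0 HB] := rGamma_n_bound r1.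
have Cr0 := ratio_cst_ge0 r1.
exists (32 * B * (ratio_cst r + 1)); first by rewrite !mulr_gt0 //; lra.
move=> s sr.
have [l Hl] : exists l, forall n, nm (rGamma_n n.+1 s - l) <= 32 * B * (ratio_cst r + 1) * tau R n.
  apply: (@tau_cvg R (fun n => rGamma_n n.+1 s)) => n.
  have -> : rGamma_n n.+2 s - rGamma_n n.+1 s = rGamma_n n.+1 s *
     ((1 + s * toC n.+2%:R^-1) * cexp (- s * toC (ln_step n)) - 1) by rewrite rGamma_nS; ring.
  rewrite nmM; apply: (@le_trans _ _ (B * ((ratio_cst r + 1) * (tau R n / n.+1%:R)))).
    apply: ler_pM; rewrite ?nm_ge0 ?HB //; apply: le_trans (rGamma_n_ratio _ r1 sr) _.
    apply: ler_pM; rewrite ?invr_ge0 ?exprn_ge0 //; first lra.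
    rewrite expr2 invfM; apply: ler_pM; rewrite ?invr_ge0 //; last first.
      by rewrite lef_pV2 ?posrE ?ltr0n // ler_nat.
    rewrite lef_pV2 ?posrE ?root4_gt0 ?ltr0n //.
    rewrite -(@ler_pXn2r _ 4) ?nnegrE ?root4_ge0 // root4K //.
    apply: (@le_trans _ _ n.+2%:R); first by rewrite ler_nat.
    by rewrite -{1}[n.+2%:R]expr1 ler_weXn2l // ler1n.
  have := tau_telescope R n; set T := tau R n / _ => h.
  have : (B * (ratio_cst r + 1)) * T <= (B * (ratio_cst r + 1)) * (32 * (tau R n - tau R n.+1)).
    by rewrite ler_wpM2l // mulr_ge0; lra.
  by lra.
by have -> : rGamma s = l by apply: lim_seqC; exact: rate_cvg Hl.
Qed.

Lemma rGamma_n_cvg s : rGamma_n n.+1 s @[n --> \oo] --> (rGamma s : C).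
Proof.
have r1 : 1 <= nm s + 1 by have := nm_ge0 s; lra.
by have [B _ HB] := rGamma_n_rate r1; apply: rate_cvg (HB s _); lra.
Qed.

Lemma ent_rGamma : entire rGamma.
Proof.
apply: ent_unif => r e e0.
have r1 : 1 <= `|r| + 1 by have := normr_ge0 r; lra.
have [B B0 HB] := rGamma_n_rate r1.
have [N HN] := @tau_small R (e / B) ltac:(by rewrite divr_gt0).
exists (rGamma_n N.+1); first exact: ent_rGamma_n.
move=> z zr; rewrite nm_sym; apply: le_trans (HB z _ N) _; first by have := ler_norm r; lra.
by have := HN N (leqnn N); rewrite ltr_pdivlMr // => /ltW; rewrite mulrC.
Qed.

Lemma cvg_seqS (u : nat -> C) (l : C) :
  (fun n => u n.+1) n @[n --> \oo] --> l -> u n @[n --> \oo] --> l.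
Proof.
move=> /cvg_seqC H; apply/cvg_seqC => e /H [N HN].
by exists N.+1 => -[//|n]; rewrite ltnS => /HN.
Qed.

Lemma cvg_seq_eq (u v : nat -> C) (l : C) (N : nat) : (forall n, (N <= n)%N -> u n = v n) ->
  u n @[n --> \oo] --> l -> v n @[n --> \oo] --> l.
Proof.
move=> H /cvg_seqC Hu; apply/cvg_seqC => e /Hu [M HM].
exists (maxn N M) => n; rewrite geq_max => /andP[n1 n2].
by rewrite -H //; exact: HM.
Qed.

Lemma Gamma_eq s : rGamma s != 0 -> Gamma s = (rGamma s)^-1.
Proof.
move=> Gs; rewrite /Gamma; apply: lim_seqC; apply: cvg_seqS.
under eq_fun do rewrite rGamma_nE.
exact: (seqcV Gs (@rGamma_n_cvg s)).
Qed.

(** The n-th product has modulus at least x (n+1)^x / n^x with x = Re s: each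
factor |1 + s/k| is at least 1 + x/k, which is at least (1 + 1/k)^x by
convexity. *)
Lemma rGamma_lower s : 0 < ReC s <= 1 -> ReC s <= nm (rGamma s).
Proof.
move=> /andP[s0 s1]; set x := ReC s in s0 s1 *.
have key n : x * expR (x * ln n.+1%:R) <= nm (\prod_(0 <= k < n.+1) (s + k%:R) / n`!%:R).
  elim: n => [|n IH].
    rewrite big_nat1 addr0 fact0 divr1 ln1 mulr0 expR0 mulr1.
    by apply: le_trans (Re_le_nm s); exact: ler_norm.
  rewrite big_nat_recr //= factS natrM.
  have -> : \prod_(0 <= k < n.+1) (s + k%:R) * (s + n.+1%:R) / (n.+1%:R * n`!%:R) =
    \prod_(0 <= k < n.+1) (s + k%:R) / n`!%:R * (1 + s * n.+1%:R^-1).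
    have h1 : (n.+1%:R : C) != 0 by rewrite pnatr_eq0.
    have h2 : (n`!%:R : C) != 0 by rewrite pnatr_eq0 -lt0n fact_gt0.
    by move: (n.+1%:R : C) (n`!%:R : C) h1 h2 => m f h1 h2; field; rewrite h2 h1.
  rewrite nmM; have -> : ln n.+2%:R = ln n.+1%:R + ln_step n :> R by rewrite /ln_step addrC subrK.
  rewrite mulrDr expRD mulrA; apply: ler_pM IH _; rewrite ?expR_ge0 ?mulr_ge0 ?expR_ge0 ?(ltW s0) //.
  have x01 : 0 <= x <= 1 by rewrite s1 ltW.
  apply: le_trans (expR_conv (ln_step n) x01) _.
  apply: le_trans (Re_le_nm _); apply: le_trans (ler_norm _).
  have -> : n.+1%:R^-1 = toC (n.+1%:R^-1) :> C.
    by rewrite (fmorphV (@toC R)) (rmorph_nat (@toC R)).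
  rewrite !ReImE mulr0 subr0 -/x ln_stepE lnK ?posrE; first by rewrite mulrDr mulr1 addrA subrK.
  by apply: ltr_wpDr => //; rewrite invr_ge0.
rewrite leNgt; apply/negP => h.
have /cvg_seqC /(_ (x - nm (rGamma s))) [|N HN] := @rGamma_n_cvg s; first by rewrite subr_gt0.
have := HN N (leqnn N); apply/negP; rewrite -leNgt.
apply: le_trans (nm_tri _ _); rewrite lerD2r /rGamma_n nmM nm_rpow ReCN -/x mulNr expRN.
rewrite ler_pdivlMr ?expR_gt0 //; apply: le_trans (key N.+1); rewrite ler_wpM2l ?(ltW s0) //.
by rewrite ler_expR ler_wpM2l ?(ltW s0) // ler_ln ?posrE ?ltr0n // ler_nat.
Qed.

Lemma rGamma_neq0 s : 0 < ReC s <= 1 -> rGamma s != 0.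
Proof.
move=> s01; rewrite -nm_gt0; apply: lt_le_trans (rGamma_lower s01).
by case/andP: s01.
Qed.

(** Minus the n-th approximation of the digamma function. *)
Definition dign (n : nat) s : C := \sum_(0 <= k < n.+1) (s + k%:R)^-1 - toC (ln n%:R).

Lemma Re_neq0 s : 0 < ReC s -> s != 0.
Proof. by apply: contraTneq => ->; rewrite ReC0 ltxx. Qed.

Lemma cderiv_rGamma_n n s : 0 < ReC s -> cderiv (rGamma_n n) s (rGamma_n n s * dign n s).
Proof.
move=> s0.
have sk k : s + k%:R != 0 by apply: Re_neq0; rewrite !ReImE ltr_wpDr.
have P m : cderiv (fun s => \prod_(0 <= k < m) (s + k%:R)) s
   ((\prod_(0 <= k < m) (s + k%:R)) * \sum_(0 <= k < m) (s + k%:R)^-1).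
  elim: m => [|m IH].
    rewrite !big_geq // mulr0; apply: cderiv_ext (cderiv_cst 1 s) => w.
    by rewrite big_geq.
  apply: (cderiv_ext (f := fun w => (\prod_(0 <= k < m) (w + k%:R)) * (w + m%:R))).
    by move=> w; rewrite big_nat_recr.
  apply: cderiv_eq (cderivM IH (cderivD (cderiv_id s) (cderiv_cst m%:R s))) _.
  rewrite !big_nat_recr //=; set A := \prod_(_ <= _ < _) _; set B := \sum_(_ <= _ < _) _.
  by field; exact: sk.
have Q : cderiv (fun w => rpow n%:R (- w)) s (- toC (ln n%:R) * rpow n%:R (- s)).
  apply: (cderiv_ext (f := fun w => cexp (- toC (ln n%:R) * w + 0))).
    by move=> w; rewrite /rpow addr0 mulNr mulNr mulrC.
  by apply: cderiv_eq (cderiv_cexp_aff _ _ _) _; rewrite addr0 /rpow; congr (_ * cexp _); ring.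
apply: cderiv_eq (cderivM (cderivM (P n.+1) (cderiv_cst _ s)) Q) _.
by rewrite /rGamma_n /dign; ring.
Qed.

(** Derivatives converge together with the entire functions [rGamma_n]. *)
Lemma rGamma_digamma : exists F : C -> C, [/\ entire F, forall s, cderiv rGamma s (F s) &
  forall s, 0 < ReC s <= 1 -> dign n.+1 s @[n --> \oo] --> (F s / rGamma s : C)].
Proof.
have [F [eF HF]] := ent_deriv ent_rGamma; exists F; split => // s s01.
have r1 : 1 <= nm s + 1 by have := nm_ge0 s; lra.
have s0 : 0 < ReC s by case/andP: s01.
have [B B0 HB] := rGamma_n_rate r1.
have H : (rGamma_n n.+1 s * dign n.+1 s) @[n --> \oo] --> (F s : C).
  apply: (@ent_deriv_lim R (fun n => rGamma_n n.+1) rGamma s _ (F s) B) => //.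
  - by move=> n; exact: ent_rGamma_n.
  - exact: ent_rGamma.
  - by move=> n w w1; apply: HB; have := nm_tri w s; lra.
  - by move=> n; exact: cderiv_rGamma_n.
have Gs := rGamma_neq0 s01.
have H2 : rGamma_n n.+1 s * dign n.+1 s * (rGamma_n n.+1 s)^-1 @[n --> \oo] --> (F s * (rGamma s)^-1 : C).
  exact: (seqcM H (seqcV Gs (@rGamma_n_cvg s))).
have /cvg_seqC /(_ (nm (rGamma s))) [|N HN] := @rGamma_n_cvg s; first by rewrite nm_gt0.
refine (@cvg_seq_eq (fun n => rGamma_n n.+1 s * dign n.+1 s * (rGamma_n n.+1 s)^-1) _ _ N _ H2).
move=> n /HN h.
rewrite mulrAC divff ?mul1r //; apply: contraTneq h => ->.
by rewrite sub0r nmN ltxx.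
Qed.

(** The digamma function on the half-open strip 0 < Re s <= 1, which contains
all arguments 1/4, 1/4 + iz/2 and s/2 that occur. *)
Lemma logderiv_Gamma : exists psi : C -> C, [/\
  forall s, 0 < ReC s <= 1 -> cderiv (@Gamma R) s (psi s * Gamma s),
  forall s, 0 < ReC s <= 1 -> Gamma s != 0,
  forall s, 0 < ReC s <= 1 -> logderiv (@Gamma R) s = psi s,
  forall s, 0 < ReC s <= 1 -> ccont psi s &
  forall s, 0 < ReC s <= 1 -> - dign n.+1 s @[n --> \oo] --> (psi s : C)].
Proof.
have [F [eF HF Hd]] := rGamma_digamma.
have Gamma0 s : 0 < ReC s <= 1 -> Gamma s != 0.
  by move=> s01; rewrite Gamma_eq ?invr_eq0 ?rGamma_neq0.
have D s : 0 < ReC s <= 1 -> cderiv (@Gamma R) s (- (F s / rGamma s) * Gamma s).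
  move=> s01; have Gs := rGamma_neq0 s01.
  have := cderivV Gs (HF s); rewrite Gamma_eq // => H.
  apply: (cderiv_near (f := fun w => (rGamma w)^-1)); last first.
    by apply: cderiv_eq H _; field.
  have := cont_neq0 (@ent_cont R rGamma s ent_rGamma) Gs.
  by apply: filterS => w Gw; rewrite Gamma_eq.
exists (fun s => - (F s / rGamma s)); split=> [||s s01|s s01|s s01].
- exact: D.
- exact: Gamma0.
- by rewrite /logderiv (cderiv_derive1 (D s s01)) mulfK // Gamma0.
- apply: ccontN; apply: ccontM; first exact: ent_cont.
  by apply: ccontV; [exact: rGamma_neq0|exact: ent_cont ent_rGamma].
- exact: (seqcN (Hd s s01)).
Qed.

Lemma rGamma_n_conj n s : rGamma_n n s^* = (rGamma_n n s)^*.
Proof.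
rewrite /rGamma_n -rmorphN /= rpow_conj !rmorphM /= fmorphV /= rmorph_nat rmorph_prod.
congr (_ * _ * _); apply: eq_bigr => k _.
by rewrite rmorphD /= rmorph_nat.
Qed.

Lemma cvg_conj (u : nat -> C) (l : C) : u n @[n --> \oo] --> l -> (u n)^* @[n --> \oo] --> l^*.
Proof.
move=> /cvg_seqC H; apply/cvg_seqC => e /H [N HN]; exists N => n /HN.
by rewrite -rmorphB nm_conj.
Qed.

Lemma rGamma_conj s : rGamma s^* = (rGamma s)^*.
Proof.
apply: (@lim_uniqC R (fun n => rGamma_n n.+1 s^*)); first exact: rGamma_n_cvg.
by under eq_fun do rewrite rGamma_n_conj; apply: cvg_conj; exact: rGamma_n_cvg.
Qed.

End GammaProduct.

(** * Finite differences of powers *)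

Section Hasse.
Variable R : realType.
Local Notation C := (Cx R).
Implicit Types (s z w : C).

(** Weierstrass' theorem for terms of size tau n / (n + 1). *)
Lemma ent_series (u : nat -> C -> C) : (forall n, entire (u n)) ->
  (forall r, exists B, forall n z, nm z <= r -> nm (u n z) <= B * (tau R n / n.+1%:R)) ->
  entire (fun z => lim (series (u ^~ z) @ \oo)) /\
  forall z, series (u ^~ z) n @[n --> \oo] --> (lim (series (u ^~ z) @ \oo) : C).
Proof.
move=> eu H.
have rate r : exists B, forall z, nm z <= r -> forall n,
    nm (series (u ^~ z) n - lim (series (u ^~ z) @ \oo)) <= B * tau R n.
  have [B HB] := H r; exists (32 * B) => z zr.
  have [l Hl] := tau_cvg_series (fun n => HB n z zr) => n.
  by rewrite (lim_seqC (rate_cvg Hl)).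
split; last first.
  by move=> z; have [B HB] := rate (nm z); apply: rate_cvg (HB z (lexx _)).
apply: ent_unif => r e e0; have [B HB] := rate r.
have [N HN] := @tau_small R (e / (`|B| + 1)) ltac:(by rewrite divr_gt0 // ltr_wpDl).
exists (fun z => series (u ^~ z) N).
  by apply: ent_sum => i; exact: eu.
move=> z zr; rewrite nm_sym; apply: le_trans (HB z zr N) _.
have := HN N (leqnn N); rewrite ltr_pdivlMr ?ltr_wpDl // => h.
have : B * tau R N <= `|B| * tau R N by rewrite ler_wpM2r ?ler_norm // ltW ?tau_gt0.
by have := tau_gt0 R N; lra.
Qed.

(** Pascal's rule: a binomial alternating sum is a difference of two shorter
ones. *)
Lemma alt_binomS (a : nat -> C) n :
  \sum_(0 <= k < n.+2) (-1) ^+ k * 'C(n.+1, k)%:R * a k =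
  \sum_(0 <= k < n.+1) (-1) ^+ k * 'C(n, k)%:R * a k -
  \sum_(0 <= k < n.+1) (-1) ^+ k * 'C(n, k)%:R * a k.+1.
Proof.
have -> : \sum_(0 <= k < n.+1) (-1) ^+ k * 'C(n, k)%:R * a k =
          \sum_(0 <= k < n.+2) (-1) ^+ k * 'C(n, k)%:R * a k.
  by rewrite [RHS]big_nat_recr //= bin_small // mulr0 mul0r addr0.
rewrite !(big_nat_recl n.+1) //= !bin0 -addrA; congr (_ + _).
rewrite -sumrB; apply: eq_bigr => k _.
by rewrite binS natrD exprS; ring.
Qed.

(** The n-th iterate of f(y) -> f(y) - f(y + 1), applied to y^(-z); the n-th
term of Hasse's series is hdiff n (s - 1) 1 / (n + 1). *)
Definition hdiff (n : nat) z (x : R) : C :=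
  \sum_(0 <= k < n.+1) (-1) ^+ k * 'C(n, k)%:R * rpow (x + k%:R) (- z).

Lemma hdiffS n z x : hdiff n.+1 z x = hdiff n z x - hdiff n z (x + 1).
Proof.
rewrite /hdiff (alt_binomS (fun k => rpow (x + k%:R) (- z))); congr (_ - _).
by apply: eq_bigr => k _; rewrite -addrA -[k.+1%:R]natr1 [1 + _]addrC.
Qed.

Lemma hdiff0 z x : hdiff 0 z x = rpow x (- z).
Proof. by rewrite /hdiff big_nat1 bin0 expr0 addr0 !mul1r. Qed.

Lemma hasd_hdiff n z x : 0 < x -> hasd (hdiff n z) x (- z * hdiff n (z + 1) x).
Proof.
move=> x0; elim: n x x0 => [|n IH] x x0.
  apply: (@hasd_ext R (fun y => rpow y (- z))) => [y|]; first by rewrite hdiff0.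
  apply: hasd_eq (hasd_rpow (- z) x0 (is_derive_id x (1 : R))) _.
  rewrite hdiff0 opprD rpowD -mulrA; congr (_ * _); rewrite mulrC; congr (_ * _).
  have -> : (-1 : C) = toC (-1) by rewrite rmorphN1.
  by rewrite rpow_toC mulN1r expRN lnK ?posrE // div1r.
apply: (@hasd_ext R (fun y => hdiff n z y - hdiff n z (y + 1))) => [y|]; first by rewrite hdiffS.
have x1 : 0 < x + 1 by lra.
have H : hasd (fun y => hdiff n z (y + 1)) x (- z * hdiff n (z + 1) (x + 1)).
  have [H1 H2] := IH _ x1.
  have D : is_derive x (1 : R) (fun y : R => y + 1) 1.
    by apply: (drv_eq (drvD (is_derive_id x (1 : R)) (is_derive_cst (1 : R) x (1 : R)))) => //; rewrite addr0.
  split.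
    by apply: (drv_eq (drv_comp (g := fun y : R => y + 1) H1 D)) => //; rewrite mulr1.
  by apply: (drv_eq (drv_comp (g := fun y : R => y + 1) H2 D)) => //; rewrite mulr1.
by apply: hasd_eq (hasdB (IH _ x0) H) _; rewrite hdiffS mulrBr.
Qed.

Definition poch_ratio (n : nat) z (t : R) : R := \prod_(0 <= k < n) (nm (z + k%:R) / (t + k%:R)).

Lemma poch_ratioS n z t : poch_ratio n.+1 z t = nm z / t * poch_ratio n (z + 1) (t + 1).
Proof.
rewrite /poch_ratio big_nat_recl // !addr0; congr (_ * _); apply: eq_bigr => k _.
by rewrite -!addrA -!(natrD _ 1 k).
Qed.

Lemma poch_ratio_ge0 n z t : 0 < t -> 0 <= poch_ratio n z t.
Proof.
move=> t0; rewrite /poch_ratio; apply: prodr_ge0 => k _.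
by rewrite divr_ge0 ?nm_ge0 // addr_ge0 // ltW.
Qed.

Lemma poch_ratio_diag n t : 0 < t -> poch_ratio n (toC t) t = 1.
Proof.
move=> t0; rewrite /poch_ratio big1 // => k _.
have tk : 0 < t + k%:R by rewrite ltr_wpDr.
by rewrite -(rmorph_nat (@toC R)) -(rmorphD (@toC R)) nm_toC gtr0_norm // divff // gt_eqF.
Qed.

Definition hdiffR n (t x : R) : R := ReC (hdiff n (toC t) x).

(** Comparison of the differences of y^(-z) with those of y^(-t), t > 0 real,
which are nonnegative. By induction: hdiff n.+1 is the increment of hdiff n
over [x, x + 1], whose derivative is -z times hdiff n for the exponent z + 1,
so the mean value inequality reduces n.+1 to n with z + 1 and t + 1. *)
Lemma hdiff_dom n : forall z (t x : R), 0 < t -> ReC z <= t -> 0 < x ->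
  nm (hdiff n z x) <= poch_ratio n z t * expR ((t - ReC z) * ln (x + n%:R)) * hdiffR n t x.
Proof.
elim: n => [|n IH] z t x t0 zt x0.
  rewrite /hdiffR !hdiff0 /poch_ratio big_geq // mul1r nm_rpow ReCN addr0.
  rewrite -(rmorphN (@toC R)) rpow_toC Re_toC -expRD ler_expR; lra.
have Dr0 y u : 0 < y -> 0 < u -> 0 <= hdiffR n u y.
  move=> y0 u0; have := IH (toC u) u y u0 (lexx _) y0.
  rewrite poch_ratio_diag // Re_toC subrr mul0r expR0 !mul1r; apply: le_trans; exact: nm_ge0.
pose K := poch_ratio n.+1 z t * expR ((t - ReC z) * ln (x + n.+1%:R)).
have dk y : x <= y <= x + 1 -> is_derive y (1 : R) (fun y => - K * hdiffR n t y) (K * t * hdiffR n (t + 1) y).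
  move=> /andP[xy _]; have y0 : 0 < y by lra.
  have [H _] := hasd_hdiff n (toC t) y0.
  apply: (drv_eq (drvZ (- K) H)) => //.
  have -> : toC t + 1 = toC (t + 1) by rewrite rmorphD rmorph1.
  by rewrite !ReImE /hdiffR; ring.
rewrite hdiffS nm_sym -/K.
have -> : K * hdiffR n.+1 t x = - K * hdiffR n t (x + 1) - (- K * hdiffR n t x).
  by rewrite /hdiffR hdiffS !ReImE; ring.
have x1 : x <= x + 1 by lra.
have := @mean_value_ineq R (hdiff n z) (fun y => - z * hdiff n (z + 1) y) (fun y => - K * hdiffR n t y)
  (fun y => K * t * hdiffR n (t + 1) y) x (x + 1) x1 _ dk; apply.
  by move=> y /andP[xy _]; apply: hasd_hdiff; lra.
move=> y /andP[xy yx]; have y0 : 0 < y by lra.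
rewrite nmM nmN.
have t1 : 0 < t + 1 by lra.
have zt1 : ReC (z + 1) <= t + 1 by rewrite !ReImE lerD2r.
apply: le_trans (ler_wpM2l (nm_ge0 z) (IH (z + 1) (t + 1) y t1 zt1 y0)) _.
rewrite mulrA ler_wpM2r ?Dr0 // /K poch_ratioS.
have -> : nm z / t * poch_ratio n (z + 1) (t + 1) * expR ((t - ReC z) * ln (x + n.+1%:R)) * t =
  nm z * (poch_ratio n (z + 1) (t + 1) * expR ((t - ReC z) * ln (x + n.+1%:R))) by field; lra.
rewrite ler_wpM2l ?nm_ge0 // ler_wpM2l ?poch_ratio_ge0 // ler_expR !ReImE.
have -> : t + 1 - (ReC z + 1) = t - ReC z by ring.
rewrite ler_wpM2l ?subr_ge0 // ler_ln ?posrE; last 2 first.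
- by rewrite ltr_wpDr.
- by rewrite ltr_wpDr.
by rewrite -[n.+1%:R]natr1; lra.
Qed.

(** From y^(-z) = y y^(-z-1) and (n+1) C(n,k) = (n+1-k) C(n+1,k). *)
Lemma hdiff_avg_step n z : n.+2%:R * hdiff n.+1 (z + 1) 1 = hdiff n.+1 z 1 + n.+1%:R * hdiff n (z + 1) 1.
Proof.
rewrite /hdiff !mulr_sumr [in RHS](_ : \sum_(0 <= i < n.+1) _ =
   \sum_(0 <= k < n.+2) n.+1%:R * ((-1) ^+ k * 'C(n, k)%:R * rpow (1 + k%:R) (- (z + 1)))); last first.
  by rewrite [RHS]big_nat_recr //= bin_small // mulr0 mul0r mulr0 addr0.
rewrite -big_split /= big_nat_cond [RHS]big_nat_cond; apply: eq_bigr => k /andP[/andP[_ kn] _].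
have -> : rpow (1 + k%:R) (- z) = k.+1%:R * rpow (1 + k%:R) (- (z + 1)) :> C.
  rewrite opprD rpowD [RHS]mulrCA; have -> : (-1 : C) = toC (-1) by rewrite rmorphN1.
  have k0 : (0 : R) < 1 + k%:R by rewrite ltr_wpDr.
  rewrite rpow_toC mulN1r expRN lnK ?posrE // -[k.+1%:R]natr1.
  have -> : k%:R + 1 = toC (1 + k%:R) :> C by rewrite rmorphD rmorph1 rmorph_nat addrC.
  by rewrite -(rmorphM (@toC R)) divff ?gt_eqF // rmorph1 mulr1.
have : (n.+1 * 'C(n, k) = (n.+1 - k) * 'C(n.+1, k))%N by rewrite -mul_bin_down.
move/(congr1 (fun m : nat => m%:R : C)); rewrite !natrM natrB; last by lia.
move=> h; set A := rpow _ _; set e := (-1) ^+ k.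
have -> : n.+1%:R * (e * 'C(n, k)%:R * A) = e * A * (n.+1%:R * 'C(n, k)%:R) by ring.
by rewrite h -[n.+2%:R]natr1 -[k.+1%:R]natr1; ring.
Qed.

(** Raising the exponent by one averages the differences: this is how the
decay in n is propagated from one integer exponent to the next. *)
Lemma hdiff_avg n z : n.+1%:R * hdiff n (z + 1) 1 = \sum_(0 <= m < n.+1) hdiff m z 1.
Proof.
elim: n => [|n IH]; last by rewrite hdiff_avg_step IH [RHS]big_nat_recr //= addrC.
by rewrite big_nat1 mul1r !hdiff0 /rpow ln1 !mulr0.
Qed.

Lemma hdiff_z0 n x : hdiff n 0 x = (n == 0)%:R.
Proof.
elim: n x => [|n IH] x; first by rewrite hdiff0 oppr0 /rpow mul0r cexp0.
by rewrite hdiffS !IH subrr.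
Qed.

Lemma tau_sum n : \sum_(0 <= k < n.+1) tau R k <= 2 * (n.+1%:R * tau R n).
Proof.
elim: n => [|n IH]; first by rewrite big_nat1 mul1r; have := tau_gt0 R 0; lra.
rewrite big_nat_recr //=.
have key : 2 * n.+1%:R * tau R n <= (2 * n.+1%:R + 1) * tau R n.+1.
  rewrite /tau; set t := n.+1%:R; have t1 : 1 <= t by rewrite ler1n.
  have t2 : n.+2%:R = t + 1 :> R by rewrite -natr1.
  rewrite t2; set a := root4 t; set b := root4 (t + 1).
  have a0 : 0 < a by rewrite root4_gt0; lra.
  have b0 : 0 < b by rewrite root4_gt0; lra.
  rewrite ler_pdivrMr // mulrAC ler_pdivlMr //.
  rewrite -(@ler_pXn2r _ 4) // ?nnegrE; last 2 first.
  - by rewrite !mulr_ge0 //; lra.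
  - by rewrite !mulr_ge0 //; lra.
  rewrite !exprMn !root4K; [|lra..].
  have h3 : 0 <= t ^+ 3 by rewrite exprn_ge0; lra.
  have h4 : 0 <= t ^+ 4 by rewrite exprn_ge0; lra.
  have h2 : 0 <= t ^+ 2 by rewrite exprn_ge0; lra.
  have -> : (2 * t + 1) ^+ 4 * t = 2 ^+ 4 * t ^+ 4 * (t + 1) + (16 * t ^+ 4 + 24 * t ^+ 3 + 8 * t ^+ 2 + t) by ring.
  lra.
have : n.+2%:R = n.+1%:R + 1 :> R by rewrite -natr1.
by move=> ->; lra.
Qed.

(** For m = 0 the difference is 1/(n+1), and averaging preserves the rate tau
up to a factor 2. *)
Lemma hdiffR_bound m n : hdiffR n m.+1%:R 1 <= 2 ^+ m * tau R n.
Proof.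
elim: m n => [|m IH] n.
  have := hdiff_avg n 0; rewrite add0r (eq_bigr (fun k : nat => (k == 0%N)%:R)); last first.
    by move=> k _; rewrite hdiff_z0.
  rewrite big_nat_recl //= big1 ?addr0 // => h.
  have -> : hdiffR n 1 1 = n.+1%:R^-1.
    rewrite /hdiffR rmorph1; have n0 : (n.+1%:R : C) != 0 by rewrite pnatr_eq0.
    have -> : hdiff n 1 1 = n.+1%:R^-1 by apply: (mulfI n0); rewrite h divff.
    by rewrite -(rmorph_nat (@toC R)) -(fmorphV (@toC R)).
  rewrite expr0 mul1r lef_pV2 ?posrE ?root4_gt0 ?ltr0n //.
  rewrite -(@ler_pXn2r _ 4) ?nnegrE ?root4_ge0 // root4K //.
  by rewrite -{1}[n.+1%:R]expr1 ler_weXn2l // ler1n.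
have n0 : 0 < n.+1%:R :> R by rewrite ltr0n.
rewrite -(ler_pM2l n0).
have -> : n.+1%:R * hdiffR n m.+2%:R 1 = \sum_(0 <= k < n.+1) hdiffR k m.+1%:R 1.
  transitivity (ReC (n.+1%:R * hdiff n (toC m.+2%:R) 1)).
    by rewrite ReCM ReC_nat ImC_nat mul0r subr0.
  have -> : toC m.+2%:R = toC m.+1%:R + 1 :> C.
    by have -> : m.+2%:R = m.+1%:R + 1 :> R; [rewrite natr1|rewrite rmorphD rmorph1].
  rewrite hdiff_avg; rewrite /hdiffR.
  by apply: (big_morph (@ReC R) (@ReCD R) (ReC0 R)).
apply: (@le_trans _ _ (\sum_(0 <= k < n.+1) 2 ^+ m * tau R k)); first exact: ler_sum.
rewrite -mulr_sumr exprS; apply: le_trans (ler_wpM2l _ (tau_sum n)) _; first by rewrite exprn_ge0.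
by rewrite le_eqVlt; apply/orP; left; apply/eqP; ring.
Qed.

End Hasse.

(** * The entire function (s - 1) zeta(s) *)

Section HasseEntire.
Variable R : realType.
Local Notation C := (Cx R).
Implicit Types (s z w : C).

Lemma fact_ge a b : (a`! * a.+1 ^ b <= (a + b)`!)%N.
Proof.
elim: b => [|b IH]; first by rewrite expn0 muln1 addn0.
rewrite addnS factS expnSr mulnA mulnC; apply: leq_mul => //.
by rewrite ltnS leq_addr.
Qed.

Lemma rising_fact m n : (\prod_(0 <= k < n) (m.+1 + k) * m`! = (m + n)`!)%N.
Proof.
elim: n => [|n IH]; first by rewrite big_geq // mul1n addn0.
by rewrite big_nat_recr //= mulnAC IH addnS factS mulnC addSn.
Qed.

Lemma ln_step_le1 n : 0 <= ln_step R n <= 1.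
Proof.
have h := ln_step_ge R n; have h2 := ln_step_le R n.
apply/andP; split; first by apply: le_trans h; rewrite invr_ge0.
by apply: le_trans h2 _; rewrite invf_le1 ?ltr0n // ler1n.
Qed.

(** The numerator is controlled by the boundedness of the Gauss products, the
denominator is a quotient of factorials; the powers of n cancel. *)
Lemma poch_ratio_bound (r : R) m : 1 <= r -> r <= m.+1%:R -> exists2 B, 0 < B & forall n z,
  nm z <= r -> poch_ratio n.+2 z m.+1%:R * expR ((m.+1%:R - ReC z) * ln (1 + n.+2%:R)) <= B.
Proof.
move=> r1 rm; have [B B0 HB] := rGamma_n_bound r1.
exists (B * m`!%:R * expR (2 * r + m.+1%:R)).
  by rewrite !mulr_gt0 ?expR_gt0 // ltr0n fact_gt0.
move=> n z zr; set sg := ReC z; set M := m.+1%:R : R.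
have sgr : `|sg| <= r by apply: le_trans zr; exact: Re_le_nm.
have f0 : 0 < n.+1`!%:R :> R by rewrite ltr0n fact_gt0.
have g0 : 0 < m`!%:R :> R by rewrite ltr0n fact_gt0.
have num : \prod_(0 <= k < n.+2) nm (z + k%:R) <= B * n.+1`!%:R * expR (sg * ln n.+1%:R).
  have := HB n z zr; rewrite /rGamma_n !nmM nmV nm_nat nm_prod nm_rpow ReCN -/sg mulNr expRN.
  by rewrite ler_pdivrMr ?expR_gt0 // ler_pdivrMr // mulrAC.
have den : n.+1`!%:R * expR (M * ln n.+2%:R) <= (\prod_(0 <= k < n.+2) (M + k%:R)) * m`!%:R.
  have -> : \prod_(0 <= k < n.+2) (M + k%:R) = (\prod_(0 <= k < n.+2) (m.+1 + k))%:R :> R.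
    by rewrite natr_prod; apply: eq_bigr => k _; rewrite natrD.
  rewrite -natrM rising_fact.
  have -> : expR (M * ln n.+2%:R) = (n.+2 ^ m.+1)%:R.
    by rewrite /M expRM_natl lnK ?posrE ?ltr0n // natrX.
  rewrite -natrM ler_nat; apply: leq_trans (fact_ge _ _) _.
  by apply: eq_leq; congr (_`!); lia.
have den0 : 0 < \prod_(0 <= k < n.+2) (M + k%:R) :> R.
  by apply: prodr_gt0 => k _; rewrite ltr_wpDr // ltr0n.
rewrite /poch_ratio prodf_div mulrAC ler_pdivrMr //.
apply: (@le_trans _ _ (B * n.+1`!%:R * expR (sg * ln n.+1%:R) * expR ((M - sg) * ln (1 + n.+2%:R)))).
  by rewrite ler_wpM2r ?expR_ge0.
apply: (@le_trans _ _ (B * expR (2 * r + M) * (n.+1`!%:R * expR (M * ln n.+2%:R)))); last first.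
  have -> : B * m`!%:R * expR (2 * r + M) * \prod_(0 <= k < n.+2) (M + k%:R) =
    B * expR (2 * r + M) * (\prod_(0 <= k < n.+2) (M + k%:R) * m`!%:R) by ring.
  by rewrite ler_wpM2l // mulr_ge0 ?expR_ge0 // ltW.
have -> : B * n.+1`!%:R * expR (sg * ln n.+1%:R) * expR ((M - sg) * ln (1 + n.+2%:R)) =
  B * n.+1`!%:R * expR (sg * ln n.+1%:R + (M - sg) * ln (1 + n.+2%:R)) by rewrite expRD; ring.
have -> : B * expR (2 * r + M) * (n.+1`!%:R * expR (M * ln n.+2%:R)) =
  B * n.+1`!%:R * expR (2 * r + M + M * ln n.+2%:R).
  by rewrite [in RHS]expRD; ring.
apply: ler_wpM2l; first by rewrite mulr_ge0 ?(ltW B0) ?(ltW f0).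
rewrite ler_expR.
have -> : 1 + n.+2%:R = n.+3%:R :> R by rewrite addrC natr1.
have e1 : ln n.+3%:R = ln n.+1%:R + ln_step R n + ln_step R n.+1 :> R.
  by rewrite /ln_step [ln n.+1%:R + _]addrC subrK addrC subrK.
have e2 : ln n.+2%:R = ln n.+1%:R + ln_step R n :> R by rewrite /ln_step addrC subrK.
rewrite e1 e2; move: (ln_step_le1 n) (ln_step_le1 n.+1).
move: (ln_step R n) (ln_step R n.+1) (ln n.+1%:R) => a b l /andP[a0 a1] /andP[b0 b1].
have M1 : 1 <= M by rewrite ler1n.
have h1 : - sg * (a + b) <= r * 2.
  apply: le_trans (ler_norm _) _; rewrite normrM normrN; apply: ler_pM => //.
  by rewrite ger0_norm; lra.
have h2 : M * b <= M * 1 by rewrite ler_wpM2l //; lra.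
lra.
Qed.

Lemma ent_hdiff n (x : R) : entire (fun z => hdiff n z x).
Proof.
apply: ent_sum => k; apply: entM; first exact: ent_cst.
by apply: ent_ext (ent_rpow (x + k%:R) (-1) 0) => s; rewrite mulN1r addr0.
Qed.

(** Locally uniform decay of the differences, by comparison with an integer
exponent above Re z. *)
Lemma hdiff_bound (r : R) : exists B, forall n z, nm z <= r -> nm (hdiff n z 1) <= B * tau R n.
Proof.
wlog r1 : r / 1 <= r.
  move=> H; have [|B HB] := H (`|r| + 1); first by rewrite ler_wpDl.
  by exists B => n z zr; apply: HB; have := ler_norm r; lra.
(* The comparison exponent t = m + 1 >= r >= Re z. *)
pose m := Num.truncn r.
have rm : r <= m.+1%:R by apply: ltW; exact: truncnS_gt.
have [B B0 HB] := poch_ratio_bound r1 rm.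
have [M0 M00 H0] := ent_bound (ent_hdiff 0 1) r.
have [M1 M10 H1] := ent_bound (ent_hdiff 1 1) r.
have t1 := tau_gt0 R 1.
have key n z : nm z <= r -> nm (hdiff n.+2 z 1) <= B * 2 ^+ m * tau R n.+2.
  move=> zr; have m0 : 0 < m.+1%:R :> R by rewrite ltr0n.
  have zm : ReC z <= m.+1%:R.
    by have := Re_le_nm z; have := ler_norm (ReC z); lra.
  apply: le_trans (hdiff_dom n.+2 m0 zm ltr01) _.
  rewrite -[leRHS]mulrA; apply: ler_pM; rewrite ?mulr_ge0 ?poch_ratio_ge0 ?expR_ge0 ?HB //.
    have := hdiff_dom n.+2 (z := toC m.+1%:R) m0 (lexx _) ltr01.
    rewrite poch_ratio_diag // Re_toC subrr mul0r expR0 !mul1r; apply: le_trans; exact: nm_ge0.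
  exact: hdiffR_bound.
exists (B * 2 ^+ m + (M0 + M1) / tau R 1) => n z zr.
have q0 : 0 <= (M0 + M1) / tau R 1 by rewrite divr_ge0 //; lra.
have B20 : 0 <= B * 2 ^+ m by rewrite mulr_ge0 ?exprn_ge0 // ltW.
have small k : (k <= 1)%N -> M0 + M1 <= (B * 2 ^+ m + (M0 + M1) / tau R 1) * tau R k.
  move=> k1; apply: (@le_trans _ _ ((M0 + M1) / tau R 1 * tau R 1)).
    by rewrite divfK // gt_eqF.
  apply: ler_pM; rewrite ?(ltW t1) //; first by lra.
  exact: tau_noninc.
case: n => [|[|n]].
- by apply: le_trans (H0 z zr) _; apply: le_trans (small 0%N _) => //; lra.
- by apply: le_trans (H1 z zr) _; apply: le_trans (small 1%N _) => //; lra.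
apply: le_trans (key n z zr) _; rewrite ler_wpM2r ?(ltW (tau_gt0 _ _)) //; lra.
Qed.

Definition hterm n s : C := n.+1%:R^-1 * \sum_(0 <= k < n.+1)
      (-1) ^+ k * 'C(n, k)%:R * rpow k.+1%:R (1 - s).

(** (s - 1) zeta(s), the sum of Hasse's series. *)
Definition Hs s : C := lim (series (hterm ^~ s) @ \oo).

Lemma zetaE s : zeta s = (s - 1)^-1 * Hs s. Proof. by []. Qed.

Lemma htermE n s : hterm n s = n.+1%:R^-1 * hdiff n (s - 1) 1.
Proof.
rewrite /hterm /hdiff; congr (_ * _); apply: eq_bigr => k _.
by rewrite opprB -[k.+1%:R]natr1 addrC.
Qed.

Lemma Hs_theory : entire Hs /\ forall s, series (hterm ^~ s) n @[n --> \oo] --> (Hs s : C).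
Proof.
apply: ent_series.
  move=> n; apply: ent_ext (entZ n.+1%:R^-1 (ent_aff 1 (-1) (ent_hdiff n 1))) => s.
  by rewrite htermE mul1r.
move=> r; have [B HB] := hdiff_bound (r + 1); exists B => n z zr.
rewrite htermE nmM nmV nm_nat mulrC mulrA ler_wpM2r ?invr_ge0 //.
by apply: HB; have := nmB z 1; rewrite nm1; lra.
Qed.

Lemma ent_Hs : entire Hs. Proof. by have [] := Hs_theory. Qed.
Lemma Hs_cvg s : series (hterm ^~ s) n @[n --> \oo] --> (Hs s : C).
Proof. by have [_] := Hs_theory; apply. Qed.

(** At s = 1 the powers are constant and all differences but the first vanish.
*)
Lemma Hs1 : Hs 1 = 1.
Proof.
apply: lim_seqC; apply: (@cvg_seq_eq R (fun=> 1) _ 1 1); last exact: seqc_cst.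
move=> [//|n] _; rewrite /series /= big_nat_recl // htermE subrr hdiff_z0 invr1 mul1r.
rewrite big1 ?addr0 // => k _.
by rewrite htermE subrr hdiff_z0 mulr0.
Qed.

Lemma hterm_conj n s : hterm n s^* = (hterm n s)^*.
Proof.
rewrite /hterm rmorphM fmorphV rmorph_nat /=; congr (_ * _).
rewrite rmorph_sum; apply: eq_bigr => k _.
rewrite !rmorphM rmorphXn rmorphN1 rmorph_nat /=; congr (_ * _).
by rewrite -rpow_conj rmorphB rmorph1.
Qed.

Lemma Hs_conj s : Hs s^* = (Hs s)^*.
Proof.
apply: (@lim_uniqC R (series (hterm ^~ s^*))); first exact: Hs_cvg.
have -> : series (hterm ^~ s^*) = fun n => (series (hterm ^~ s) n)^*.
  by apply/funext => n; rewrite /series /= rmorph_sum; apply: eq_bigr => k _; rewrite hterm_conj.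
by apply: cvg_conj; exact: Hs_cvg.
Qed.

End HasseEntire.

(** * Integrals of nonnegative continuous functions *)

Section PositiveIntegrals.
Variable R : realType.
Implicit Types (f g h : R -> R) (v w : R).
Local Notation mu := (@lebesgue_measure R).

Definition cont f := forall x : R, {for x, continuous f}.

Lemma cont_cst v : cont (fun=> v).
Proof. by move=> x; exact: cst_continuous. Qed.
Lemma cont_id : cont id.
Proof. by move=> x; exact: cvg_id. Qed.
Lemma contD f g : cont f -> cont g -> cont (fun x => f x + g x).
Proof. by move=> cf cg x; exact: (continuousD (cf x) (cg x)). Qed.
Lemma contN f : cont f -> cont (fun x => - f x).
Proof. by move=> cf x; exact: (continuousN (cf x)). Qed.
Lemma contB f g : cont f -> cont g -> cont (fun x => f x - g x).
Proof. by move=> cf cg; exact: contD cf (contN cg). Qed.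
Lemma contM f g : cont f -> cont g -> cont (fun x => f x * g x).
Proof. by move=> cf cg x; exact: (continuousM (cf x) (cg x)). Qed.
Lemma contV f : (forall x, f x != 0) -> cont f -> cont (fun x => (f x)^-1).
Proof. by move=> f0 cf x; exact: (continuousV (f0 x) (cf x)). Qed.
Lemma cont_comp f g : cont f -> cont g -> cont (fun x => g (f x)).
Proof. by move=> cf cg x; exact: (continuous_comp (cf x) (cg (f x))). Qed.
Lemma cont_exp f : cont f -> cont (fun x => expR (f x)).
Proof. by move=> cf; apply: (cont_comp cf) => x; exact: continuous_expR. Qed.
Lemma contX f n : cont f -> cont (fun x => f x ^+ n).
Proof.
move=> cf; elim: n => [|n IH]; first exact: cont_cst.
have := contM cf IH; congr cont; apply/funext => x; by rewrite exprS.
Qed.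
Lemma contZ v f : cont f -> cont (fun x => v * f x).
Proof. by move=> cf; exact (contM (@cont_cst v) cf). Qed.
Lemma cont_ext f g : (forall x, f x = g x) -> cont f -> cont g.
Proof. by move=> /funext ->. Qed.
Lemma drv_cont f f' : (forall y : R, is_derive y (1 : R) f (f' y)) -> cont f.
Proof.
by move=> H x; apply/differentiable_continuous/derivable1_diffP; have [] := H x.
Qed.

Lemma cont_meas f : cont f -> measurable_fun setT f.
Proof. by move=> cf; exact: continuous_measurable_fun. Qed.
Lemma cont_measE f : cont f -> measurable_fun setT (EFin \o f).
Proof. by move=> cf; apply/measurable_EFinP; exact: cont_meas. Qed.

(** f is continuous and nonnegative and its integral over R is the real number
v. The conjunction carries the side conditions of all the integral
manipulations. *)
Definition hasI f v := [/\ cont f, (forall x, 0 <= f x) & (\int[mu]_x (f x)%:E)%E = v%:E].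

Lemma hasI_ext f g v w : (forall x, f x = g x) -> v = w -> hasI f v -> hasI g w.
Proof. by move=> /funext -> ->. Qed.

Lemma hasI_uniq f v w : hasI f v -> hasI f w -> v = w.
Proof. by move=> [_ _ e1] [_ _ e2]; apply: EFin_inj; rewrite -e1 -e2. Qed.

Lemma hasI_ge0 f v : hasI f v -> 0 <= v.
Proof.
by move=> [_ f0 e]; rewrite -lee_fin -e; apply: integral_ge0 => x _; rewrite lee_fin.
Qed.

Lemma hasI_add f g v w : hasI f v -> hasI g w -> hasI (fun x => f x + g x) (v + w).
Proof.
move=> [cf f0 e1] [cg g0 e2]; split; first exact: contD.
  by move=> x; rewrite addr_ge0.
rewrite EFinD -e1 -e2 -ge0_integralD //; first by move=> x _; rewrite lee_fin.
- exact: cont_measE.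
- by move=> x _; rewrite lee_fin.
- exact: cont_measE.
Qed.

Lemma hasI_scale c f v : 0 <= c -> hasI f v -> hasI (fun x => c * f x) (c * v).
Proof.
move=> c0 [cf f0 e1]; split; first exact: contZ.
  by move=> x; rewrite mulr_ge0.
rewrite EFinM -e1 -ge0_integralZl //; first exact: cont_measE.
by move=> x _; rewrite lee_fin.
Qed.

(** Domination gives finiteness, and the value is then some real number. *)
Lemma hasI_dom f g w : cont f -> (forall x, 0 <= f x <= g x) -> hasI g w -> exists v, hasI f v.
Proof.
move=> cf fg [cg g0 e].
have f0 x : 0 <= f x by case/andP: (fg x).
have : (\int[mu]_x (f x)%:E <= w%:E)%E.
  rewrite -e; apply: ge0_le_integral => //.
  - by move=> x _; rewrite lee_fin.
  - exact: cont_measE.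
  - exact: cont_measE.
  - by move=> x _; rewrite lee_fin; case/andP: (fg x).
have : (0 <= \int[mu]_x (f x)%:E)%E by apply: integral_ge0 => x _; rewrite lee_fin.
case E : (\int[mu]_x (f x)%:E)%E => [v||] //= _ _.
by exists v.
Qed.

Lemma hasI_sub f g h v w : cont f -> (forall x, 0 <= f x) -> (forall x, h x = f x + g x) ->
  hasI h v -> hasI g w -> hasI f (v - w).
Proof.
move=> cf f0 hfg Hh Hg; have [u Hu] : exists u, hasI f u.
  apply: hasI_dom Hh => // x; rewrite f0 hfg lerDl /=.
  by case: Hg => _ g0 _.
have := hasI_ext hfg erefl Hh => Hh'.
by rewrite (hasI_uniq Hh' (hasI_add Hu Hg)) addrK.
Qed.

Lemma hasI_series (f : nat -> R -> R) (v : nat -> R) g :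
  (forall n, hasI (f n) (v n)) -> cont g ->
  (forall x, series (f ^~ x) n @[n --> \oo] --> g x) ->
  (series v n)%:E @[n --> \oo] --> (\int[mu]_x (g x)%:E)%E.
Proof.
move=> Hf cg fg.
have HS n : hasI (fun x => series (f ^~ x) n) (series v n).
  elim: n => [|n IH].
    apply: (@hasI_ext (fun=> 0) _ 0); first by move=> x; rewrite /series /= big_geq.
      by rewrite /series /= big_geq.
    by split; [exact: cont_cst|by []|rewrite integral0_eq].
  apply: hasI_ext (hasI_add IH (Hf n)) => [x|].
    by rewrite /series /= big_nat_recr.
  by rewrite /series /= big_nat_recr.
have H : (\int[mu]_x (series (f ^~ x) n)%:E)%E @[n --> \oo] -->
    (\int[mu]_x limn (fun n => (series (f ^~ x) n)%:E))%E.
  apply: (@cvg_monotone_convergence _ _ R mu setT measurableT (fun n x => (series (f ^~ x) n)%:E)).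
  - by move=> n; have [c _ _] := HS n; exact: cont_measE c.
  - by move=> n x _; have [_ c _] := HS n; rewrite lee_fin.
  - move=> x _ m n mn; rewrite lee_fin; apply: (@nondecreasing_series _ (f ^~ x) xpredT 0%N) => //.
    by move=> k _ _; have [_ c _] := Hf k.
move: H.
have -> : (fun n => (\int[mu]_x (series (f ^~ x) n)%:E)%E) = fun n => (series v n)%:E.
  by apply/funext => n; have [] := HS n.
have -> : (\int[mu]_x limn (fun n => (series (f ^~ x) n)%:E))%E = (\int[mu]_x (g x)%:E)%E.
  apply: eq_integral => x _; apply/cvg_lim => //.
  by apply: cvg_EFin; [exact: nearW|exact: fg].
by [].
Qed.

(** Monotone convergence for series of nonnegative functions, in both
directions: it computes the integral of the sum and it proves convergence of
the series of integrals. *)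
Lemma hasI_seriesP (f : nat -> R -> R) (v : nat -> R) g (l : R) :
  (forall n, hasI (f n) (v n)) -> cont g ->
  (forall x, series (f ^~ x) n @[n --> \oo] --> g x) ->
  hasI g l <-> series v n @[n --> \oo] --> l.
Proof.
move=> Hf cg fg; have H := hasI_series Hf cg fg.
have g0 x : 0 <= g x.
  have <- := cvg_lim (@Rhausdorff R) (fg x).
  apply: limr_ge; first by apply/cvg_ex; exists (g x); exact: fg.
  apply: nearW => n; apply: sumr_ge0 => k _; by have [_ c _] := Hf k.
split=> [[_ _ e]|vl].
  by move: H; rewrite e => /fine_cvgP [].
split => //; apply: (@cvg_unique _ (@ereal_hausdorff R) _ _ _ _ H).
by apply: cvg_EFin; [exact: nearW|exact: vl].
Qed.

End PositiveIntegrals.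

(** * Substitution, the fundamental theorem, integration by parts *)

Section IntegralTools.
Variable R : realType.
Implicit Types (f g h : R -> R) (v w : R).
Local Notation mu := (@lebesgue_measure R).

Lemma hasI_aff f v (a b : R) : 0 < a -> hasI f v -> hasI (fun x => f (a * x + b)) (v / a).
Proof.
move=> a0 [cf f0 e].
pose F (x : R) := a * x + b.
have datan_pw x : is_derive x (1 : R) F a.
  apply: (drv_eq (drvD (drvZ a (is_derive_id x (1 : R))) (is_derive_cst b x (1 : R)))) => //.
  by rewrite addr0 mulr1.
have dF1 : F^`()%classic = fun=> a.
  by apply/funext => x; rewrite derive1E; have [_] := datan_pw x.
have cF : cont F := drv_cont datan_pw.
have H := @increasing_ge0_integration_by_substitutionT R F f.
have {}H : (\int[mu]_x (f x)%:E)%E = (\int[mu]_x (((f \o F) * F^`()%classic) x)%:E)%E.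
  apply: H => //.
  - by move=> x y xy; rewrite /F ltrD2r ltr_pM2l.
  - by rewrite dF1 => x; exact: cst_continuous.
  - by rewrite dF1; exact: is_cvg_cst.
  - by rewrite dF1; exact: is_cvg_cst.
  - apply/cvgrNyPle => A; exists ((A - b) / a); split; first exact: num_real.
    by move=> x; rewrite ltr_pdivlMr // /F; lra.
  - apply/cvgryPge => A; exists ((A - b) / a); split; first exact: num_real.
    by move=> x; rewrite ltr_pdivrMr // /F; lra.
have HI : hasI (fun x => a * f (F x)) v.
  split; first exact: contZ (cont_comp cF cf).
    by move=> x; rewrite mulr_ge0 // ltW.
  rewrite -e H; apply: eq_integral => x _; rewrite dF1; congr EFin.
  by rewrite mulrC.
have a0' : 0 <= a^-1 by rewrite invr_ge0 ltW.
apply: hasI_ext (hasI_scale a0' HI) => [x|]; last by rewrite mulrC.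
by rewrite mulrA mulVf ?mul1r // gt_eqF.
Qed.

Lemma hasI_shift f v (b : R) : hasI f v -> hasI (fun x => f (x + b)) v.
Proof.
move=> H; apply: hasI_ext (hasI_aff b ltr01 H) => [x|]; first by rewrite mul1r.
by rewrite divr1.
Qed.

Lemma hasI_FTC f (F : R -> R) (l1 l2 : R) : cont f -> (forall x, 0 <= f x) ->
  (forall y : R, is_derive y (1 : R) F (f y)) ->
  F n.+1%:R @[n --> \oo] --> l2 -> F (- n.+1%:R) @[n --> \oo] --> l1 ->
  hasI f (l2 - l1).
Proof.
move=> cf f0 datan_pw F2 F1; split => //.
have cF : cont F := drv_cont datan_pw.
pose A (n : nat) := `[- n.+1%:R : R, n.+1%:R]%classic.
have H : (\int[mu]_(x in A n) (f x)%:E)%E @[n --> \oo] --> (\int[mu]_(x in \bigcup_n A n) (f x)%:E)%E.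
  apply: ge0_nondecreasing_set_cvg_integral.
  - move=> m n mn; apply/subsetPset => x; rewrite /A /= !in_itv /= => /andP[x1 x2].
    have : m.+1%:R <= n.+1%:R :> R by rewrite ler_nat.
    by move=> h; apply/andP; split; lra.
  - by move=> n; exact: measurable_itv.
  - by move=> n; apply/measurable_EFinP; apply: measurable_funTS; exact: cont_meas.
  - by move=> n x _; rewrite lee_fin.
have UT : \bigcup_n A n = setT.
  apply/seteqP; split => // x _; exists (Num.truncn `|x|) => //; rewrite /A /= in_itv /=.
  by rewrite -ler_norml ltW // truncnS_gt.
rewrite UT in H; apply: (@cvg_unique _ (@ereal_hausdorff R) _ _ _ _ H).
have -> : (fun n => (\int[mu]_(x in A n) (f x)%:E)%E) = fun n => (F n.+1%:R - F (- n.+1%:R))%:E.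
  apply/funext => n; rewrite EFinB; apply: continuous_FTC2.
  - by rewrite gtrN // ltr0n.
  - by apply: continuous_subspaceT => x; exact: cf.
  - split; first by move=> x _; have [] := datan_pw x.
      by apply: cvg_at_right_filter; exact: cF.
    by apply: cvg_at_left_filter; exact: cF.
  - by move=> x _; rewrite derive1E; have [_] := datan_pw x.
apply: cvg_EFin; first exact: nearW.
exact: cvgB F2 F1.
Qed.

(** 1/(e^(dx) + e^(-dx)): the reference function for two-sided exponential
decay. *)
Definition sech (d x : R) : R := (expR (d * x) + expR (- (d * x)))^-1.

Lemma sech_den (d x : R) : 0 < expR (d * x) + expR (- (d * x)).
Proof. by rewrite addr_gt0 ?expR_gt0. Qed.

Lemma cont_lin (d : R) : cont (fun x : R => d * x).
Proof. exact (contM (@cont_cst R d) (@cont_id R)). Qed.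

Lemma cont_sech d : cont (sech d).
Proof.
apply: contV => [x|]; first by rewrite gt_eqF // sech_den.
by apply: contD; apply: cont_exp; [|apply: contN]; exact: cont_lin.
Qed.

Lemma sech_ge0 d x : 0 <= sech d x.
Proof. by rewrite invr_ge0 ltW // sech_den. Qed.

(** The smaller of e^(dx) and e^(-dx) is at most 2 sech. *)
Lemma sech_min d x (A B : R) : 0 <= A -> B <= A * expR (d * x) -> B <= A * expR (- (d * x)) ->
  B <= 2 * A * sech d x.
Proof.
move=> A0; rewrite /sech ler_pdivlMr ?sech_den // expRN.
have := expR_gt0 (d * x); set E := expR _ => E0 h1 h2.
have h3 : B * E <= A by rewrite -ler_pdivlMr.
have h4 : B * E^-1 <= A.
  by rewrite ler_pdivrMr.
lra.
Qed.

Lemma expR_lim (d : R) : 0 < d -> expR (- (d * n.+1%:R)) @[n --> \oo] --> (0 : R).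
Proof.
move=> d0; apply/cvgrPdist_le => e e0; near=> n.
rewrite sub0r normrN ger0_norm ?expR_ge0 // expRN.
rewrite -[e]invrK lef_pV2 ?posrE ?expR_gt0 ?invr_gt0 //.
apply: le_trans (expR_ge1Dx _).
apply: (@le_trans _ _ (d * n.+1%:R)); last by rewrite lerDr.
rewrite mulrC -ler_pdivrMr //.
apply: (@le_trans _ _ n%:R); last by rewrite ler_nat.
near: n; exact: nbhs_infty_ger.
Unshelve. all: by end_near. Qed.

Lemma atan_exp_drv (d y : R) : 0 < d -> is_derive y (1 : R) (fun y => d^-1 * atan (expR (d * y))) (sech d y).
Proof.
move=> d0.
have D1 := drv_comp (f := expR) (g := fun y : R => d * y) (is_derive_expR (d * y)) (drvZ d (is_derive_id y (1 : R))).
have D2 := drv_comp (f := atan) (g := fun y : R => expR (d * y)) (is_derive1_atan (expR (d * y))) D1.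
apply: (drv_eq (drvZ d^-1 D2)) => //.
rewrite mulr1 /sech expRN; have := expR_gt0 (d * y); set E := expR _ => E0.
have E2 : 0 < E ^+ 2 by rewrite exprn_gt0.
by field; rewrite !gt_eqF //; lra.
Qed.

Lemma hasI_sech d : 0 < d -> hasI (sech d) (d^-1 * (pi / 2)).
Proof.
move=> d0; rewrite -[d^-1 * _]subr0.
apply: (@hasI_FTC _ (fun y => d^-1 * atan (expR (d * y)))).
- exact: cont_sech.
- exact: sech_ge0.
- by move=> y; exact: atan_exp_drv.
- apply: cvgM; first exact: cvg_cst.
  have H : expR (d * n.+1%:R) @[n --> \oo] --> +oo.
    apply/cvgryPge => A; near=> n.
    apply: le_trans (expR_ge1Dx _).
    apply: (@le_trans _ _ (d * n.+1%:R)); last by rewrite lerDr.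
    rewrite mulrC -ler_pdivrMr //.
    apply: (@le_trans _ _ n%:R); last by rewrite ler_nat.
    near: n; exact: nbhs_infty_ger.
  exact: (cvg_comp _ _ H (@cvgy_atan R)).
- rewrite [X in _ --> X](_ : _ = d^-1 * atan 0); last by rewrite atan0 mulr0.
  apply: cvgM; first exact: cvg_cst.
  have H : expR (d * - n.+1%:R) @[n --> \oo] --> (0 : R).
    by under eq_fun do rewrite mulrN; exact: expR_lim.
  exact: (cvg_comp _ _ H (@continuous_atan R 0)).
Unshelve. all: by end_near. Qed.

(** The integral of F' is 0 because F decays at both ends. F' has no sign, so
a multiple of sech is added before the fundamental theorem is applied and
cancelled afterwards. *)
Lemma hasI_IBP (a b F : R -> R) (d K : R) : 0 < d -> 0 <= K -> cont a -> cont b ->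
  (forall x, 0 <= a x <= K * sech d x) -> (forall x, 0 <= b x <= K * sech d x) ->
  (forall y : R, is_derive y (1 : R) F (a y - b y)) ->
  (forall x, `|F x| <= K * sech d x) -> exists v, hasI a v /\ hasI b v.
Proof.
move=> d0 K0 ca cb Ha Hb datan_pw HF.
have HS := hasI_scale K0 (hasI_sech d0).
have [va Hva] := hasI_dom ca Ha HS; have [vb Hvb] := hasI_dom cb Hb HS.
have Flim (u : nat -> R) : (forall n, `|F (u n)| <= K * expR (- (d * n.+1%:R))) -> F (u n) @[n --> \oo] --> (0 : R).
  move=> Hu; apply/cvgr0Pnorm_le => e e0.
  have H : K * expR (- (d * n.+1%:R)) @[n --> \oo] --> (K * 0 : R).
    by apply: cvgM; [exact: cvg_cst|exact: expR_lim].
  move: H; rewrite mulr0 => /cvgr0Pnorm_le /(_ e e0).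
  apply: filterS => n; rewrite ger0_norm; last by rewrite mulr_ge0 ?expR_ge0.
  exact: le_trans (Hu n).
have sl n : sech d n.+1%:R <= expR (- (d * n.+1%:R)).
  rewrite /sech expRN lef_pV2 ?posrE ?expR_gt0 //; last by rewrite addr_gt0 ?invr_gt0 ?expR_gt0.
  by rewrite lerDl invr_ge0 expR_ge0.
have F2 : F n.+1%:R @[n --> \oo] --> (0 : R).
  by apply: Flim => n; apply: le_trans (HF _) _; rewrite ler_wpM2l.
have F1 : F (- n.+1%:R) @[n --> \oo] --> (0 : R).
  apply: Flim => n; apply: le_trans (HF _) _; rewrite ler_wpM2l //.
  by rewrite /sech mulrN opprK addrC; exact: sl.
(* Nonnegative, since b <= K sech. *)
pose f x := a x - b x + K * sech d x.
have cf : cont f by exact (contD (contB ca cb) (contZ (v := K) (@cont_sech d))).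
have f0 x : 0 <= f x.
  by rewrite /f; case/andP: (Ha x) => a1 _; case/andP: (Hb x) => _ b1; lra.
have D2 n : atan (expR (d * n.+1%:R)) <= pi / 2 :> R by exact/ltW/atan_ltpi2.
have Hf : hasI f (K * (d^-1 * (pi / 2))).
  pose G (y : R) := F y + K * (d^-1 * atan (expR (d * y))).
  have -> : K * (d^-1 * (pi / 2)) = (0 + K * (d^-1 * (pi / 2))) - (0 + K * (d^-1 * 0)) by ring.
  apply: (@hasI_FTC _ G) => //.
  - by move=> y; apply: (drvD (datan_pw y) (drvZ K (atan_exp_drv y d0))).
  - apply: cvgD => //; apply: cvgM; first exact: cvg_cst.
    apply: cvgM; first exact: cvg_cst.
    have H : expR (d * n.+1%:R) @[n --> \oo] --> +oo.
      apply/cvgryPge => A; near=> n.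
      apply: le_trans (expR_ge1Dx _).
      apply: (@le_trans _ _ (d * n.+1%:R)); last by rewrite lerDr.
      rewrite mulrC -ler_pdivrMr //.
      apply: (@le_trans _ _ n%:R); last by rewrite ler_nat.
      near: n; exact: nbhs_infty_ger.
    exact: (cvg_comp _ _ H (@cvgy_atan R)).
  - apply: cvgD => //; apply: cvgM; first exact: cvg_cst.
    apply: cvgM; first exact: cvg_cst.
    rewrite -[X in _ --> X]atan0.
    have H : expR (d * - n.+1%:R) @[n --> \oo] --> (0 : R).
      by under eq_fun do rewrite mulrN; exact: expR_lim.
    exact: (cvg_comp _ _ H (@continuous_atan R 0)).
have E1 := hasI_add Hf Hvb; have E2 := hasI_add Hva HS.
have E3 : hasI (fun x => a x + K * sech d x) (K * (d^-1 * (pi / 2)) + vb).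
  by apply: hasI_ext E1 => // x; rewrite /f; ring.
have := hasI_uniq E3 E2; rewrite addrC => /addIr e.
by exists va; split => //; rewrite -e.
Unshelve. all: by end_near. Qed.

End IntegralTools.

(** * The Gamma integral *)

Section GammaIntegral.
Variable R : realType.
Implicit Types (f : R -> R) (s x y : R).
Local Notation mu := (@lebesgue_measure R).

Lemma drv_id y : is_derive y (1 : R) (fun t : R => t) 1.
Proof. exact: is_derive_id. Qed.
Lemma drv_cst (c y : R) : is_derive y (1 : R) (fun=> c : R) 0.
Proof. exact: is_derive_cst. Qed.
Lemma drv_exp (f : R -> R) (y a : R) : is_derive y (1 : R) f a ->
  is_derive y (1 : R) (fun t => expR (f t)) (expR (f y) * a).
Proof. by move=> H; exact: (drv_comp (f := expR) (g := f) (is_derive_expR (f y)) H). Qed.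
Lemma drv_lin (c y : R) : is_derive y (1 : R) (fun t => c * t) c.
Proof. by apply: (drv_eq (drvZ c (drv_id y))) => //; rewrite mulr1. Qed.

(** x^s e^(-x) in the variable x = e^y, so that dy = dx/x. *)
Definition gam s y : R := expR (s * y - expR y).

Lemma drv_gam s y : is_derive y (1 : R) (gam s) ((s - expR y) * gam s y).
Proof.
apply: (drv_eq (drv_exp (drvB (drv_lin s y) (drv_exp (drv_id y))))) => //.
by rewrite mulr1 mulrC.
Qed.

Lemma cont_gam s : cont (gam s).
Proof. exact: drv_cont (drv_gam s). Qed.

Lemma gam_S s y : gam (s + 1) y = expR y * gam s y.
Proof. by rewrite /gam -expRD; congr expR; ring. Qed.

(** x^p e^(-x) <= (k+1)! for 0 <= p <= k + 1, at x = e^y. *)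
Lemma exp_pow (p y : R) k : 0 <= p <= k.+1%:R -> expR (p * y - expR y) <= k.+1`!%:R.
Proof.
move=> /andP[p0 pk]; have e0 := expR_gt0 y.
have f1 : 1 <= k.+1`!%:R :> R by rewrite ler1n fact_gt0.
have f0 : 0 < k.+1`!%:R :> R by lra.
case: (leP y 0) => y0.
  apply: le_trans f1; rewrite expR_le1.
  have : p * y <= 0 by rewrite mulr_ge0_le0.
  lra.
rewrite expRB ler_pdivrMr ?expR_gt0 //.
apply: (@le_trans _ _ (expR y ^+ k.+1)).
  by rewrite -expRM_natl ler_expR ler_wpM2r // ltW.
rewrite mulrC -ler_pdivrMr //; have := expR_ge1Dxn k (ltW e0); lra.
Qed.

Lemma gam_bound s d : 0 < d -> d <= s -> exists2 K, 0 <= K & forall y, gam s y <= K * sech d y.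
Proof.
move=> d0 ds; pose k := Num.truncn (s + d).
have k1 : s + d <= k.+1%:R by apply: ltW; exact: truncnS_gt.
exists (2 * k.+1`!%:R); first by rewrite mulr_ge0.
move=> y; apply: sech_min => //.
  have -> : gam s y = expR ((s - d) * y - expR y) * expR (d * y).
    by rewrite /gam -expRD; congr expR; ring.
  by rewrite ler_wpM2r ?expR_ge0 // exp_pow //; lra.
have -> : gam s y = expR ((s + d) * y - expR y) * expR (- (d * y)).
  by rewrite /gam -expRD; congr expR; ring.
by rewrite ler_wpM2r ?expR_ge0 // exp_pow //; lra.
Qed.

(** Euler's integral for Gamma(s). *)
Definition gammaI s : R := fine (\int[mu]_y (gam s y)%:E)%E.

Lemma hasI_gammaI s : 0 < s -> hasI (gam s) (gammaI s).
Proof.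
move=> s0; have [K K0 HK] := gam_bound s0 (lexx s).
have [v Hv] : exists v, hasI (gam s) v.
  apply: hasI_dom (hasI_scale K0 (hasI_sech s0)); first exact: cont_gam.
  by move=> x; rewrite expR_ge0 HK.
have [_ _ e] := Hv; have -> : gammaI s = v by rewrite /gammaI e.
exact: Hv.
Qed.

Lemma gammaI_rec s : 0 < s -> gammaI (s + 1) = s * gammaI s.
Proof.
move=> s0; have s1 : s <= s + 1 by lra.
have [K1 K10 H1] := gam_bound s0 (lexx s); have [K2 K20 H2] := gam_bound s0 s1.
have sK1 : 0 <= s * K1 by rewrite mulr_ge0 // ltW.
have B1 y : gam s y <= (s * K1 + K1 + K2) * sech s y.
  apply: le_trans (H1 y) _; rewrite ler_wpM2r ?sech_ge0 //; lra.
have B2 y : s * gam s y <= (s * K1 + K1 + K2) * sech s y.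
  apply: le_trans (ler_wpM2l (ltW s0) (H1 y)) _; rewrite mulrA ler_wpM2r ?sech_ge0 //; lra.
have B3 y : gam (s + 1) y <= (s * K1 + K1 + K2) * sech s y.
  apply: le_trans (H2 y) _; rewrite ler_wpM2r ?sech_ge0 //; lra.
have K0 : 0 <= s * K1 + K1 + K2 by lra.
have c1 : cont (fun y => s * gam s y) by exact (contZ (v := s) (@cont_gam s)).
have [||||v [Ha Hb]] := @hasI_IBP R (fun y => s * gam s y) (gam (s + 1)) (gam s) s
  (s * K1 + K1 + K2) s0 K0 c1 (@cont_gam _).
- by move=> x; rewrite B2 mulr_ge0 ?expR_ge0 // ltW.
- by move=> x; rewrite B3 expR_ge0.
- by move=> y; apply: (drv_eq (drv_gam s y)) => //; rewrite gam_S; ring.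
- by move=> x; rewrite ger0_norm ?expR_ge0.
rewrite (hasI_uniq (hasI_gammaI _) Hb); last by lra.
exact: hasI_uniq Ha (hasI_scale (ltW s0) (hasI_gammaI s0)).
Qed.

Lemma gammaI1 : gammaI 1 = 1.
Proof.
have H : hasI (gam 1) (0 - (- expR (- 0))).
  apply: (@hasI_FTC _ _ (fun y => - expR (- expR y))).
  - exact: cont_gam.
  - by move=> x; exact: expR_ge0.
  - move=> y; apply: (drv_eq (drvZ (-1) (drv_exp (drvZ (-1) (drv_exp (drv_id y)))))).
      by move=> t; rewrite !mulN1r.
    by rewrite /gam mul1r addrC expRD !mulN1r; ring.
  - rewrite -[X in _ --> X]oppr0; apply: cvgN.
    apply/cvgr0Pnorm_le => e e0.
    have := @expR_lim R 1 ltr01; move/cvgr0Pnorm_le => /(_ e e0); apply: filterS => n.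
    rewrite !ger0_norm ?expR_ge0 //; apply: le_trans; rewrite ler_expR lerN2 mul1r.
    by have := expR_ge1Dx (n.+1%:R : R); lra.
  - apply: cvgN.
    have H : - expR (- n.+1%:R) @[n --> \oo] --> (- 0 : R).
      by apply: cvgN; have := @expR_lim R 1 ltr01; under eq_fun do rewrite mul1r.
    exact: (cvg_comp _ _ H (@continuous_expR R (- 0))).
rewrite (hasI_uniq (hasI_gammaI ltr01) H); by rewrite oppr0 expR0; ring.
Qed.

Lemma hasI_gammaI_scale s c : 0 < s -> 0 < c ->
  hasI (fun y => expR (s * y - c * expR y)) (expR (- (s * ln c)) * gammaI s).
Proof.
move=> s0 c0.
apply: hasI_ext (hasI_scale (expR_ge0 (- (s * ln c))) (hasI_shift (ln c) (hasI_gammaI s0))) => // y.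
rewrite /gam -expRD; congr expR; rewrite [expR (y + _)]expRD lnK ?posrE //; ring.
Qed.

(** Integrate e^(by) e^w e^(-e^w (1 + e^y)) over the plane in both orders:
over w it is elementary, over y it is a Gamma integral. The left-hand side is
the integral of x^(b-1)/(1 + x) over x > 0. *)
Lemma hasI_beta b : 0 < b < 1 -> hasI (fun y => expR (b * y) / (1 + expR y)) (gammaI b * gammaI (1 - b)).
Proof.
move=> /andP[b0 b1].
pose k (y w : R) := expR (b * y + w - expR w * (1 + expR y)).
have k0 y w : 0 <= k y w := expR_ge0 _.
have kw y : hasI (k y) (expR (b * y) / (1 + expR y)).
  have c0 : 0 < 1 + expR y by rewrite addr_gt0 ?expR_gt0.
  apply: hasI_ext (hasI_scale (expR_ge0 (b * y)) (hasI_gammaI_scale ltr01 c0)) => [w|].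
    by rewrite /k -expRD; congr expR; ring.
  by rewrite gammaI1 mulr1 mul1r expRN lnK ?posrE.
have ky w : hasI (k ^~ w) (gam (1 - b) w * gammaI b).
  apply: hasI_ext (hasI_scale (expR_ge0 ((1 - b) * w - expR w)) (hasI_shift w (hasI_gammaI b0))) => // y.
  by rewrite /k /gam -expRD; congr expR; rewrite expRD; ring.
have mk : measurable_fun [set: R * R] (fun p : R * R => (k p.1 p.2)%:E).
  apply/measurable_EFinP; rewrite /k; apply: measurableT_comp; first exact: measurable_expR.
  apply: measurable_funB.
    apply: measurable_funD; last exact: measurable_snd.
    by apply: measurable_funM; [exact: measurable_cst|exact: measurable_fst].
  apply: measurable_funM.
    by apply: measurableT_comp; [exact: measurable_expR|exact: measurable_snd].
  apply: measurable_funD; first exact: measurable_cst.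
  by apply: measurableT_comp; [exact: measurable_expR|exact: measurable_fst].
have FT := @fubini_tonelli _ _ _ _ R mu mu _ mk (fun p => _).
have {}FT : (\int[mu]_y \int[mu]_w (k y w)%:E = \int[mu]_w \int[mu]_y (k y w)%:E)%E.
  by apply: FT => p; rewrite lee_fin.
have b1' : 0 < 1 - b by lra.
split.
- have c1 : cont (fun y => expR (b * y)) by apply: cont_exp; exact: cont_lin.
  apply: (contM c1); apply: contV => [x|]; first by rewrite gt_eqF // addr_gt0 ?expR_gt0.
  exact (contD (@cont_cst R 1) (cont_exp (@cont_id R))).
- by move=> x; rewrite divr_ge0 ?expR_ge0 // addr_ge0 ?expR_ge0.
- transitivity (\int[mu]_y \int[mu]_w (k y w)%:E)%E.
    by apply: eq_integral => y _; have [_ _ ->] := kw y.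
  rewrite FT; have [_ _ <-] := hasI_scale (hasI_ge0 (hasI_gammaI b0)) (hasI_gammaI b1').
  by apply: eq_integral => w _; have [_ _ ->] := ky w; rewrite mulrC.
Qed.

Lemma hasI_beta2 a : 0 < a < 2 ->
  hasI (fun y => expR (a * y) / (1 + expR (2 * y))) (gammaI (a / 2) * gammaI (1 - a / 2) / 2).
Proof.
move=> a02; have b01 : 0 < a / 2 < 1 by lra.
apply: hasI_ext (hasI_aff 0 (ltr0n R 2) (hasI_beta b01)) => // y.
by rewrite addr0; congr (expR _ / _); field.
Qed.

(** The case b = 1/2 is the integral of sech, computed by an arctangent. *)
Lemma gammaI_half : gammaI 2^-1 ^+ 2 = pi.
Proof.
have H : hasI (sech 1) (gammaI (1 / 2) * gammaI (1 - 1 / 2) / 2).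
  have a02 : 0 < (1 : R) < 2 by lra.
  apply: hasI_ext (hasI_beta2 a02) => // y.
  have -> : 2 * y = y + y by ring.
  rewrite /sech !mul1r expRN expRD; have := expR_gt0 y; set E := expR y => E0.
  have E2 : 0 < E * E by rewrite mulr_gt0. by field; rewrite !gt_eqF //=; lra.
have := hasI_uniq H (hasI_sech ltr01).
have -> : 1 - 1 / 2 = 2^-1 :> R by field.
rewrite mul1r invr1 mul1r => e; rewrite expr2; lra.
Qed.

End GammaIntegral.

(** * Mellin transforms of finite differences *)

Section HasseIntegrals.
Variable R : realType.
Implicit Types (f : R -> R) (a b s x y : R).

(** The second remainder of e^(-x): it behaves like x^2 at 0 and like x at
infinity, which makes its Mellin transform converge at exponents between -2
and -1. *)
Definition exp_rem x : R := expR (- x) - 1 + x.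

Lemma exp_rem_ge0 x : 0 <= exp_rem x.
Proof. by rewrite /exp_rem; have := expR_ge1Dx (- x); lra. Qed.
Lemma exp_rem_le x : 0 <= x -> exp_rem x <= x.
Proof. by move=> x0; rewrite /exp_rem; have : expR (- x) <= 1; [rewrite expR_le1; lra|lra]. Qed.
Lemma exp_rem_le2 x : 0 <= x -> exp_rem x <= x ^+ 2.
Proof.
move=> x0; rewrite /exp_rem expRN; have h := expR_ge1Dx x; have e0 := expR_gt0 x.
have : (expR x)^-1 <= (1 + x)^-1 by rewrite lef_pV2 ?posrE //; lra.
have : (1 + x)^-1 <= 1 - x + x ^+ 2.
  rewrite -[_^-1]mul1r ler_pdivrMr; last lra.
  have -> : (1 - x + x ^+ 2) * (1 + x) = 1 + x ^+ 3 by ring.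
  by rewrite lerDl exprn_ge0.
lra.
Qed.

(** A function bounded by both exponentials, of rates at least d, decays at
both ends. *)
Lemma sech_two (d p q B y : R) : 0 < d -> d <= p -> d <= q ->
  B <= expR (- (p * y)) -> B <= expR (q * y) -> B <= 2 * sech d y.
Proof.
move=> d0 dp dq h1 h2; rewrite -[2]mulr1; apply: sech_min => //; rewrite mul1r; case: (leP 0 y) => y0.
- apply: le_trans h1 _; rewrite ler_expR.
  have : 0 <= p * y by rewrite mulr_ge0 //; lra.
  have : 0 <= d * y by rewrite mulr_ge0 //; lra.
  lra.
- apply: le_trans h2 _; rewrite ler_expR.
  by have := mulr_ge0_le0 (ltac:(lra) : 0 <= q - d) (ltW y0); lra.
- apply: le_trans h1 _; rewrite ler_expR.
  by have := mulr_ge0 (ltac:(lra) : 0 <= p - d) y0; lra.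
- apply: le_trans h2 _; rewrite ler_expR.
  have := mulr_ge0_le0 (ltac:(lra) : 0 <= q) (ltW y0).
  have := mulr_ge0_le0 (ltac:(lra) : 0 <= d) (ltW y0).
  lra.
Qed.

Lemma drv_exp_rem (k y : R) : is_derive y (1 : R) (fun y => exp_rem (k * expR y))
   (k * expR y * (1 - expR (- (k * expR y)))).
Proof.
have D := drvZ k (drv_exp (drv_id y)).
apply: (drv_eq (drvD (drvB (drv_exp (drvZ (-1) D)) (drv_cst 1 y)) D)) => [t|].
  by rewrite /exp_rem mulN1r.
by rewrite mulN1r; ring.
Qed.

Definition exp_rem_mellin a k y : R := exp_rem (k * expR y) * expR (- (a * y)).

Lemma exp_rem_mellin_ge0 a k y : 0 <= exp_rem_mellin a k y.
Proof. by rewrite mulr_ge0 ?exp_rem_ge0 ?expR_ge0. Qed.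

(** Two integrations by parts reduce the Mellin transform at -a to the Gamma
integral at 2 - a; its value c is the continuation Gamma(-a). *)
Lemma hasI_exp_rem a : 1 < a < 2 -> exists c, hasI (exp_rem_mellin a 1) c /\ a * (a - 1) * c = gammaI (2 - a).
Proof.
move=> /andP[a1 a2].
(* The rate of decay common to both ends. *)
have [d d0 [da1 da2]] : exists2 d : R, 0 < d & d <= a - 1 /\ d <= 2 - a.
  exists (Num.min (a - 1) (2 - a)); first by rewrite lt_min; lra.
  by rewrite !ge_min !lexx orbT.
(* The first derivative of exp_rem, at x = e^y, times x^(1-a). *)
pose F2 y : R := (1 - expR (- expR y)) * expR (- ((a - 1) * y)).
have dexp (p y : R) : is_derive y (1 : R) (fun y => expR (- (p * y))) (- p * expR (- (p * y))).
  by apply: (drv_eq (drv_exp (drvZ (-1) (drv_lin p y)))) => [t|]; rewrite mulN1r // mulrC mulN1r.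
have dF1 y : is_derive y (1 : R) (exp_rem_mellin a 1) (F2 y - a * exp_rem_mellin a 1 y).
  apply: (drv_eq (drvM (drv_exp_rem 1 y) (dexp a y))) => //.
  rewrite /F2 /exp_rem_mellin mul1r.
  have -> : expR (- ((a - 1) * y)) = expR y * expR (- (a * y)).
    by rewrite -expRD; congr expR; ring.
  by ring.
have dF2 y : is_derive y (1 : R) F2 (gam (2 - a) y - (a - 1) * F2 y).
  have D1 := drvB (drv_cst 1 y) (drv_exp (drvZ (-1) (drv_exp (drv_id y)))).
  apply: (drv_eq (drvM D1 (dexp (a - 1) y))) => [t|].
    by rewrite /F2 !mulN1r.
  have -> : gam (2 - a) y = expR y * expR (- expR y) * expR (- ((a - 1) * y)).
    by rewrite /gam -!expRD; congr expR; ring.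
  by rewrite /F2 !mulN1r; ring.
have em y : expR (- expR y) <= 1 by rewrite expR_le1 oppr_le0 expR_ge0.
have F20 y : 0 <= F2 y by rewrite mulr_ge0 ?expR_ge0 // subr_ge0.
have B1 y : exp_rem_mellin a 1 y <= 2 * sech d y.
  apply: (sech_two (p := a - 1) (q := 2 - a)) => //.
    have -> : expR (- ((a - 1) * y)) = expR y * expR (- (a * y)).
      by rewrite -expRD; congr expR; ring.
    by rewrite ler_wpM2r ?expR_ge0 // mul1r exp_rem_le // expR_ge0.
  have -> : expR ((2 - a) * y) = expR y ^+ 2 * expR (- (a * y)).
    by rewrite expr2 -!expRD; congr expR; ring.
  by rewrite ler_wpM2r ?expR_ge0 // mul1r exp_rem_le2 // expR_ge0.
have B2 y : F2 y <= 2 * sech d y.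
  apply: (sech_two (p := a - 1) (q := 2 - a)) => //.
    by rewrite -[leRHS]mul1r ler_wpM2r ?expR_ge0 //; have := expR_ge0 (- expR y); lra.
  have -> : expR ((2 - a) * y) = expR y * expR (- ((a - 1) * y)).
    by rewrite -!expRD; congr expR; ring.
  by rewrite ler_wpM2r ?expR_ge0 //; have := expR_ge1Dx (- expR y); lra.
have [K K0 HK] := gam_bound d0 da2.
have cF1 := drv_cont dF1; have cF2 := drv_cont dF2.
have s0 y := sech_ge0 d y.
have [|||||v [Hv1 Hv2]] := @hasI_IBP R F2 (fun y => a * exp_rem_mellin a 1 y) (exp_rem_mellin a 1) d 4 d0 _ cF2 _ _ _ dF1.
- by [].
- exact (contZ (v := a) cF1).
- by move=> y; rewrite F20 /=; have := B2 y; have := s0 y; lra.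
- move=> y; apply/andP; split; first by rewrite mulr_ge0 ?exp_rem_mellin_ge0 //; lra.
  have := ler_wpM2r (exp_rem_mellin_ge0 a 1 y) (ltW a2); have := B1 y; lra.
- move=> y; rewrite ger0_norm ?exp_rem_mellin_ge0 //; have := B1 y; have := s0 y; lra.
have [|||||w [Hw1 Hw2]] := @hasI_IBP R (gam (2 - a)) (fun y => (a - 1) * F2 y) F2 d (K + 4) d0 _ (@cont_gam _ _) _ _ _ dF2.
- lra.
- exact (contZ (v := a - 1) cF2).
- move=> y; rewrite expR_ge0 /=; apply: le_trans (HK y) _; rewrite ler_wpM2r //; lra.
- move=> y; apply/andP; split; first by rewrite mulr_ge0 ?F20 //; lra.
  have h1 : (a - 1) * F2 y <= 1 * F2 y by rewrite ler_wpM2r //; lra.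
  have := B2 y; have := mulr_ge0 K0 (s0 y); have := s0 y; lra.
- move=> y; rewrite ger0_norm ?F20 //.
  have := B2 y; have := mulr_ge0 K0 (s0 y); have := s0 y; lra.
have a0 : 0 <= a^-1 by rewrite invr_ge0; lra.
have Hc : hasI (exp_rem_mellin a 1) (a^-1 * v).
  apply: hasI_ext (hasI_scale a0 Hv2) => // y.
  by rewrite mulrA mulVf ?mul1r // gt_eqF //; lra.
exists (a^-1 * v); split => //.
have ga : 0 < 2 - a by lra.
rewrite (hasI_uniq (hasI_gammaI ga) Hw1).
have a10 : 0 <= a - 1 by lra.
rewrite (hasI_uniq Hw2 (hasI_scale a10 Hv1)); field; rewrite gt_eqF //; lra.
Qed.

Lemma hasI_exp_rem_scale a c k : 0 < k -> hasI (exp_rem_mellin a 1) c -> hasI (exp_rem_mellin a k) (expR (a * ln k) * c).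
Proof.
move=> k0 H; apply: hasI_ext (hasI_scale (expR_ge0 (a * ln k)) (hasI_shift (ln k) H)) => // y.
rewrite /exp_rem_mellin mulrCA -expRD expRD lnK ?posrE // mul1r [expR y * k]mulrC; congr (_ * expR _).
by ring.
Qed.

Lemma hdiffRS n t x : hdiffR n.+1 t x = hdiffR n t x - hdiffR n t (x + 1).
Proof. by rewrite /hdiffR hdiffS !ReImE. Qed.
Lemma hdiffR0 t x : hdiffR 0 t x = expR (- (t * ln x)).
Proof. by rewrite /hdiffR hdiff0 -(rmorphN (@toC R)) rpow_toC Re_toC mulNr. Qed.

(** e^(-kx) (1 - e^(-x))^n at x = e^y, with the letter x of the formula
standing for k. *)
Definition hasse_ker n x y : R := expR (- (x * expR y)) * (1 - expR (- expR y)) ^+ n.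

Lemma hasse_base_ge0 y : 0 <= 1 - expR (- expR y) :> R.
Proof. by rewrite subr_ge0 expR_le1 oppr_le0 expR_ge0. Qed.
Lemma hasse_ker_ge0 n x y : 0 <= hasse_ker n x y.
Proof. by rewrite mulr_ge0 ?expR_ge0 // exprn_ge0 // hasse_base_ge0. Qed.
Lemma cont_hasse_ker n x : cont (hasse_ker n x).
Proof.
have c1 : cont (fun y : R => expR y) := cont_exp (@cont_id R).
apply: contM.
  by apply: cont_exp; apply: contN; exact (contZ (v := x) c1).
by apply: contX; apply: (contB (@cont_cst R 1)); apply: cont_exp; exact: contN.
Qed.
Lemma hasse_kerS n x y : hasse_ker n.+1 x y = hasse_ker n x y - hasse_ker n (x + 1) y.
Proof.
rewrite /hasse_ker mulrDl mul1r opprD expRD exprS; ring.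
Qed.
Lemma cont_explin (p : R) : cont (fun y => expR (p * y)).
Proof. by apply: cont_exp; exact: cont_lin. Qed.

(** Induction on n: both sides satisfy the recursion of differences. *)
Lemma hasI_hdiffR n b x : 0 < b -> 0 < x ->
  hasI (fun y => expR (b * y) * hasse_ker n x y) (hdiffR n b x * gammaI b).
Proof.
move=> b0; elim: n x => [|n IH] x x0.
  apply: hasI_ext (hasI_gammaI_scale b0 x0) => [y|]; last by rewrite hdiffR0.
  by rewrite /hasse_ker expr0 mulr1 -expRD.
have x1 : 0 < x + 1 by lra.
rewrite hdiffRS mulrBl; apply: hasI_sub (IH x x0) (IH _ x1).
- exact (contM (@cont_explin b) (@cont_hasse_ker n.+1 x)).
- by move=> y; rewrite mulr_ge0 ?expR_ge0 ?hasse_ker_ge0.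
- by move=> y; rewrite hasse_kerS; ring.
Qed.

(** The same recursion for a negative exponent -a; it starts at n = 2, the
first difference for which the integrand is a combination of remainders
[exp_rem]. *)
Lemma hasI_hdiffR_neg n a c x : 0 < x -> hasI (exp_rem_mellin a 1) c ->
  hasI (fun y => expR (- (a * y)) * hasse_ker n.+2 x y) (hdiffR n.+2 (- a) x * c).
Proof.
move=> x0 Hc; elim: n x x0 => [|n IH] x x0; last first.
  have x1 : 0 < x + 1 by lra.
  rewrite hdiffRS mulrBl; apply: hasI_sub (IH x x0) (IH _ x1).
  - by apply: contM; [apply: cont_exp; apply: contN; exact: cont_lin|exact: cont_hasse_ker].
  - by move=> y; rewrite mulr_ge0 ?expR_ge0 ?hasse_ker_ge0.
  - by move=> y; rewrite (hasse_kerS n.+2); ring.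
have x1 : 0 < x + 1 by lra.
have x2 : 0 < x + 1 + 1 by lra.
have H1 := hasI_add (hasI_exp_rem_scale x0 Hc) (hasI_exp_rem_scale x2 Hc).
have H2 := hasI_scale (ler0n R 2) (hasI_exp_rem_scale x1 Hc).
rewrite !hdiffRS !hdiffR0 !mulNr !opprK.
apply: hasI_ext (hasI_sub _ _ _ H1 H2) => //.
- by ring.
- by apply: contM; [apply: cont_exp; apply: contN; exact: cont_lin|exact: cont_hasse_ker].
- by move=> y; rewrite mulr_ge0 ?expR_ge0 ?hasse_ker_ge0.
- move=> y; rewrite /exp_rem_mellin /exp_rem !hasse_kerS /hasse_ker !expr0 !mulr1; ring.
Qed.

End HasseIntegrals.

(** * A finite partial fraction expansion of coth *)

Section Coth.
Variable R : realType.
Local Notation C := (Cx R).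
Implicit Types (x y : R).

(** Expand T / (T - w^k) as a finite geometric sum in w^k / T, using w^N = 1,
and sum over k first. *)
Lemma sum_inv_uroot N (T : C) : (0 < N)%N -> T != 0 -> (forall k, T - uroot R N ^+ k != 0) ->
  T ^+ N != 1 ->
  \sum_(k < N) T / (T - uroot R N ^+ k) = N%:R * T ^+ N / (T ^+ N - 1).
Proof.
move=> N0 T0 Tk TN; set w := uroot R N.
have TN0 : T ^+ N - 1 != 0 by rewrite subr_eq0.
have e (k : 'I_N) : T / (T - w ^+ k) = (T ^+ N / (T ^+ N - 1)) * \sum_(j < N) (w ^+ j) ^+ k * T ^- j.
  have h := Tk k.
  have := subrX1 (w ^+ k / T) N.
  rewrite expr_div_n exprAC uroot_unity // expr1n div1r.
  have -> : \sum_(i < N) (w ^+ k / T) ^+ i = \sum_(j < N) (w ^+ j) ^+ k * T ^- j.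
    by apply: eq_bigr => j _; rewrite expr_div_n exprAC.
  set S := \sum_(j < N) _ => e.
  have -> : S = (T ^- N - 1) / (w ^+ k / T - 1).
    rewrite e [_ * S]mulrC mulfK //.
    have -> : w ^+ k / T - 1 = - (T - w ^+ k) / T by field.
    by rewrite mulf_neq0 ?oppr_eq0 ?invr_eq0.
  have TNn : T ^+ N != 0 by rewrite expf_neq0.
  have h2 : w ^+ k - T != 0 by rewrite -opprB oppr_eq0.
  by move: (T ^+ N) TN0 TNn => Y Y1 Y0; move: (w ^+ k) h h2 => W h h2; field; rewrite mulN1r h h2 Y1 Y0 T0.
rewrite (eq_bigr _ (fun k _ => e k)) -mulr_sumr exchange_big /=.
have -> : \sum_(j < N) \sum_(i < N) (w ^+ j) ^+ i * T ^- j = N%:R.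
  have h0 : \sum_(i < N) (w ^+ 0) ^+ i * T ^- 0 = N%:R.
    transitivity (\sum_(i < N) (1 : C)); last by rewrite sumr_const card_ord.
    by apply: eq_bigr => k _; rewrite expr0 expr1n mul1r invr1.
  rewrite (bigD1 (Ordinal N0)) //= h0 big1 ?addr0 // => j j0.
  have j0' : (0 < j < N)%N by rewrite ltn_ord andbT lt0n.
  by rewrite -mulr_suml uroot_sum ?mul0r.
by rewrite mulrC mulrA.
Qed.

(** sinh(u) / (cosh(u) - cos(2 pi k / N)) written in T = e^u. *)
Definition cterm (N k : nat) (T : R) : R :=
  (T ^+ 2 - 1) / (T ^+ 2 - 2 * T * cos (2 * pi * k%:R / N%:R) + 1).

Lemma cterm_den N k (T : R) : 1 < T -> 0 < T ^+ 2 - 2 * T * cos (2 * pi * k%:R / N%:R) + 1.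
Proof.
move=> T1; have := cos_le1 (2 * pi * k%:R / N%:R : R); set c := cos _ => c1.
have : 2 * T * c <= 2 * T * 1 by rewrite ler_wpM2l //; lra.
have : 0 < (T - 1) ^+ 2 by rewrite exprn_gt0 //; lra.
rewrite !expr2; lra.
Qed.

(** Real part of [sum_inv_uroot]: N coth(N u / 2) is a sum of N terms over the
N-th roots of unity. *)
Lemma coth_finite N (T : R) : (0 < N)%N -> 1 < T ->
  \sum_(k < N) cterm N k T = N%:R * (T ^+ N + 1) / (T ^+ N - 1).
Proof.
move=> N0 T1; set w := uroot R N.
have nw k : nm (w ^+ k) = 1 by rewrite nmX nm_uroot expr1n.
have Tk k : toC T - w ^+ k != 0.
  apply/eqP => /eqP; rewrite subr_eq0 => /eqP h.
  by have := nw k; rewrite -h nm_toC gtr0_norm; lra.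
have T0 : toC T != 0 by rewrite -nm_gt0 nm_toC normr_gt0 gt_eqF //; lra.
have TN1 : 1 < T ^+ N by rewrite exprn_egt1 // -lt0n.
have TN : toC T ^+ N != 1.
  apply/eqP => /(congr1 (@nm R)); rewrite nmX nm_toC nm1 gtr0_norm; lra.
have := sum_inv_uroot N0 T0 Tk TN.
move/(congr1 (@ReC R)); rewrite (big_morph (@ReC R) (@ReCD R) (ReC0 R)).
have -> : N%:R * toC T ^+ N / (toC T ^+ N - 1) = toC (N%:R * T ^+ N / (T ^+ N - 1)).
  by rewrite !rmorphM fmorphV rmorphB rmorphXn rmorph1 rmorph_nat.
rewrite Re_toC => e.
have ct (k : 'I_N) : cterm N k T = 2 * ReC (toC T / (toC T - w ^+ k)) - 1.
  have cw : ReC (w ^+ k) = cos (2 * pi * k%:R / N%:R) by rewrite Re_urootX.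
  have n2 : ReC (w ^+ k) ^+ 2 + ImC (w ^+ k) ^+ 2 = 1 by rewrite -nm_sqr nw expr1n.
  have d0 : 0 < T ^+ 2 - 2 * T * ReC (w ^+ k) + 1 by rewrite cw; exact: cterm_den.
  have -> : ReC (toC T / (toC T - w ^+ k)) = T * (T - ReC (w ^+ k)) / (T ^+ 2 - 2 * T * ReC (w ^+ k) + 1).
    have -> : toC T / (toC T - w ^+ k) = toC (T / (T ^+ 2 - 2 * T * ReC (w ^+ k) + 1)) * (toC T - w ^+ k)^*.
      apply: (mulIf (Tk k)); rewrite divfK // -[RHS]mulrA [X in _ = _ * X]mulrC.
      have -> : (toC T - w ^+ k) * (toC T - w ^+ k)^* = toC (T ^+ 2 - 2 * T * ReC (w ^+ k) + 1).
        apply: eqC; rewrite !(ReImE, ReC_conj, ImC_conj); last by ring.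
        by move: n2; rewrite !expr2; lra.
      by rewrite -(rmorphM (@toC R)) divfK // gt_eqF.
    by rewrite !(ReImE, ReC_conj, ImC_conj); field; rewrite gt_eqF.
  rewrite /cterm -cw; field; rewrite gt_eqF //.
rewrite (eq_bigr _ (fun k _ => ct k)) sumrB -mulr_sumr e sumr_const card_ord.
by field; lra.
Qed.

(** For odd N the terms k and N - k coincide, and the term k = 0 is split off.
*)
Lemma coth_finite_odd M (T : R) : 1 < T ->
  \sum_(0 <= k < M) cterm (2 * M).+1 k.+1 T =
  ((2 * M).+1%:R * (T ^+ (2 * M).+1 + 1) / (T ^+ (2 * M).+1 - 1) - (T + 1) / (T - 1)) / 2.
Proof.
move=> T1; set N := (2 * M).+1.
have := coth_finite (ltn0Sn (2 * M)) T1; rewrite -/N => <-.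
rewrite -(big_mkord xpredT (fun k => cterm N k T)) /N big_nat_recl //=.
have -> : cterm N 0 T = (T + 1) / (T - 1).
  rewrite /cterm mulr0 mul0r cos0 (_ : T ^+ 2 - 2 * T * 1 + 1 = (T - 1) ^+ 2); last by ring.
  by field; lra.
rewrite [_ + \sum_(0 <= i < 2 * M) _]addrC addrK.
have M2 : (M <= 2 * M)%N by lia.
rewrite [in RHS](@big_cat_nat _ _ _ M) //= -/N.
have -> : \sum_(M <= i < 2 * M) cterm N i.+1 T = \sum_(0 <= k < M) cterm N k.+1 T.
  rewrite -{1}[M]add0n big_addn (_ : 2 * M - M = M)%N; last by lia.
  rewrite [RHS]big_nat_rev /=; apply: eq_big_nat => i /andP[_ iM].
  rewrite /cterm; congr (_ / (_ - _ * _ + _)).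
  have N0 : 0 < N%:R :> R by rewrite ltr0n.
  have -> : 2 * pi * (i + M).+1%:R / N%:R = pi *+ 2 - 2 * pi * (0 + M - i.+1).+1%:R / N%:R :> R.
    have -> : (i + M).+1 = (N - (0 + M - i.+1).+1)%N by rewrite /N; lia.
    rewrite natrB; last by rewrite /N; lia.
    by rewrite -mulr_natl; field; rewrite gt_eqF.
  by rewrite addrC cosD2pi cosN.
by field.
Qed.

End Coth.

(** * The partial fraction series of coth *)

Section CothSeries.
Variable R : realType.
Implicit Types (x y : R).

(** Dominated convergence for series with the domination written as
telescoping increments. *)
Lemma tannery (u : nat -> nat -> R) (v : nat -> R) (B L : R) : 0 <= B ->
  (forall N k, `|u N k| <= B * (tau R k - tau R k.+1)) ->
  (forall k, u N k @[N --> \oo] --> v k) ->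
  \sum_(0 <= k < N) u N k @[N --> \oo] --> L ->
  series v n @[n --> \oo] --> L.
Proof.
move=> B0 Hu Huv HS.
have key K : `|series v K - L| <= B * tau R K.
  have H : \sum_(0 <= k < K) u N k - \sum_(0 <= k < N) u N k @[N --> \oo] --> series v K - L.
    apply: cvgB => //; rewrite /series /=.
    elim: K => [|K IH].
      by under eq_fun do rewrite big_geq //; rewrite big_geq //; exact: cvg_cst.
    under eq_fun do rewrite big_nat_recr //=; rewrite big_nat_recr //=.
    by apply: cvgD.
  apply/ler_addgt0Pr => e e0.
  move/cvgrPdist_lt : H => /(_ e e0) [N _ HN].
  have := HN (maxn N K) (leq_maxl _ _) => /=; set M := maxn N K.
  have KM : (K <= M)%N by rewrite leq_maxr.
  rewrite (@big_cat_nat _ _ _ K 0 M) //= [in X in _ - X]opprD [in X in _ - X]addrA [in X in _ - X]subrr sub0r => h.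
  have b : `|\sum_(K <= i < M) u M i| <= B * tau R K.
    apply: le_trans (ler_norm_sum _ _ _) _.
    apply: (@le_trans _ _ (\sum_(K <= i < M) (B * (tau R i - tau R i.+1)))); first exact: ler_sum.
    rewrite -mulr_sumr ler_wpM2l // -(opprK (\sum_(_ <= _ < _) _)) -sumrN.
    under eq_bigr do rewrite opprB.
    by rewrite telescope_sumr // opprB; have := tau_gt0 R M; lra.
  set A := series v K - L in h *; set S := \sum_(_ <= _ < _) _ in h b *.
  have -> : A = (A - - S) - S by ring.
  apply: le_trans (ler_normB _ _) _; lra.
apply/cvgrPdist_lt => e e0.
have [N HN] := @tau_small R (e / (B + 1)) ltac:(by rewrite divr_gt0 //; lra).
exists N => // n /= /HN; rewrite ltr_pdivlMr; last lra.
rewrite distrC => h; apply: le_lt_trans (key n) _; have := tau_gt0 R n; lra.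
Qed.

Lemma sin_le x : 0 <= x -> `|sin x| <= x.
Proof.
move=> x0.
have [|c] := @MVT_segment R sin cos 0 x x0.
- by apply: continuous_subspaceT => y; exact: continuous_sin.
move=> _; rewrite sin0 !subr0 => ->; rewrite normrM (ger0_norm x0).
by rewrite -[leRHS]mul1r ler_wpM2r // cos_max.
Qed.

Lemma cosE2 x : cos x = 1 - 2 * sin (x / 2) ^+ 2.
Proof.
have -> : cos x = cos (x / 2 *+ 2) by rewrite -mulr_natl mulrCA divff ?mulr1.
by rewrite cos_mulr2n -mulr_natl; have := cos2Dsin2 (x / 2); lra.
Qed.

Lemma sin_bounds x : 0 <= x -> x - x ^+ 3 <= sin x <= x.
Proof.
move=> x0; apply/andP; split; last by apply: le_trans (sin_le x0); exact: ler_norm.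
have [|c] := @MVT_segment R sin cos 0 x x0.
- by apply: continuous_subspaceT => y; exact: continuous_sin.
rewrite in_itv /= => /andP[c0 cx]; rewrite sin0 !subr0 => ->.
have : 1 - cos c <= c ^+ 2.
  rewrite cosE2; have c20 : 0 <= c / 2 by lra.
  have h := sin_le c20; have : sin (c / 2) ^+ 2 <= (c / 2) ^+ 2.
    by rewrite -real_normK ?num_real // lerXn2r ?nnegrE.
  rewrite expr_div_n; have := sqr_ge0 c; lra.
have c2x : c ^+ 2 <= x ^+ 2 by rewrite lerXn2r ?nnegrE.
move=> h; have : x * (1 - cos c) <= x * x ^+ 2 by rewrite ler_wpM2l //; lra.
by rewrite -exprS; lra.
Qed.

(** A quadratic lower bound on [0, pi], which dominates the terms of the
finite expansion uniformly in N. *)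
Lemma one_cos_ge x : 0 <= x <= pi -> x ^+ 2 / 32 <= 1 - cos x.
Proof.
move=> /andP[x0 xpi].
have cge y : 0 <= y <= pi / 4 -> 2^-1 <= cos y.
  move=> /andP[y0 y4].
  have c2 : 0 <= cos (y *+ 2) by apply: cos_ge0_pihalf; rewrite -mulr_natl; have := pi_gt0 R; lra.
  have c0 : 0 <= cos y by apply: cos_ge0_pihalf; have := pi_gt0 R; lra.
  rewrite -(@ler_pXn2r _ 2) ?nnegrE //.
  by move: c2; rewrite cos_mulr2n -mulr_natl exprVn; lra.
pose y := x / 4; have y0 : 0 <= y by rewrite /y; lra.
have y4 : y <= pi / 4 by rewrite /y; lra.
have sy : y / 2 <= sin y.
  have [|c] := @MVT_segment R sin cos 0 y y0.
  - by apply: continuous_subspaceT => z; exact: continuous_sin.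
  rewrite in_itv /= => /andP[c0 cy]; rewrite sin0 !subr0 => ->.
  by rewrite mulrC ler_wpM2r //; apply: cge; lra.
have cy : 2^-1 <= cos y by apply: cge; lra.
have s2 : x / 8 <= sin (x / 2).
  have -> : x / 2 = y *+ 2 by rewrite /y -mulr_natl; field.
  rewrite sin_mulr2n -mulr_natl.
  have : 2^-1 * (y / 2) <= cos y * sin y by apply: ler_pM => //; lra.
  by rewrite /y; lra.
rewrite cosE2.
have : (x / 8) ^+ 2 <= sin (x / 2) ^+ 2 by rewrite lerXn2r ?nnegrE //; lra.
by rewrite expr_div_n; lra.
Qed.

Lemma expR_bounds x : 0 <= x -> x <= expR x - 1 <= x * expR x.
Proof.
move=> x0; have h := expR_ge1Dx x; have h2 := expR_ge1Dx (- x).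
have e0 := expR_gt0 x; apply/andP; split; first lra.
have : expR x * (1 - x) <= expR x * expR (- x) by rewrite ler_wpM2l // ltW.
by rewrite expRxMexpNx_1; lra.
Qed.

(** The finite expansions of coth are taken of odd size, for which the terms
pair up. *)
Definition oddn (M : nat) : R := (2 * M).+1%:R.
Lemma oddn_gt0 M : 0 < oddn M. Proof. by rewrite ltr0n. Qed.

Lemma oddn_inv : (oddn M)^-1 @[M --> \oo] --> (0 : R).
Proof.
apply/cvgr0Pnorm_le => e e0; near=> M.
rewrite ger0_norm ?invr_ge0 ?(ltW (oddn_gt0 M)) // -[e]invrK lef_pV2 ?posrE ?oddn_gt0 ?invr_gt0 //.
apply: (@le_trans _ _ M%:R); last by rewrite ler_nat; lia.
near: M; exact: nbhs_infty_ger.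
Unshelve. all: by end_near. Qed.

(** Limit of [coth_finite_odd] with T = e^(x/N): each term converges because N
(T - 1) tends to x and N sin(pi k / N) to pi k, and the terms are dominated by
a multiple of 1/k^2. *)
Lemma coth_series x : 0 < x ->
  series (fun n => 2 * x ^+ 2 / (x ^+ 2 + (2 * pi * n.+1%:R) ^+ 2)) n @[n --> \oo] -->
  x / (expR x - 1) - 1 + x / 2.
Proof.
move=> x0.
pose T M := expR (x / oddn M).
have T1 M : 1 < T M by rewrite expR_gt1 divr_gt0 ?oddn_gt0.
have TN M : T M ^+ (2 * M).+1 = expR x.
  by rewrite /T -expRM_natl /oddn mulrCA divff ?mulr1 // pnatr_eq0.
have Tx M : T M <= expR x.
  rewrite ler_expR ler_pdivrMr ?oddn_gt0 // ler_peMr ?(ltW x0) //.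
  by rewrite /oddn ler1n.
have ex1 : 1 < expR x by rewrite expR_gt1.
have hb M : x <= oddn M * (T M - 1) <= x * T M.
  have := @expR_bounds (x / oddn M) (ltW (divr_gt0 x0 (oddn_gt0 M))) => /andP[a b].
  have o0 := oddn_gt0 M; apply/andP; split.
    by rewrite -ler_pdivrMl // mulrC.
  have := ler_wpM2l (ltW o0) b; rewrite mulrA [oddn M * (x / _)]mulrCA divff ?mulr1 // gt_eqF //.
have Tlim : T M @[M --> \oo] --> (1 : R).
  have H : x / oddn M @[M --> \oo] --> (x * 0 : R) by apply: cvgM; [exact: cvg_cst|exact: oddn_inv].
  rewrite mulr0 in H; rewrite -(expR0 R).
  exact: (cvg_comp _ _ H (@continuous_expR R 0)).
have NT : oddn M * (T M - 1) @[M --> \oo] --> x.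
  apply: (squeeze_cvgr (f := fun=> x) (h := fun M => x * T M)).
  - by apply: nearW => M; exact: hb.
  - exact: cvg_cst.
  - rewrite -[X in _ --> X]mulr1; apply: cvgM => //; exact: cvg_cst.
have sinlim (c : R) : 0 < c -> oddn M * sin (c / oddn M) @[M --> \oo] --> c.
  move=> c0; apply: (squeeze_cvgr (f := fun M => c - c ^+ 3 * (oddn M)^-1 * (oddn M)^-1) (h := fun=> c)).
  - apply: nearW => M; have o0 := oddn_gt0 M.
    have /andP[a b] := @sin_bounds (c / oddn M) (ltW (divr_gt0 c0 o0)).
    have := ler_wpM2l (ltW o0) a; have := ler_wpM2l (ltW o0) b.
    have -> : oddn M * (c / oddn M) = c by field; rewrite gt_eqF.
    have -> : oddn M * (c / oddn M - (c / oddn M) ^+ 3) = c - c ^+ 3 / oddn M / oddn M.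
      by field; rewrite gt_eqF.
    by move=> -> ->.
  - rewrite -[X in _ --> X]subr0; apply: cvgB; first exact: cvg_cst.
    rewrite -[X in _ --> X](mulr0 (c ^+ 3 * 0)); apply: cvgM; last exact: oddn_inv.
    by apply: cvgM; [exact: cvg_cst|exact: oddn_inv].
  - exact: cvg_cst.
pose u M k := if (k < M)%N then cterm (2 * M).+1 k.+1 (T M) / oddn M else 0.
pose th M k := 2 * pi * k.+1%:R / oddn M.
have uE M k : cterm (2 * M).+1 k.+1 (T M) / oddn M =
  (T M + 1) * (oddn M * (T M - 1)) / ((oddn M * (T M - 1)) ^+ 2 +
     4 * T M * (oddn M * sin (pi * k.+1%:R / oddn M)) ^+ 2).
  have o0 := oddn_gt0 M; have t1 := T1 M.
  have := cterm_den (2 * M).+1 k.+1 t1; rewrite /cterm -/(oddn M) cosE2.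
  have -> : 2 * pi * k.+1%:R / oddn M / 2 = pi * k.+1%:R / oddn M by field; rewrite gt_eqF.
  move: (sin _) => S.
  have -> : T M ^+ 2 - 2 * T M * (1 - 2 * S ^+ 2) + 1 = (T M - 1) ^+ 2 + 4 * T M * S ^+ 2 by ring.
  have -> : (oddn M * (T M - 1)) ^+ 2 + 4 * T M * (oddn M * S) ^+ 2 = oddn M ^+ 2 * ((T M - 1) ^+ 2 + 4 * T M * S ^+ 2) by ring.
  set D := _ + _ => D0; field; rewrite !gt_eqF //.
have pi0 := pi_gt0 R.
have H2 : series (fun n => 2 * x / (x ^+ 2 + (2 * pi * n.+1%:R) ^+ 2)) n @[n --> \oo] -->
   ((expR x + 1) / (expR x - 1) - 2 / x) / 2.
  apply: (@tannery u _ (64 * x * expR x)).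
  - by rewrite !mulr_ge0 ?expR_ge0 // ltW.
  - move=> M k; rewrite /u; case: ifP => kM; last first.
      rewrite normr0 mulr_ge0 ?mulr_ge0 ?expR_ge0 ?(ltW x0) // subr_ge0.
      exact: tau_noninc.
    have o0 := oddn_gt0 M; have t1 := T1 M.
    have den := cterm_den (2 * M).+1 k.+1 t1.
    rewrite ger0_norm; last first.
      rewrite divr_ge0 ?(ltW o0) // /cterm divr_ge0 ?(ltW den) //.
      by rewrite subr_ge0 exprn_ege1 // ltW.
    have th0 : 0 <= th M k <= pi.
      apply/andP; split; first by rewrite divr_ge0 ?mulr_ge0 ?(ltW o0) ?(ltW pi0).
      rewrite ler_pdivrMr // -mulrA mulrCA ler_wpM2l ?(ltW pi0) //.
      by rewrite /oddn -natrM ler_nat; lia.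
    have oc := one_cos_ge th0.
    have th2 : 0 < th M k ^+ 2 by rewrite exprn_gt0 // divr_gt0 // !mulr_gt0 // ltr0n.
    have b1 : cterm (2 * M).+1 k.+1 (T M) <= 32 * (T M - 1) / th M k ^+ 2.
      rewrite /cterm ler_pdivrMr // -[leRHS]mulrA [_^-1 * _]mulrC mulrA ler_pdivlMr // -/(oddn M) -/(th M k).
      have -> : T M ^+ 2 - 2 * T M * cos (th M k) + 1 = (T M - 1) ^+ 2 + 2 * T M * (1 - cos (th M k)) by ring.
      have : 2 * T M * (th M k ^+ 2 / 32) <= 2 * T M * (1 - cos (th M k)) by rewrite ler_wpM2l //; lra.
      have s1 : 0 <= (T M - 1) ^+ 2 by exact: sqr_ge0.
      move=> s2.
      apply: (@le_trans _ _ (32 * (T M - 1) * (2 * T M * (th M k ^+ 2 / 32)))); last first.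
        by rewrite ler_wpM2l; lra.
      have -> : 32 * (T M - 1) * (2 * T M * (th M k ^+ 2 / 32)) = (T M - 1) * (2 * T M) * th M k ^+ 2 by field.
      rewrite ler_wpM2r ?(ltW th2) //.
      have -> : T M ^+ 2 - 1 = (T M - 1) * (T M + 1) by ring.
      by rewrite ler_wpM2l; lra.
    apply: (@le_trans _ _ (32 * (T M - 1) / th M k ^+ 2 / oddn M)); first by rewrite ler_wpM2r ?invr_ge0 ?(ltW o0).
    have k0 : 0 < k.+1%:R :> R by rewrite ltr0n.
    have -> : 32 * (T M - 1) / th M k ^+ 2 / oddn M = 8 / pi ^+ 2 * (oddn M * (T M - 1)) / k.+1%:R ^+ 2.
      rewrite /th; move: (k.+1%:R) k0 (pi : R) pi0 => c c0 p p0; field; rewrite !gt_eqF //.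
    have b2 : oddn M * (T M - 1) <= x * expR x.
      by case/andP: (hb M) => _ h; apply: le_trans h _; rewrite ler_wpM2l // ltW.
    have b3 : 8 / pi ^+ 2 <= 2 :> R.
      rewrite ler_pdivrMr ?exprn_gt0 //.
      have : 2 ^+ 2 <= pi ^+ 2 :> R by rewrite lerXn2r ?nnegrE ?(ltW pi0) ?pi_ge2.
      have -> : (2 : R) ^+ 2 = 4 by ring.
      lra.
    have tt := tau_telescope R k.
    have b4 : (k.+1%:R ^+ 2)^-1 <= tau R k / k.+1%:R.
      rewrite expr2 invfM ler_wpM2r ?invr_ge0 // lef_pV2 ?posrE ?root4_gt0 //.
      rewrite -(@ler_pXn2r _ 4) ?nnegrE ?root4_ge0 // root4K //.
      by rewrite -{1}[k.+1%:R]expr1 ler_weXn2l // ler1n.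
    have q0 : 0 <= oddn M * (T M - 1) by rewrite mulr_ge0 ?(ltW o0) // subr_ge0 ltW.
    apply: (@le_trans _ _ (2 * (x * expR x) * (32 * (tau R k - tau R k.+1)))); last lra.
    apply: ler_pM; rewrite ?invr_ge0 ?exprn_ge0 //; last by apply: le_trans tt.
      by rewrite mulr_ge0 // divr_ge0 // exprn_ge0 // ltW.
    by apply: ler_pM => //; rewrite divr_ge0 // exprn_ge0 // ltW.
  - move=> k.
    have c0 : 0 < pi * k.+1%:R :> R by rewrite mulr_gt0 // ltr0n.
    have xx : 0 < x ^+ 2 by rewrite exprn_gt0.
    have pk : 0 < (pi * k.+1%:R) ^+ 2 :> R by rewrite exprn_gt0.
    have H : (T M + 1) * (oddn M * (T M - 1)) / ((oddn M * (T M - 1)) * (oddn M * (T M - 1)) +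
     4 * T M * ((oddn M * sin (pi * k.+1%:R / oddn M)) * (oddn M * sin (pi * k.+1%:R / oddn M)))) @[M --> \oo] -->
     (1 + 1) * x / (x * x + 4 * 1 * ((pi * k.+1%:R) * (pi * k.+1%:R))).
      have S := sinlim _ c0.
      apply: cvgM.
        by apply: cvgM => //; apply: cvgD => //; exact: cvg_cst.
      apply: cvgV; first by rewrite gt_eqF // -!expr2; lra.
      apply: cvgD; first exact: cvgM.
      by apply: cvgM; [apply: cvgM => //; exact: cvg_cst|exact: cvgM].
    have -> : 2 * x / (x ^+ 2 + (2 * pi * k.+1%:R) ^+ 2) =
       (1 + 1) * x / (x * x + 4 * 1 * ((pi * k.+1%:R) * (pi * k.+1%:R))) :> R.
      by congr (_ / _); ring.
    apply: cvg_trans H; apply: near_eq_cvg; exists k.+1 => // M /= kM.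
    by rewrite /u kM uE !expr2.
  - have H : ((expR x + 1) / (expR x - 1) - (T M + 1) / (oddn M * (T M - 1))) / 2 @[M --> \oo] -->
      ((expR x + 1) / (expR x - 1) - (1 + 1) / x) / 2.
      apply: cvgM; last exact: cvg_cst.
      apply: cvgB; first exact: cvg_cst.
      apply: cvgM; first by apply: cvgD => //; exact: cvg_cst.
      by apply: cvgV => //; rewrite gt_eqF.
    apply: cvg_trans H; apply: near_eq_cvg; apply: nearW => M.
    rewrite (eq_big_nat _ _ (F2 := fun k => cterm (2 * M).+1 k.+1 (T M) / oddn M)); last first.
      by move=> k /andP[_ kM]; rewrite /u kM.
    rewrite -mulr_suml coth_finite_odd // TN -/(oddn M).
    have o0 := oddn_gt0 M; have t1 := T1 M.
    field; rewrite !gt_eqF //; lra.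
have H3 : x * series (fun n => 2 * x / (x ^+ 2 + (2 * pi * n.+1%:R) ^+ 2)) n @[n --> \oo] -->
   x * (((expR x + 1) / (expR x - 1) - 2 / x) / 2) by apply: cvgM => //; exact: cvg_cst.
have -> : x / (expR x - 1) - 1 + x / 2 = x * (((expR x + 1) / (expR x - 1) - 2 / x) / 2).
  by field; rewrite !gt_eqF //; lra.
apply: cvg_trans H3; apply: near_eq_cvg; apply: nearW => n.
rewrite /series /= mulr_sumr; apply: eq_bigr => k _; ring.
Qed.

End CothSeries.

(** * The functional equation on a real interval, through integrals *)

Section RealFunctionalEquation.
Variable R : realType.
Local Notation C := (Cx R).
Implicit Types (f : R -> R) (a b s x y t : R).

(** The partial sums have derivative (1 - y^N)/(1 - y), so the error is at
most q^(N+1)/(1 - q) by the mean value theorem. *)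
Lemma log_series (q : R) : 0 <= q < 1 ->
  series (fun n => q ^+ n.+1 / n.+1%:R) n @[n --> \oo] --> - ln (1 - q).
Proof.
move=> /andP[q0 q1].
pose d N y := - ln (1 - y) - series (fun n => y ^+ n.+1 / n.+1%:R) N.
have dd N y : 0 <= y -> y <= q -> is_derive y (1 : R) (d N) (y ^+ N / (1 - y)).
  move=> y0 yq; have y1 : 0 < 1 - y by lra.
  have DS : is_derive y (1 : R) (fun y => series (fun n => y ^+ n.+1 / n.+1%:R) N) (\sum_(0 <= k < N) y ^+ k).
    elim: N => [|N IH].
      rewrite big_geq //; apply: (drv_eq (drv_cst 0 y)) => // t.
      by rewrite /series /= big_geq.
    rewrite big_nat_recr //=.
    have D := is_deriveX N.+1 (is_derive_id y (1 : R)).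
    apply: (drv_eq (drvD IH (drvZ (N.+1%:R^-1) D))) => [t|].
      by rewrite /series /= big_nat_recr //= exprfctE mulrC.
    by congr (_ + _); rewrite /GRing.scale /= mulr1 mulrA mulVf ?mul1r // pnatr_eq0.
  have DL := drv_comp (f := @ln R) (g := fun y => 1 - y) (is_derive1_ln y1) (drvB (drv_cst 1 y) (drv_id y)).
  apply: (drv_eq (drvB (drvZ (-1) DL) DS)) => [t|]; first by rewrite /d mulN1r.
  have := subrX1 y N; rewrite -(big_mkord xpredT (fun i => y ^+ i)); set S := \sum_(_ <= _ < _) _.
  move=> e; have -> : y ^+ N = 1 + (y - 1) * S by rewrite -e addrC subrK.
  by field; lra.
have key N : `|d N q| <= q * (q ^+ N / (1 - q)).
  have q1' : 0 < 1 - q by lra.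
  have [||c] := @MVT_segment R (d N) (fun y => y ^+ N / (1 - y)) 0 q q0.
  - by move=> y; rewrite in_itv /= => /andP[y0 y1]; apply: dd; exact: ltW.
  - apply: derivable_within_continuous => y; rewrite in_itv /= => /andP[y0 yq].
    by have [] := dd N y y0 yq.
  rewrite in_itv /= => /andP[c0 cq].
  have -> : d N 0 = 0.
    by rewrite /d subr0 ln1 oppr0 sub0r /series /= big1 ?oppr0 // => k _; rewrite expr0n mul0r.
  rewrite !subr0 => ->; rewrite normrM (ger0_norm q0) mulrC ler_wpM2l //.
  rewrite ger0_norm; last by rewrite divr_ge0 ?exprn_ge0 //; lra.
  apply: ler_pM; rewrite ?exprn_ge0 ?invr_ge0 //; first by lra.
    by rewrite lerXn2r ?nnegrE.
  by rewrite lef_pV2 ?posrE; lra.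
apply/cvgrPdist_le => e e0.
have H : q * (q ^+ N / (1 - q)) @[N --> \oo] --> (q * (0 / (1 - q)) : R).
  apply: cvgM; first exact: cvg_cst.
  by apply: cvgM; [apply: cvg_expr; rewrite ger0_norm|exact: cvg_cst].
rewrite mul0r mulr0 in H; move/cvgr0Pnorm_le : H => /(_ e e0); apply: filterS => N h.
apply: le_trans (key N) _; apply: le_trans (ler_norm _) h.
Qed.

(** t/(e^t - 1), the generating function of the Bernoulli numbers, at t = e^y.
*)
Definition bern y : R := expR y / (expR (expR y) - 1).

Lemma expexp_gt1 y : 0 < expR (expR y) - 1 :> R.
Proof. by rewrite subr_gt0 expR_gt1 expR_gt0. Qed.

Lemma cont_bern : cont bern.
Proof.
have c1 : cont (fun y : R => expR y) := cont_exp (@cont_id R).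
apply: (contM c1); apply: contV => [x|]; first by rewrite gt_eqF // expexp_gt1.
exact (contB (cont_exp c1) (@cont_cst R 1)).
Qed.

(** t = -ln(1 - (1 - e^(-t))), expanded as a logarithmic series: this is the
origin of Hasse's series. *)
Lemma bern_hasse y : series (fun n => n.+1%:R^-1 * hasse_ker n 1 y) n @[n --> \oo] --> bern y.
Proof.
set t := expR y; have t0 : 0 < t := expR_gt0 y.
have E0 := expR_gt0 (- t); have E1 : expR (- t) < 1 by rewrite expR_lt1; lra.
set q := 1 - expR (- t); have q01 : 0 <= q < 1 by rewrite /q; lra.
have q0 : 0 < q by rewrite /q; lra.
have := log_series q01; rewrite {2}/q opprB addrC subrK expRK opprK => H.
have H2 : expR (- t) / q * series (fun n => q ^+ n.+1 / n.+1%:R) n @[n --> \oo] --> expR (- t) / q * t.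
  by apply: cvgM; [exact: cvg_cst|exact: H].
have -> : bern y = expR (- t) / q * t.
  rewrite /bern -/t /q expRN; have := expexp_gt1 y; rewrite -/t; have := expR_gt0 t.
  move: (expR t) => E e0 e1; field; rewrite !gt_eqF //.
apply: cvg_trans H2; apply: near_eq_cvg; apply: nearW => n.
rewrite /series /= mulr_sumr; apply: eq_bigr => k _.
rewrite /hasse_ker mul1r -/t -/q exprS; field.
by rewrite (gt_eqF q0) andbT addrC natr1 pnatr_eq0.
Qed.

(** The geometric series of 1/(e^t - 1). *)
Lemma bern_geom y : series (fun m => expR y * expR (- (m.+1%:R * expR y))) m @[m --> \oo] --> bern y.
Proof.
set t := expR y; have t0 : 0 < t := expR_gt0 y.
have E0 := expR_gt0 (- t); have E1 : expR (- t) < 1 by rewrite expR_lt1; lra.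
have H := @cvg_geometric_series R (t * expR (- t)) (expR (- t)).
have {}H : series (geometric (t * expR (- t)) (expR (- t))) n @[n --> \oo] --> t * expR (- t) / (1 - expR (- t)).
  by apply: H; rewrite ger0_norm // ltW.
have -> : bern y = t * expR (- t) / (1 - expR (- t)).
  rewrite /bern -/t expRN; have := expexp_gt1 y; rewrite -/t; have := expR_gt0 t.
  move: (expR t) => E e0 e1; field; rewrite !gt_eqF //.
apply: cvg_trans H; apply: near_eq_cvg; apply: nearW => n.
rewrite /series /=; apply: eq_bigr => k _; rewrite /geometric /= -mulrA; congr (_ * _).
by rewrite -expRM_natl -expRD -[k.+1%:R]natr1; congr expR; ring.
Qed.

(** Hs is real on the real axis, by symmetry under conjugation. *)
Definition HsR x : R := ReC (Hs (toC x)).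

Lemma Hs_toC x : Hs (toC x) = toC (HsR x).
Proof.
apply: eqC; rewrite !ReImE //.
have := Hs_conj (toC x); rewrite conj_toC => /(congr1 (@ImC R)).
rewrite ImC_conj => h; lra.
Qed.

Lemma HsR_cvg x : series (fun n => n.+1%:R^-1 * hdiffR n (x - 1) 1) n @[n --> \oo] --> HsR x.
Proof.
have /cvg_seqC H := @Hs_cvg R (toC x).
apply/cvgrPdist_lt => e e0; have [N HN] := H e e0.
exists N => // n /= /HN h; apply: le_lt_trans h; rewrite distrC.
have -> : series (fun n => n.+1%:R^-1 * hdiffR n (x - 1) 1) n - HsR x =
   @ReC R (series (fun n => @hterm R n (toC x)) n - Hs (toC x)); last exact: Re_le_nm.
rewrite ReCD ReCN; congr (_ - _); rewrite /series /=.
rewrite (big_morph (@ReC R) (@ReCD R) (erefl : @ReC R 0 = 0)); apply: eq_bigr => k _.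
rewrite htermE -(rmorph1 (@toC R)) -(rmorphB (@toC R)) -(rmorph_nat (@toC R)) -(fmorphV (@toC R)).
by rewrite ReCM Re_toC Im_toC mul0r subr0.
Qed.

(** Integrating [bern_hasse] term by term gives Hasse's series. *)
Lemma hasI_bern b : 0 < b -> hasI (fun y => expR (b * y) * bern y) (HsR (1 + b) * gammaI b).
Proof.
move=> b0.
apply/(@hasI_seriesP R (fun n y => n.+1%:R^-1 * (expR (b * y) * hasse_ker n 1 y))
   (fun n => n.+1%:R^-1 * (hdiffR n b 1 * gammaI b))).
- by move=> n; apply: hasI_scale; [rewrite invr_ge0|exact: hasI_hdiffR].
- exact (contM (@cont_explin R b) cont_bern).
- move=> y; have H : expR (b * y) * series (fun n => n.+1%:R^-1 * hasse_ker n 1 y) n @[n --> \oo] --> expR (b * y) * bern y.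
    by apply: cvgM; [exact: cvg_cst|exact: bern_hasse].
  apply: cvg_trans H; apply: near_eq_cvg; apply: nearW => n.
  rewrite /series /= mulr_sumr; apply: eq_bigr => k _; ring.
- have := @HsR_cvg (1 + b); have -> : 1 + b - 1 = b by ring.
  move=> H0; have H : series (fun n => n.+1%:R^-1 * hdiffR n b 1) n * gammaI b @[n --> \oo] --> HsR (1 + b) * gammaI b.
    by apply: cvgM; [exact: H0|exact: cvg_cst].
  apply: cvg_trans H; apply: near_eq_cvg; apply: nearW => n.
  rewrite /series /= mulr_suml; apply: eq_bigr => k _; ring.
Qed.

(** Integrating [bern_geom] term by term instead: on a > 1, Hs(a) is (a - 1)
times the Dirichlet series. *)
Lemma dirichlet b : 0 < b ->
  series (fun m => expR (- ((b + 1) * ln m.+1%:R)) * gammaI (b + 1)) m @[m --> \oo] --> HsR (1 + b) * gammaI b.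
Proof.
move=> b0; have b1 : 0 < b + 1 by lra.
apply/(@hasI_seriesP R (fun m y => expR (b * y) * (expR y * expR (- (m.+1%:R * expR y)))) _ (fun y => expR (b * y) * bern y)).
- move=> m; have m0 : 0 < m.+1%:R :> R by rewrite ltr0n.
  apply: hasI_ext (hasI_gammaI_scale b1 m0) => // y.
  by rewrite -!expRD; congr expR; ring.
- exact (contM (@cont_explin R b) cont_bern).
- move=> y; have H : expR (b * y) * series (fun m => expR y * expR (- (m.+1%:R * expR y))) n @[n --> \oo] --> expR (b * y) * bern y.
    by apply: cvgM; [exact: cvg_cst|exact: bern_geom].
  apply: cvg_trans H; apply: near_eq_cvg; apply: nearW => n.
  by rewrite /series /= mulr_sumr.
- exact: hasI_bern.
Qed.

(** bern minus its Taylor polynomial of degree 1, nonnegative by its partial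
fraction expansion. *)
Definition coth_rem y : R := bern y - 1 + expR y / 2.

Lemma coth_rem_cvg y : series (fun n => 2 * expR y ^+ 2 / (expR y ^+ 2 + (2 * pi * n.+1%:R) ^+ 2)) n @[n --> \oo] --> coth_rem y.
Proof. exact: coth_series (expR_gt0 y). Qed.

Lemma coth_rem_ge0 y : 0 <= coth_rem y.
Proof.
have <- := cvg_lim (@Rhausdorff R) (@coth_rem_cvg y).
apply: limr_ge; first by apply/cvg_ex; exists (coth_rem y); exact: coth_rem_cvg.
apply: nearW => n; apply: sumr_ge0 => k _.
by have E := expR_gt0 y; rewrite divr_ge0 // ?addr_ge0 ?sqr_ge0 // mulr_ge0 // sqr_ge0.
Qed.

Lemma cont_coth_rem : cont coth_rem.
Proof.
apply: contD; first exact (contB cont_bern (@cont_cst R 1)).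
exact (contM (cont_exp (@cont_id R)) (@cont_cst R 2^-1)).
Qed.

(** bern minus the first two terms of [bern_hasse]. Only from the third term
on do the integrals against e^(-ay) converge. *)
Definition bern_tail y : R := bern y - hasse_ker 0 1 y - hasse_ker 1 1 y / 2.

Lemma series_shift2 (u : nat -> R) (l : R) : series u n @[n --> \oo] --> l ->
  series (fun n => u n.+2) n @[n --> \oo] --> l - u 0%N - u 1%N.
Proof.
move=> H; have H2 : series u n.+2 - u 0%N - u 1%N @[n --> \oo] --> l - u 0%N - u 1%N.
  apply: cvgB; last exact: cvg_cst.
  apply: cvgB; last exact: cvg_cst.
    have := H; rewrite -(cvg_shiftn 2); apply: cvg_trans; apply: near_eq_cvg.
    by apply: nearW => n /=; rewrite addn2.
apply: cvg_trans H2; apply: near_eq_cvg; apply: nearW => n.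
by rewrite /series /= !big_nat_recl //; ring.
Qed.

Lemma bern_tail_cvg y : series (fun n => n.+3%:R^-1 * hasse_ker n.+2 1 y) n @[n --> \oo] --> bern_tail y.
Proof.
have := series_shift2 (@bern_hasse y).
by rewrite /= invr1 mul1r /bern_tail [_ / 2]mulrC.
Qed.

Lemma cont_expN a : cont (fun y : R => expR (- (a * y))).
Proof. by apply: cont_exp; apply: contN; exact: cont_lin. Qed.

Lemma hasI_bern_tail a c : hasI (exp_rem_mellin a 1) c ->
  hasI (fun y => expR (- (a * y)) * bern_tail y) ((HsR (1 - a) - 1 - 2^-1 * (1 - expR (a * ln 2))) * c).
Proof.
move=> Hc.
apply/(@hasI_seriesP R (fun n y => n.+3%:R^-1 * (expR (- (a * y)) * hasse_ker n.+2 1 y))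
   (fun n => n.+3%:R^-1 * (hdiffR n.+2 (- a) 1 * c))).
- by move=> n; apply: hasI_scale; [rewrite invr_ge0|exact: hasI_hdiffR_neg].
- apply: (contM (@cont_expN a)); apply: contB.
    exact (contB cont_bern (@cont_hasse_ker R 0 1)).
  exact (contM (@cont_hasse_ker R 1 1) (@cont_cst R 2^-1)).
- move=> y; have H : expR (- (a * y)) * series (fun n => n.+3%:R^-1 * hasse_ker n.+2 1 y) n @[n --> \oo] --> expR (- (a * y)) * bern_tail y.
    by apply: cvgM; [exact: cvg_cst|exact: bern_tail_cvg].
  apply: cvg_trans H; apply: near_eq_cvg; apply: nearW => n.
  rewrite /series /= mulr_sumr; apply: eq_bigr => k _; ring.
- have := series_shift2 (@HsR_cvg (1 - a)).
  have -> : 1 - a - 1 = - a by ring.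
  rewrite invr1 mul1r hdiffRS !hdiffR0 ln1 mulr0 oppr0 expR0 mulNr opprK (_ : 1 + 1 = 2) // => H0.
  have H : series (fun n => n.+3%:R^-1 * hdiffR n.+2 (- a) 1) n * c @[n --> \oo] --> (HsR (1 - a) - 1 - 2^-1 * (1 - expR (a * ln 2))) * c.
    by apply: cvgM; [exact: H0|exact: cvg_cst].
  apply: cvg_trans H; apply: near_eq_cvg; apply: nearW => n.
  rewrite /series /= mulr_suml; apply: eq_bigr => k _; ring.
Qed.

(** The linear corrections in [coth_rem] and in [bern_tail] differ by
combinations of remainders [exp_rem], whose integrals are known. *)
Lemma hasI_coth_rem a c : hasI (exp_rem_mellin a 1) c -> hasI (fun y => expR (- (a * y)) * coth_rem y) (HsR (1 - a) * c).
Proof.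
move=> Hc.
have c32 : 0 <= 3 / 2 :> R by lra.
have H1 := hasI_add (hasI_bern_tail Hc) (hasI_scale c32 Hc).
have c12 : 0 <= 2^-1 :> R by lra.
have H2 := hasI_scale c12 (hasI_exp_rem_scale (ltr0n R 2) Hc).
apply: hasI_ext (hasI_sub _ _ _ H1 H2) => //.
- by field.
- exact (contM (@cont_expN a) cont_coth_rem).
- by move=> y; rewrite mulr_ge0 ?expR_ge0 ?coth_rem_ge0.
- move=> y; rewrite /exp_rem_mellin /bern_tail /coth_rem /exp_rem /hasse_ker !expr0 expr1 !mul1r !mulr1.
  have -> : expR (- (2 * expR y)) = expR (- expR y) * expR (- expR y).
    by rewrite -expRD; congr expR; ring.
  by field.
Qed.

Lemma hasI_cothterm a n : 1 < a < 2 ->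
  hasI (fun y => expR (- (a * y)) * (2 * expR y ^+ 2 / (expR y ^+ 2 + (2 * pi * n.+1%:R) ^+ 2)))
    (expR (- (a * ln (2 * pi * n.+1%:R))) * (gammaI (1 - a / 2) * gammaI (a / 2))).
Proof.
move=> /andP[a1 a2]; set L := ln _.
have p0 : 0 < 2 * pi * n.+1%:R :> R by rewrite !mulr_gt0 ?pi_gt0.
have a02 : 0 < 2 - a < 2 by lra.
have e0 : 0 <= 2 * expR (- (a * L)) by rewrite mulr_ge0 ?expR_ge0.
apply: hasI_ext (hasI_scale e0 (hasI_shift (- L) (hasI_beta2 a02))) => [y|]; last first.
  have -> : (2 - a) / 2 = 1 - a / 2 by field.
  have -> : 1 - (1 - a / 2) = a / 2 by ring.
  by field.
have -> : 2 * pi * n.+1%:R = expR L by rewrite lnK ?posrE.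
have -> : expR ((2 - a) * (y - L)) = expR y * expR y * expR (- (a * y)) * expR (a * L) / (expR L * expR L).
  by rewrite -!expRD -expRN -expRD; congr expR; ring.
have -> : expR (2 * (y - L)) = expR y * expR y / (expR L * expR L).
  by rewrite -!expRD -expRN -expRD; congr expR; ring.
have -> : expR (- (a * L)) = (expR (a * L))^-1 by rewrite expRN.
have := expR_gt0 L; have := expR_gt0 (a * L); have := expR_gt0 y.
move: (expR L) (expR (a * L)) (expR y) => A B D D0 B0 A0.
have AD : 0 < A * A + D * D by rewrite addr_gt0 // mulr_gt0.
have AD2 : 0 < D ^+ 2 + A ^+ 2 by rewrite addr_gt0 // exprn_gt0.
by field; rewrite !gt_eqF //= !expr2 addrC.
Qed.

(** Term by term integration of the partial fractions; each term is a beta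
integral. *)
Lemma fe_series a c : 1 < a < 2 -> hasI (exp_rem_mellin a 1) c ->
  series (fun n => expR (- (a * ln (2 * pi * n.+1%:R))) * (gammaI (1 - a / 2) * gammaI (a / 2))) n @[n --> \oo] -->
    HsR (1 - a) * c.
Proof.
move=> a12 Hc.
apply/(@hasI_seriesP R (fun n y => expR (- (a * y)) * (2 * expR y ^+ 2 / (expR y ^+ 2 + (2 * pi * n.+1%:R) ^+ 2))) _
   (fun y => expR (- (a * y)) * coth_rem y)).
- by move=> n; exact: hasI_cothterm.
- exact (contM (@cont_expN a) cont_coth_rem).
- move=> y; have H : expR (- (a * y)) * series (fun n => 2 * expR y ^+ 2 / (expR y ^+ 2 + (2 * pi * n.+1%:R) ^+ 2)) n @[n --> \oo] --> expR (- (a * y)) * coth_rem y.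
    by apply: cvgM; [exact: cvg_cst|exact: coth_rem_cvg].
  apply: cvg_trans H; apply: near_eq_cvg; apply: nearW => n.
  by rewrite /series /= mulr_sumr.
- exact: hasI_coth_rem.
Qed.

End RealFunctionalEquation.

(** * The Gamma integral and the Gauss product agree *)

Section GammaFacts.
Variable R : realType.
Local Notation C := (Cx R).
Implicit Types (a b x y t w : R) (s z : C).

Lemma hasI_le (f h : R -> R) v u : hasI f v -> hasI h u -> (forall x, f x <= h x) -> v <= u.
Proof.
move=> Hf Hh fh; have [cf _ _] := Hf; have [ch _ _] := Hh.
have H : hasI (fun x => h x - f x) (u - v).
  apply: hasI_sub Hh Hf; first exact (contB ch cf).
    by move=> x; rewrite subr_ge0.
  by move=> x; rewrite subrK.
by have := hasI_ge0 H; rewrite subr_ge0.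
Qed.

(** Log-convexity in the form Gamma(w + b) <= w^b Gamma(w), integrated from
[expR_conv]. *)
Lemma gammaI_convex w b : 0 < w -> 0 <= b <= 1 -> gammaI (w + b) <= expR (b * ln w) * gammaI w.
Proof.
move=> w0 b01; have /andP[b0 b1] := b01; have wb : 0 < w + b by lra.
have w1 : 0 < w + 1 by lra.
have b1' : 0 <= 1 - b by lra.
have bw : 0 <= b / w by rewrite divr_ge0 // ltW.
have H := hasI_add (hasI_scale b1' (hasI_gammaI w0)) (hasI_scale bw (hasI_gammaI w1)).
have := hasI_le (hasI_gammaI wb) (hasI_scale (expR_ge0 (b * ln w)) H).
rewrite gammaI_rec // (_ : (1 - b) * gammaI w + b / w * (w * gammaI w) = gammaI w); last by field; rewrite gt_eqF.
apply=> y; rewrite gam_S.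
have := expR_conv (y - ln w) b01; rewrite expRD expRN lnK ?posrE // => h.
have -> : gam (w + b) y = expR (b * ln w) * (gam w y * expR (b * (y - ln w))).
  by rewrite /gam -!expRD; congr expR; ring.
rewrite ler_wpM2l ?expR_ge0 //.
have -> : (1 - b) * gam w y + b / w * (expR y * gam w y) = gam w y * (1 - b + b * (expR y / w)).
  by ring.
by rewrite ler_wpM2l ?expR_ge0.
Qed.

Lemma gammaI_nat n : gammaI n.+1%:R = n`!%:R :> R.
Proof.
elim: n => [|n IH]; first exact: gammaI1.
by rewrite -[n.+2%:R]natr1 gammaI_rec ?ltr0n // IH factS natrM.
Qed.

Lemma gammaI_lower n b : 0 <= b <= 1 -> expR (b * ln n.+1%:R) * n.+1`!%:R <= gammaI (b + n.+2%:R).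
Proof.
move=> b01; have /andP[b0 b1] := b01.
have n0 : 0 < n.+1%:R :> R by rewrite ltr0n.
have wb : 0 < n.+1%:R + b by lra.
have b01' : 0 <= 1 - b <= 1 by lra.
have := gammaI_convex wb b01'; rewrite (_ : n.+1%:R + b + (1 - b) = n.+2%:R); last by rewrite -[n.+2%:R]natr1; ring.
rewrite gammaI_nat => h.
have -> : b + n.+2%:R = n.+1%:R + b + 1 by rewrite -[n.+2%:R]natr1; ring.
rewrite gammaI_rec //.
have gE : (n.+1%:R + b) * gammaI (n.+1%:R + b) = expR (b * ln (n.+1%:R + b)) * (expR ((1 - b) * ln (n.+1%:R + b)) * gammaI (n.+1%:R + b)).
  rewrite mulrA -expRD -mulrDl [b + _]addrC subrK mul1r lnK ?posrE //.
rewrite gE; apply: ler_pM => //; rewrite ?expR_ge0 //.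
by rewrite ler_expR ler_wpM2l // ler_ln ?posrE //; lra.
Qed.

Lemma gammaI_upper n b : 0 <= b <= 1 -> gammaI (b + n.+2%:R) <= (1 + n.+1%:R^-1) * (expR (b * ln n.+1%:R) * n.+1`!%:R).
Proof.
move=> b01; have /andP[b0 b1] := b01.
have n0 : 0 < n.+1%:R :> R by rewrite ltr0n.
have := gammaI_convex n0 b01; rewrite gammaI_nat => h.
have -> : b + n.+2%:R = n.+1%:R + b + 1 by rewrite -[n.+2%:R]natr1; ring.
rewrite gammaI_rec; last by lra.
have -> : (1 + n.+1%:R^-1) * (expR (b * ln n.+1%:R) * n.+1`!%:R) =
   (n.+1%:R + 1) * (expR (b * ln n.+1%:R) * n`!%:R).
  by rewrite factS natrM; field; rewrite addrC natr1 pnatr_eq0.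
have g0 : 0 <= gammaI (n.+1%:R + b).
  by apply: hasI_ge0 (hasI_gammaI _); lra.
by apply: ler_pM => //; lra.
Qed.

Lemma gammaI_prod n b : 0 < b -> gammaI (b + n%:R) = \prod_(0 <= k < n) (b + k%:R) * gammaI b.
Proof.
move=> b0; elim: n => [|n IH]; first by rewrite big_geq // addr0 mul1r.
rewrite big_nat_recr //= -natr1 addrA gammaI_rec; last by rewrite ltr_wpDr.
by rewrite IH; ring.
Qed.

Lemma gammaI_gt0 b : 0 < b <= 1 -> 0 < gammaI b.
Proof.
move=> /andP[b0 b1]; have b01 : 0 <= b <= 1 by lra.
have := gammaI_lower 0 b01; rewrite (gammaI_prod 2 b0) => h.
have : 0 < \prod_(0 <= k < 2) (b + k%:R) * gammaI b.
  by apply: lt_le_trans h; rewrite mulr_gt0 ?expR_gt0 // ltr0n.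
rewrite pmulr_rgt0 // prodr_gt0 // => k _; exact: ltr_wpDr.
Qed.

(** Bohr and Mollerup: the convexity bounds squeeze the ratio of Gamma(b + n +
2) and (n+1)^b (n+1)! between 1 and 1 + 1/(n+1), and this ratio is the product
of Gamma(b) with the Gauss approximation of 1/Gamma(b). *)
Lemma rGamma_gammaI b : 0 < b <= 1 -> rGamma (toC b) = toC (gammaI b)^-1.
Proof.
move=> b01; have g0 := gammaI_gt0 b01; have /andP[b0 b1] := b01.
have b01' : 0 <= b <= 1 by lra.
apply: (@lim_uniqC R (fun n => rGamma_n n.+1 (toC b))); first exact: rGamma_n_cvg.
apply/cvg_seqC => e e0; exists (Num.truncn ((e * gammaI b)^-1)) => n Nn.
set E := expR (b * ln n.+1%:R) * n.+1`!%:R.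
have E0 : 0 < E by rewrite mulr_gt0 ?expR_gt0 // ltr0n fact_gt0.
have -> : rGamma_n n.+1 (toC b) = toC (gammaI (b + n.+2%:R) / (E * gammaI b)).
  rewrite /rGamma_n -(rmorphN (@toC R)) rpow_toC gammaI_prod // mulNr expRN /E.
  have -> : \prod_(0 <= k < n.+2) (toC b + k%:R) = toC (\prod_(0 <= k < n.+2) (b + k%:R)).
    by rewrite (rmorph_prod (@toC R)); apply: eq_bigr => k _; rewrite (rmorphD (@toC R)) (rmorph_nat (@toC R)).
  rewrite -(rmorph_nat (@toC R) n.+1`!) -(fmorphV (@toC R)) -!(rmorphM (@toC R)); congr toC.
  have h2 : expR (b * ln n.+1%:R) != 0 :> R by rewrite gt_eqF // expR_gt0.
  have h3 : n.+1`!%:R != 0 :> R by rewrite pnatr_eq0 -lt0n fact_gt0.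
  have h1 : gammaI b != 0 by rewrite gt_eqF.
  move: h1 h2 h3; move: (gammaI b) (expR _) (n.+1`!%:R) (\prod_(_ <= _ < _) _) => A B D F h1 h2 h3.
  by field; rewrite h1 h2 h3.
rewrite -(rmorphB (@toC R)) nm_toC.
have := gammaI_upper n b01'; have := gammaI_lower n b01'; rewrite -/E => l u.
have -> : gammaI (b + n.+2%:R) / (E * gammaI b) - (gammaI b)^-1 = (gammaI (b + n.+2%:R) - E) / (E * gammaI b).
  by field; rewrite !gt_eqF.
have d0 : 0 < E * gammaI b by rewrite mulr_gt0.
rewrite ger0_norm; last by rewrite divr_ge0 ?subr_ge0 // ltW.
rewrite ltr_pdivrMr //; apply: le_lt_trans (_ : n.+1%:R^-1 * E < _).
  by move: u; rewrite mulrDl mul1r => u; move: (_^-1 * E) u => X; lra.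
have -> : e * (E * gammaI b) = (e * gammaI b) * E by ring.
rewrite ltr_pM2r //.
have eg : 0 < e * gammaI b by rewrite mulr_gt0.
rewrite -[ltRHS]invrK ltf_pV2 ?posrE ?invr_gt0 ?ltr0n //.
by apply: lt_le_trans (truncnS_gt _) _; rewrite ler_nat ltnS.
Qed.

Lemma rGamma1 : @rGamma R 1 = 1.
Proof.
by rewrite -(rmorph1 (@toC R)) rGamma_gammaI ?gammaI1 ?invr1 // lexx ltr01.
Qed.

(** From the exact relation between the Gauss products at s and s + 1. *)
Lemma rGamma_rec s : rGamma s = s * rGamma (s + 1).
Proof.
have e n : rGamma_n n.+1 s * (1 + (s + 1) * toC n.+1%:R^-1) = s * rGamma_n n.+1 (s + 1).
  rewrite /rGamma_n opprD rpowD /= -(rmorph1 (@toC R)) -rmorphN rpow_toC mulN1r expRN lnK ?posrE ?ltr0n // rmorph1.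
  have -> : \prod_(0 <= k < n.+2) (s + 1 + k%:R) = (\prod_(0 <= k < n.+1) (s + k.+1%:R)) * (s + n.+2%:R).
    rewrite big_nat_recr //=; congr (_ * _); last by ring.
    by apply: eq_bigr => k _; ring.
  rewrite big_nat_recl // addr0.
  have n0 : n.+1%:R != 0 :> C by rewrite pnatr_eq0.
  rewrite (fmorphV (@toC R)) (rmorph_nat (@toC R)) (_ : n.+2%:R = n.+1%:R + 1 :> C); last by rewrite natr1.
  have f0 : n.+1`!%:R != 0 :> C by rewrite -nm_gt0 nm_nat ltr0n fact_gt0.
  move: n0 f0; move: (n.+1%:R) (n.+1`!%:R) (rpow _ _) (\prod_(_ <= _ < _) _) => N F A B n0 f0.
  by field; rewrite n0 f0.
apply: (@lim_uniqC R (fun n => rGamma_n n.+1 s * (1 + (s + 1) * toC n.+1%:R^-1))).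
  rewrite -[X in _ --> X]mulr1; apply: seqcM; first exact: rGamma_n_cvg.
  rewrite -[X in _ --> X](addr0 (1 : C)); apply: seqcD; first exact: seqc_cst.
  rewrite -[X in _ --> X](mulr0 (s + 1)); apply: seqcM; first exact: seqc_cst.
  apply/cvg_seqC => e0 e00; exists (Num.truncn e0^-1) => n Nn.
  rewrite subr0 nm_toC ger0_norm ?invr_ge0 // -[ltRHS]invrK ltf_pV2 ?posrE ?invr_gt0 ?ltr0n //.
  by apply: lt_le_trans (truncnS_gt _) _; rewrite ler_nat ltnS.
under eq_fun do rewrite e.
by apply: seqcM; [exact: seqc_cst|exact: rGamma_n_cvg].
Qed.

End GammaFacts.

(** * The functional equation in the complex plane *)

Section FunctionalEquation.
Variable R : realType.
Local Notation C := (Cx R).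
Implicit Types (a b x y t : R) (s z : C).

(** Even and odd factors of a product of length 2m. *)
Lemma dup_prod s m : (\prod_(0 <= k < m) (s / 2 + k%:R)) * (\prod_(0 <= k < m) ((s + 1) / 2 + k%:R)) * 4 ^+ m =
  \prod_(0 <= k < m.*2) (s + k%:R).
Proof.
elim: m => [|m IH]; first by rewrite !big_geq // !mul1r expr0.
rewrite doubleS; do 4 rewrite [\prod_(0 <= k < _.+1) _]big_nat_recr //=; rewrite -IH exprS -[(m.*2).+1%:R]natr1 -[m.*2]mul2n natrM.
move: (\prod_(_ <= _ < _) _) (\prod_(_ <= _ < _) _) (4 ^+ m) => A B D.
by field.
Qed.

Lemma seq_ccont (f : C -> C) (u : nat -> C) (l : C) : ccont f l -> u n @[n --> \oo] --> l ->
  f (u n) @[n --> \oo] --> f l.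
Proof.
move=> cf /cvg_seqC Hu; apply/cvg_seqC => e e0.
have [d d0 H] := cf e e0; have [N HN] := Hu d d0.
by exists N => n /HN /H.
Qed.

(** ln((2n + 3)/(n + 1)), the logarithm of the ratio of the two Gauss indices
in the duplication formula. *)
Definition dup_ln (n : nat) : R := ln (n.+1.*2.+1)%:R - ln n.+1%:R.

Lemma dup_ln_cvg : (fun n => toC (dup_ln n)) n @[n --> \oo] --> (toC (ln 2) : C).
Proof.
apply/cvg_seqC => e e0; exists (Num.truncn (e^-1)) => n Nn.
have n0 : 0 < n.+1%:R :> R by rewrite ltr0n.
have i0 : 0 < n.+1%:R^-1 :> R by rewrite invr_gt0.
rewrite -(rmorphB (@toC R)) nm_toC.
have i1 : n.+1%:R^-1 < e.
  rewrite -[ltRHS]invrK ltf_pV2 ?posrE ?invr_gt0 ?ltr0n //.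
  by apply: lt_le_trans (truncnS_gt _) _; rewrite ler_nat ltnS.
have -> : dup_ln n - ln 2 = ln (1 + n.+1%:R^-1 / 2).
  rewrite /dup_ln; have -> : (n.+1.*2.+1)%:R = (n.+1%:R * 2) * (1 + n.+1%:R^-1 / 2) :> R.
    by rewrite -[(_.+1)%:R]natr1 -mul2n natrM; move: i0; move: (n.+1%:R : R) n0 => N N0 _; field; rewrite gt_eqF.
  have h : 0 < 1 + n.+1%:R^-1 / 2 :> R by move: (n.+1%:R^-1) i0 => i i0; lra.
  rewrite !lnM ?posrE ?mulr_gt0 //; first by ring.
have h : -1 < n.+1%:R^-1 / 2 :> R by move: (n.+1%:R^-1) i0 => i i0; lra.
rewrite ger0_norm.
  by apply: le_lt_trans (le_ln1Dx h) _; move: (n.+1%:R^-1) i0 i1 => i i0 i1; lra.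
by apply: ln_ge0; move: (n.+1%:R^-1) i0 => i i0; lra.
Qed.

(** Legendre's formula. The Gauss products at s/2, (s+1)/2 and at s, of twice
the length, have the same factors; the constants independent of s are
eliminated by comparing with s = 1. *)
Lemma duplication s : rGamma (s / 2) * rGamma ((s + 1) / 2) * cexp ((1 - s) * toC (ln 2)) = rGamma (toC 2^-1) * rGamma s.
Proof.
pose X z n : C := rGamma_n n.+1 (z / 2) * rGamma_n n.+1 ((z + 1) / 2).
pose Y z n : C := rGamma_n (n.+1.*2.+1) z.
have e n : X s n * Y 1 n * cexp ((1 - s) * toC (dup_ln n)) = X 1 n * Y s n.
  have PE z : \prod_(0 <= k < (n.+1.*2.+2)) (z + k%:R) = _ := esym (dup_prod z n.+2).
  rewrite /X /Y /rGamma_n !PE /rpow /dup_ln.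
  set l1 := ln n.+1%:R; set l2 := ln _.
  have F1 : n.+1`!%:R != 0 :> C by rewrite -nm_gt0 nm_nat ltr0n fact_gt0.
  have F2 : (n.+1.*2.+1)`!%:R != 0 :> C by rewrite -nm_gt0 nm_nat ltr0n fact_gt0.
  have cE (A : C) : cexp A * cexp (- A) = 1 by rewrite -cexpD subrr cexp0.
  set E1 := cexp (- (s / 2) * _); set E2 := cexp (- ((s + 1) / 2) * _).
  set E3 := cexp (- 1 * _); set E4 := cexp ((1 - s) * _).
  set E5 := cexp (- (1 / 2) * _); set E6 := cexp (- ((1 + 1) / 2) * _); set E7 := cexp (- s * _).
  have eE : E1 * E2 * E3 * E4 = E5 * E6 * E7.
    rewrite /E1 /E2 /E3 /E4 /E5 /E6 /E7 -!cexpD; congr cexp.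
    by rewrite (rmorphB (@toC R)); field.
  move: eE F1 F2.
  move: E1 E2 E3 E4 E5 E6 E7 (n.+1`!%:R) ((n.+1.*2.+1)`!%:R) (4 ^+ n.+2) => E1 E2 E3 E4 E5 E6 E7 f1 f2 A eE F1 F2.
  move: (\prod_(0 <= k < _) (s / 2 + _)) (\prod_(0 <= k < _) ((s + 1) / 2 + _)) => P1 P2.
  move: (\prod_(0 <= k < _) (1 / 2 + _)) (\prod_(0 <= k < _) ((1 + 1) / 2 + _)) => P3 P4.
  transitivity (P1 * P2 * P3 * P4 * A / (f1 ^+ 2 * f2) * (E1 * E2 * E3 * E4)); first by field; rewrite F1 F2.
  by rewrite eE; field; rewrite F1 F2.
have Xc z : X z n @[n --> \oo] --> (rGamma (z / 2) * rGamma ((z + 1) / 2) : C) by apply: seqcM; exact: rGamma_n_cvg.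
have Yc z : Y z n @[n --> \oo] --> (rGamma z : C).
  have /cvg_seqC H := @rGamma_n_cvg R z; apply/cvg_seqC => ep /H [N HN]; exists N => n Nn.
  by rewrite /Y; apply: HN; rewrite -addnn; lia.
have EC : (fun n => cexp ((1 - s) * toC (dup_ln n))) n @[n --> \oo] --> (cexp ((1 - s) * toC (ln 2)) : C).
  apply: (@seq_ccont (fun w => cexp ((1 - s) * w)) (fun n => toC (dup_ln n))); last exact: dup_ln_cvg.
  by apply: ccont_comp; [apply: ccontM; [exact: ccont_cst|exact: ccont_id]|exact: ent_cont (@ent_cexp R)].
have L : rGamma (s / 2) * rGamma ((s + 1) / 2) * rGamma 1 * cexp ((1 - s) * toC (ln 2)) = rGamma (1 / 2) * rGamma ((1 + 1) / 2) * rGamma s.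
  apply: (@lim_uniqC R (fun n => X s n * Y 1 n * cexp ((1 - s) * toC (dup_ln n)))).
    exact: (seqcM (seqcM (Xc s) (Yc 1)) EC).
  under eq_fun do rewrite e.
  exact: (seqcM (Xc 1) (Yc s)).
move: L; rewrite (_ : (1 + 1) / 2 = 1 :> C); last by field.
rewrite rGamma1 !mulr1 (_ : 1 / 2 = toC 2^-1) // div1r (fmorphV (@toC R)) (rmorph_nat (@toC R)) //.
Qed.

(** The Dirichlet series is eliminated between [fe_series] and [dirichlet]. *)
Lemma fe_real a : 1 < a < 2 ->
  HsR (1 - a) * gammaI (2 - a) = a * expR (- (a * ln (2 * pi))) * (gammaI (1 - a / 2) * gammaI (a / 2)) * HsR a.
Proof.
move=> a12; have /andP[a1 a2] := a12.
have [c [Hc ec]] := hasI_exp_rem a12.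
have A := fe_series a12 Hc.
have b0 : 0 < a - 1 by lra.
have B := dirichlet b0.
have ga : gammaI a = (a - 1) * gammaI (a - 1) by rewrite -(gammaI_rec b0) subrK.
have g0 : 0 < gammaI (a - 1) by apply: gammaI_gt0; lra.
have p0 : 0 < 2 * pi :> R by rewrite mulr_gt0 ?pi_gt0.
(* The ratio of corresponding terms of the two series. *)
set K := expR (- (a * ln (2 * pi))) * (gammaI (1 - a / 2) * gammaI (a / 2)) / ((a - 1) * gammaI (a - 1)).
have E : HsR (1 - a) * c = K * (HsR a * gammaI (a - 1)).
  have BK : K * series (fun m => expR (- ((a - 1 + 1) * ln m.+1%:R)) * gammaI (a - 1 + 1)) n @[n --> \oo] --> K * (HsR (1 + (a - 1)) * gammaI (a - 1)).
    by apply: cvgM; [exact: cvg_cst|exact: B].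
  move: BK; rewrite subrK addrC subrK => BK.
  apply: cvg_unique A _ => //.
  apply: cvg_trans BK; apply: near_eq_cvg; apply: nearW => n.
  rewrite /series /= mulr_sumr; apply: eq_bigr => k _.
  rewrite lnM ?posrE ?ltr0n // mulrDr opprD expRD /K ga.
  by field; rewrite gt_eqF //= gt_eqF.
rewrite -ec; transitivity (a * (a - 1) * (HsR (1 - a) * c)); first by ring.
rewrite E /K; field; rewrite (gt_eqF g0) /=; rewrite gt_eqF //.
Qed.

(** Both sides are entire and agree for real s in (1, 2). *)
Lemma fe_complex s :
  Hs (1 - s) * rGamma (1 - s / 2) * rGamma (s / 2) = s * cexp (- s * toC (ln (2 * pi))) * Hs s * rGamma (2 - s).
Proof.
apply/eqP; rewrite -subr_eq0; apply/eqP.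
have b1 : (1 : R) < (3 / 2 : R) < (2 : R) by apply/andP; split; lra.
pose f s : C := Hs (1 - s) * rGamma (1 - s / 2) * rGamma (s / 2) - s * cexp (- s * toC (ln (2 * pi))) * Hs s * rGamma (2 - s).
have aff (F : C -> C) (u v : C) (h : C -> C) : (forall z, h z = u * z + v) -> entire F -> entire (fun z => F (h z)).
  by move=> E eF; apply: ent_ext (ent_aff u v eF) => z; rewrite E.
apply: (@ent_identity R f 1 2 (3 / 2) b1) => [|x x12].
  apply: entB; apply: entM.
  - apply: entM; first by apply: (aff _ (-1) 1) (@ent_Hs R) => z; ring.
    by apply: (aff _ (- 2^-1) 1) (@ent_rGamma R) => z; ring.
  - by apply: (aff _ 2^-1 0) (@ent_rGamma R) => z; ring.
  - apply: entM; last exact: ent_Hs.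
    apply: entM; first exact: ent_id.
    by apply: (aff _ (- toC (ln (2 * pi))) 0) (@ent_cexp R) => z; ring.
  - by apply: (aff _ (-1) 2) (@ent_rGamma R) => z; ring.
have /andP[x1 x2] := x12; rewrite /f.
have two : 2 = toC 2 :> C by rewrite (rmorph_nat (@toC R)).
rewrite two -(rmorph1 (@toC R)) -(fmorphV (@toC R)) -(rmorphM (@toC R)) -(rmorphN (@toC R)) -!(rmorphB (@toC R)) -(rmorphM (@toC R)) cexp_toC.
rewrite -!(rmorphD (@toC R)) !Hs_toC; do 3 (rewrite rGamma_gammaI; last by lra).
rewrite -!(rmorphM (@toC R)) -(rmorphB (@toC R)).
have g1 : 0 < gammaI (1 - x / 2) by apply: gammaI_gt0; lra.
have g2 : 0 < gammaI (x / 2) by apply: gammaI_gt0; lra.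
have g3 : 0 < gammaI (2 - x) by apply: gammaI_gt0; lra.
rewrite -[RHS](rmorph0 (@toC R)); congr toC.
have := fe_real x12; rewrite mulNr.
move: g1 g2 g3; move: (gammaI (1 - x / 2)) (gammaI (x / 2)) (gammaI (2 - x)) (expR _) (HsR x) (HsR (1 - x)) => A B D E H1 H2 A0 B0 D0 h.
have -> : H2 * A^-1 * B^-1 - x * E * H1 * D^-1 = (H2 * D - x * E * (A * B) * H1) / (A * B * D).
  by field; rewrite !gt_eqF.
by rewrite h subrr mul0r.
Qed.

(** xi, with the pole of zeta absorbed in Hs and Gamma(s/2) as a reciprocal.
*)
Definition Xi s : C := 2^-1 * s * cexp (- (s / 2) * toC (ln pi)) * Hs s / rGamma (s / 2).

Lemma ReC_half s : ReC (s / 2) = ReC s / 2.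
Proof.
rewrite -[2 in LHS](rmorph_nat (@toC R)) -(fmorphV (@toC R)).
by rewrite !ReImE mulr0 subr0.
Qed.

Lemma rGamma_half_neq0 s : 0 < ReC s < 1 -> rGamma (s / 2) != 0.
Proof. by move=> h; apply: rGamma_neq0; rewrite ReC_half; lra. Qed.

Lemma Xi_sym s : 0 < ReC s < 1 -> Xi (1 - s) = Xi s.
Proof.
move=> s01.
have s1 : 0 < ReC (1 - s) < 1 by rewrite !ReImE; lra.
have g1 := rGamma_half_neq0 s01; have g2 := rGamma_half_neq0 s1.
have g3 : rGamma (1 - s / 2) != 0.
  apply: rGamma_neq0; rewrite ReCD ReCN ReC_half !ReImE; lra.
have F := fe_complex s.
have D := duplication (1 - s).
have Gr := rGamma_rec (1 - s); rewrite (_ : 1 - s + 1 = 2 - s) in Gr; last by ring.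
rewrite (_ : (1 - s + 1) / 2 = 1 - s / 2) in D; last by field.
rewrite (_ : 1 - (1 - s) = s) in D; last by ring.
rewrite Gr in D.
have gh0 : rGamma (toC 2^-1 : C) = cexp (- (1 / 2) * toC (ln pi)).
  rewrite rGamma_gammaI; last by lra.
  have -> : - (1 / 2) * toC (ln pi) = toC (- (2^-1 * ln pi)) :> C.
    rewrite (rmorphN (@toC R)) (rmorphM (@toC R)) (fmorphV (@toC R)) (rmorph_nat (@toC R)); ring.
  rewrite cexp_toC expRN; congr (toC _^-1).
  have gp : 0 < @gammaI R 2^-1 by apply: gammaI_gt0; lra.
  have p0 : 0 < pi :> R := pi_gt0 R.
  apply/eqP; rewrite -(@eqrXn2 _ 2) ?expR_ge0 ?(ltW gp) //; apply/eqP.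
  by rewrite gammaI_half -expRM_natl mulrA divff // mul1r lnK ?posrE.
rewrite gh0 in D.
rewrite /Xi.
have e2 : cexp (- ((1 - s) / 2) * toC (ln pi)) * (cexp (- s * toC (ln (2 * pi))) * cexp (s * toC (ln 2))) =
   cexp (- (s / 2) * toC (ln pi)) * cexp (- (1 / 2) * toC (ln pi)).
  have p0 : 0 < pi :> R := pi_gt0 R.
  rewrite -!cexpD; congr cexp; rewrite lnM ?posrE // (rmorphD (@toC R)). by field.
move: e2 D F g1 g2 g3.
have n1 := cexp_neq0 (s * toC (ln 2)).
move: n1.
move: (cexp (- ((1 - s) / 2) * _)) (cexp (- s * _)) (cexp (s * _)) (cexp (- (s / 2) * _)) (cexp (- (1 / 2) * _)) => c1 c2 c3 c4 c5.
move: (rGamma (2 - s)) (rGamma (1 - s / 2)) (rGamma (s / 2)) (rGamma ((1 - s) / 2)) (Hs s) (Hs (1 - s)) => A B D E H1 H2 n3 e2 eD eF D0 E0 B0.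
have key : (1 - s) * c1 * H2 * D = s * c4 * H1 * E.
  apply: (mulIf B0); apply: (mulIf n3).
  transitivity ((1 - s) * c1 * c3 * (H2 * B * D)); first by ring.
  rewrite eF; transitivity ((1 - s) * s * H1 * A * (c1 * (c2 * c3))); first by ring.
  rewrite e2; transitivity (s * H1 * c4 * (c5 * ((1 - s) * A))); first by ring.
  rewrite -eD; ring.
apply: (mulIf D0); apply: (mulIf E0).
transitivity (2^-1 * ((1 - s) * c1 * H2 * D)); first by field.
by rewrite key; field; exact: D0.
Qed.

End FunctionalEquation.

(** * xi and Theta in the critical strip *)

Section CompletedZeta.
Variable R : realType.
Local Notation C := (Cx R).
Implicit Types (x y t : R) (s z w : C) (f : C -> C).

(** The open critical strip: here all the factors of xi except Hs are regular
and do not vanish. *)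
Definition strip s := 0 < ReC s < 1.

Lemma strip_near s : strip s -> \forall w \near s, strip w.
Proof.
move=> /andP[s0 s1]; apply/nbhsC_P; exists (Num.min (ReC s) (1 - ReC s)).
  by rewrite lt_min s0 subr_gt0.
move=> w; rewrite lt_min => /andP[h1 h2]; have := Re_le_nm (w - s).
rewrite ReCD ReCN => h; rewrite /strip; move: (ler_norm (ReC w - ReC s)) (ler_norm (- (ReC w - ReC s))).
rewrite normrN; lra.
Qed.

Lemma strip_half s : strip s -> 0 < ReC (s / 2) <= 1.
Proof. by rewrite /strip ReC_half; lra. Qed.

Lemma strip_neq0 s : strip s -> s != 0.
Proof. by move=> /andP[h _]; exact: Re_neq0. Qed.

Lemma strip_neq1 s : strip s -> s - 1 != 0.
Proof.
move=> /andP[_ h]; rewrite -oppr_eq0 opprB; apply: Re_neq0; rewrite !ReImE; lra.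
Qed.

Lemma strip_1B s : strip s -> strip (1 - s).
Proof. by rewrite /strip !ReImE; lra. Qed.

Lemma strip_conj s : strip s -> strip s^*.
Proof. by rewrite /strip ReC_conj. Qed.

(** The digamma function. *)
Definition psi s : C := logderiv (@Gamma R) s.

Lemma cderiv_Gamma s : 0 < ReC s <= 1 -> cderiv (@Gamma R) s (psi s * Gamma s).
Proof.
have [p [H1 H2 H3 H4 H5]] := @logderiv_Gamma R.
by move=> h; rewrite /psi H3 //; exact: H1.
Qed.

Lemma Gamma_neq0 s : 0 < ReC s <= 1 -> Gamma s != 0.
Proof. by have [p [H1 H2 H3 H4 H5]] := @logderiv_Gamma R; exact: H2. Qed.

Lemma psi_cvg s : 0 < ReC s <= 1 -> - dign n.+1 s @[n --> \oo] --> (psi s : C).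
Proof.
have [p [H1 H2 H3 H4 H5]] := @logderiv_Gamma R.
by move=> h; rewrite /psi H3 //; exact: H5.
Qed.

Lemma psi_cont s : strip s -> ccont psi s.
Proof.
have [p [H1 H2 H3 H4 H5]] := @logderiv_Gamma R.
move=> h; apply: (@ccont_near R p); last by apply: H4; move: h; rewrite /strip; lra.
have := strip_near h; apply: filterS => w hw; rewrite /psi H3 //.
by move: hw; rewrite /strip; lra.
Qed.

Definition dHs : C -> C := projT1 (cid (ent_deriv (@ent_Hs R))).

Lemma ent_dHs : entire dHs.
Proof. by rewrite /dHs; case: cid => ? []. Qed.

Lemma cderiv_Hs s : cderiv (@Hs R) s (dHs s).
Proof. by rewrite /dHs; case: cid => ? []. Qed.

(** The factor of xi that does not vanish on the strip: xi = xi_fac Hs. *)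
Definition xi_fac s : C := 2^-1 * s * cexp (- (s / 2) * toC (ln pi)) * Gamma (s / 2).
(** The logarithmic derivative of [xi_fac]. *)
Definition xi_fac_dlog s : C := s^-1 - 2^-1 * toC (ln pi) + 2^-1 * psi (s / 2).
(** (xi + xi') / xi_fac. *)
Definition xi_den s : C := (1 + xi_fac_dlog s) * Hs s + dHs s.

Lemma XiE s : strip s -> Xi s = xi_fac s * Hs s.
Proof.
by move=> h; rewrite /Xi /xi_fac Gamma_eq; [rewrite mulrAC|exact: rGamma_half_neq0].
Qed.

Lemma xi_fac_neq0 s : strip s -> xi_fac s != 0.
Proof.
move=> h; apply: mulf_neq0; last by apply: Gamma_neq0; exact: strip_half.
apply: mulf_neq0; last exact: cexp_neq0.
by apply: mulf_neq0; [rewrite invr_eq0 pnatr_eq0|exact: strip_neq0].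
Qed.

Lemma cderiv_xi_fac s : strip s -> cderiv xi_fac s (xi_fac s * xi_fac_dlog s).
Proof.
move=> h.
have D1 := cderivZ (2^-1) (cderiv_id s).
have D2 := @cderiv_cexp_aff R (- (2^-1 * toC (ln pi))) 0 s.
have D3 : cderiv (fun w => Gamma (2^-1 * w + 0)) s (2^-1 * (psi (2^-1 * s + 0) * Gamma (2^-1 * s + 0))).
  by apply: cderiv_aff; apply: cderiv_Gamma; rewrite addr0 mulrC; exact: strip_half.
apply: (cderiv_ext (f := fun w => 2^-1 * w * cexp (- (2^-1 * toC (ln pi)) * w + 0) * Gamma (2^-1 * w + 0))).
  by move=> w; rewrite /xi_fac !addr0 [2^-1 * w as X in Gamma X]mulrC; congr (_ * cexp _ * _); ring.
apply: cderiv_eq (cderivM (cderivM D1 D2) D3) _.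
rewrite /xi_fac /xi_fac_dlog !addr0.
have -> : - (2^-1 * toC (ln pi)) * s = - (s / 2) * toC (ln pi) by ring.
have -> : 2^-1 * s = s / 2 by rewrite mulrC.
by field; exact: strip_neq0.
Qed.

Lemma xi_fac_dlog_cont s : strip s -> ccont xi_fac_dlog s.
Proof.
move=> h; apply: ccontD.
  apply: ccontB; last exact: ccont_cst.
  by apply: ccontV; [exact: strip_neq0|exact: ccont_id].
apply: ccontM; first exact: ccont_cst.
apply: (@ccont_comp R (fun w => w / 2)).
  by apply: ccontM; [exact: ccont_id|exact: ccont_cst].
by apply: psi_cont; move: h; rewrite /strip ReC_half; lra.
Qed.

Lemma xi_den_cont s : strip s -> ccont xi_den s.
Proof.
move=> h; apply: ccontD; last exact: ent_cont ent_dHs.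
apply: ccontM; last exact: ent_cont (@ent_Hs R).
by apply: ccontD; [exact: ccont_cst|exact: xi_fac_dlog_cont].
Qed.

Lemma cderiv_xi_facHs s : strip s -> cderiv (fun w => xi_fac w * Hs w) s (xi_fac s * (xi_fac_dlog s * Hs s + dHs s)).
Proof.
move=> h; apply: cderiv_eq (cderivM (cderiv_xi_fac h) (cderiv_Hs s)) _; ring.
Qed.

(** On the strip the defining expression is continuous, so removing
singularities does nothing. *)
Lemma xiE s : strip s -> xi s = xi_fac s * Hs s.
Proof.
move=> h; rewrite /xi; apply: lim_punctC => e e0.
have [d1 d10 H1] := cderiv_cont (cderiv_xi_facHs h) e0.
have /nbhsC_P[d2 d20 H2] := strip_near h.
exists (Num.min d1 d2); first by rewrite lt_min d10.
move=> w _; rewrite lt_min => /andP[w1 w2].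
have sw := H2 w w2.
have -> : 2^-1 * w * (w - 1) * rpow pi (- (w / 2)) * Gamma (w / 2) * zeta w = xi_fac w * Hs w.
  rewrite /xi_fac zetaE /rpow; move: (strip_neq1 sw) (Gamma _) (cexp _) (Hs w) => w1' A B D.
  by field; exact: w1'.
exact: H1.
Qed.

Lemma cderiv_xi s : strip s -> cderiv (@xi R) s (xi_fac s * (xi_fac_dlog s * Hs s + dHs s)).
Proof.
move=> h; apply: cderiv_near (cderiv_xi_facHs h).
by have := strip_near h; apply: filterS => w hw; rewrite xiE.
Qed.

Lemma xi_sym s : strip s -> xi (1 - s) = xi s.
Proof.
by move=> h; rewrite !xiE ?strip_1B // -!XiE ?strip_1B // Xi_sym.
Qed.

Lemma xi_conj s : strip s -> xi s^* = (xi s)^*.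
Proof.
move=> h; rewrite !xiE ?strip_conj // -!XiE ?strip_conj // /Xi.
have two : (2 : C)^* = 2 by rewrite rmorph_nat.
rewrite !rmorphM /= !fmorphV /= -rGamma_conj -cexp_conj !rmorphM /= !rmorphN !rmorphM /= !fmorphV /= two.
by rewrite conj_toC -Hs_conj.
Qed.

Lemma cderiv_conj f s d : cderiv f s d -> cderiv (fun w => (f w^*)^*) s^* d^*.
Proof.
move=> [phi [c1 c2 /nbhsC_P[r r0 H]]]; exists (fun w => (phi w^*)^*); split.
- move=> e /c1 [d0 d00 Hd]; exists d0 => // w hw.
  rewrite conjCK -rmorphB nm_conj; apply: Hd.
  by rewrite -nm_conj rmorphB /= conjCK.
- by rewrite conjCK c2.
- apply/nbhsC_P; exists r => // w hw; rewrite conjCK -rmorphB.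
  have h : nm (w^* - s) < r by rewrite -nm_conj rmorphB /= conjCK.
  by rewrite (H _ h) rmorphM rmorphB /= conjCK.
Qed.

Definition dxi s : C := xi_fac s * (xi_fac_dlog s * Hs s + dHs s).

Lemma dxi_derive s : strip s -> derive1 (@xi R) s = dxi s.
Proof. by move=> h; exact: cderiv_derive1 (cderiv_xi h). Qed.

(** Differentiate xi(1 - s) = xi(s). *)
Lemma dxi_sym s : strip s -> dxi (1 - s) = - dxi s.
Proof.
move=> h; have D := cderiv_xi (strip_1B h).
have D2 : cderiv (fun w => xi (-1 * w + 1)) s (-1 * dxi (1 - s)).
  by apply: cderiv_aff; rewrite mulN1r addrC.
have D3 : cderiv (@xi R) s (-1 * dxi (1 - s)).
  apply: cderiv_near D2; have := strip_near h; apply: filterS => w hw.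
  by rewrite mulN1r addrC xi_sym.
have e : dxi s = -1 * dxi (1 - s) := cderiv_uniq (cderiv_xi h) D3.
by rewrite e mulN1r opprK.
Qed.

Lemma dxi_conj s : strip s -> dxi s^* = (dxi s)^*.
Proof.
move=> h; have D := cderiv_conj (cderiv_xi h).
apply: (@cderiv_uniq R (@xi R) s^*); first exact: cderiv_xi (strip_conj h).
apply: cderiv_near D; have := strip_near (strip_conj h); apply: filterS => w hw.
by rewrite xi_conj // conjCK.
Qed.

Lemma halfC : 2^-1 = toC 2^-1 :> C.
Proof. by rewrite (fmorphV (@toC R)) (rmorph_nat (@toC R)). Qed.

(** The substitution z -> s that sends the real axis to the critical line. *)
Definition crit_arg z : C := 2^-1 - 'i * z.

(** The functional equation and the reflection s -> conj s turn the numerator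
of Theta into xi(s) - xi'(s). *)
Lemma Theta_strip z : strip (crit_arg z) -> xi_den (crit_arg z) != 0 ->
  1 + Theta z = 2 * Hs (crit_arg z) / xi_den (crit_arg z).
Proof.
set s := crit_arg z => h D0.
have e1 : (Efun z^*)^* = xi s - dxi s.
  have sc : strip (2^-1 - 'i * z^*).
    by move: h; rewrite /s /crit_arg /strip halfC !ReImE ReC_conj ImC_conj; lra.
  have ec : (2^-1 - 'i * z^*)^* = 1 - s.
    rewrite rmorphB rmorphM /= conjCi conjCK fmorphV rmorph_nat /s /crit_arg.
    by field.
  have a1 : (xi (2^-1 - 'i * z^*))^* = xi s by rewrite -(xi_conj sc) ec (xi_sym h).
  have a2 : (dxi (2^-1 - 'i * z^*))^* = - dxi s by rewrite -(dxi_conj sc) ec (dxi_sym h).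
  by rewrite /Efun (dxi_derive sc) rmorphD /= a1 a2.
have e2 : Efun z = xi_fac s * xi_den s.
  rewrite /Efun -/(crit_arg z) -/s (xiE h) (dxi_derive h) /dxi /xi_den; ring.
have p0 := xi_fac_neq0 h.
rewrite /Theta e1 e2 (xiE h) /dxi.
have -> : xi_fac s * Hs s - xi_fac s * (xi_fac_dlog s * Hs s + dHs s) = xi_fac s * (2 * Hs s - xi_den s) by rewrite /xi_den; ring.
by field; rewrite D0 p0.
Qed.

(** Z = 2 xi / (s (s - 1)). *)
Lemma logderiv_Z s : strip s -> Hs s != 0 ->
  logderiv (@Zcompleted R) s = xi_fac_dlog s + dHs s / Hs s - s^-1 - (s - 1)^-1.
Proof.
move=> h H0; have s0 := strip_neq0 h; have s1 := strip_neq1 h; have p0 := xi_fac_neq0 h.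
have D1 := cderivV s0 (cderiv_id s).
have D2 : cderiv (fun w => (w - 1)^-1) s (- (1 + 0) / (s - 1) ^+ 2).
  by apply: (@cderivV R (fun w => w - 1)); [exact: s1|exact: cderivD (cderiv_id s) (cderiv_cst (- 1) s)].
have D := cderivZ 2 (cderivM (cderivM D1 D2) (cderiv_xi_facHs h)).
have E w : strip w -> 2 * (w^-1 * (w - 1)^-1 * (xi_fac w * Hs w)) = Zcompleted w.
  move=> hw; rewrite /xi_fac /Zcompleted zetaE /rpow.
  move: (strip_neq0 hw) (strip_neq1 hw) (Gamma _) (cexp _) (Hs w) => w0 w1 A B F.
  by field; rewrite w0 w1.
have DZ : cderiv (@Zcompleted R) s _ := cderiv_near
  (@filterS _ (nbhs s) _ _ _ E (strip_near h)) D.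
have {}DZ := DZ (nbhs_filter s).
rewrite /logderiv (cderiv_derive1 DZ) -(E s h).
by field; rewrite p0 H0 s0 s1.
Qed.

(** (1 + Theta) xi'/xi = 2 - (1 + Theta): the unbounded logarithmic derivative
disappears from the product. *)
Lemma Theta_logderiv z : strip (crit_arg z) -> Hs (crit_arg z) != 0 -> xi_den (crit_arg z) != 0 ->
  (1 + Theta z) * logderiv (@Zcompleted R) (crit_arg z) =
  2 - (1 + Theta z) * (1 + (crit_arg z)^-1 + (crit_arg z - 1)^-1).
Proof.
move=> h H0 D0; rewrite (logderiv_Z h H0) (Theta_strip h D0).
have s0 := strip_neq0 h; have s1 := strip_neq1 h.
move: D0; rewrite /xi_den; move: (xi_fac_dlog _) (dHs _) (Hs _) H0 => A d H H0 D0.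
by field; rewrite s0 s1 H0 D0.
Qed.

End CompletedZeta.

(** * The values of 1 + Theta on the real line *)

Section ThetaLimit.
Variable R : realType.
Local Notation C := (Cx R).
Implicit Types (x y t : R) (s z w : C) (f : C -> C).

Lemma Re_crit_arg z : ReC (crit_arg z) = 2^-1 + ImC z.
Proof. by rewrite /crit_arg halfC !ReImE; ring. Qed.

Lemma strip_crit_arg z : `|ImC z| < 2^-1 -> strip (crit_arg z).
Proof. by rewrite /strip Re_crit_arg ltr_norml; lra. Qed.

Lemma strip_crit_arg_real x : strip (crit_arg (toC x)).
Proof. by apply: strip_crit_arg; rewrite Im_toC normr0; lra. Qed.

Lemma crit_arg_cont z : ccont (@crit_arg R) z.
Proof.
apply: ccontB; first exact: ccont_cst.
by apply: ccontM; [exact: ccont_cst|exact: ccont_id].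
Qed.

Lemma crit_arg_diff z w : crit_arg z - crit_arg w = - 'i * (z - w).
Proof. by rewrite /crit_arg; ring. Qed.

Lemma cderiv_pow c n z : cderiv (fun w => (w - c) ^+ n.+1) z (n.+1%:R * (z - c) ^+ n).
Proof.
elim: n => [|n IH].
  apply: (cderiv_ext (f := fun w => w - c)) => [w|]; first by rewrite expr1.
  by apply: cderiv_eq (cderivD (cderiv_id z) (cderiv_cst (- c) z)) _; rewrite addr0 expr0 mulr1.
have D := cderivM (cderivD (cderiv_id z) (cderiv_cst (- c) z)) IH.
apply: (cderiv_ext (f := fun w => (w - c) * (w - c) ^+ n.+1)) => [w|]; first by rewrite -exprS.
by apply: cderiv_eq D _; rewrite addr0 mul1r -[n.+2%:R]natr1 exprS; ring.
Qed.

Lemma crit_arg_conj x : (crit_arg (toC x))^* = 1 - crit_arg (toC x).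
Proof. by rewrite /crit_arg rmorphB rmorphM /= conjCi conj_toC fmorphV rmorph_nat; field. Qed.

(** On the critical line conj s = 1 - s. *)
Lemma xi_real x : ImC (xi_fac (crit_arg (toC x)) * Hs (crit_arg (toC x))) = 0.
Proof.
set s := crit_arg _; have h : strip s := strip_crit_arg_real x.
have := xi_conj h; rewrite crit_arg_conj xi_sym // xiE // => /(congr1 (@ImC R)).
by rewrite ImC_conj; lra.
Qed.

Lemma dxi_imag x : ReC (dxi (crit_arg (toC x))) = 0.
Proof.
set s := crit_arg _; have h : strip s := strip_crit_arg_real x.
have := dxi_conj h; rewrite crit_arg_conj dxi_sym // => /(congr1 (@ReC R)).
by rewrite ReC_conj ReCN; lra.
Qed.

(** xi is real and xi' is imaginary on the critical line, so |xi + xi'| >=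
|xi|. *)
Lemma xi_den_ge x : nm (Hs (crit_arg (toC x))) <= nm (xi_den (crit_arg (toC x))).
Proof.
set s := crit_arg _; have h : strip s := strip_crit_arg_real x.
have p0 : 0 < nm (xi_fac s) by rewrite nm_gt0 xi_fac_neq0.
rewrite -(ler_pM2l p0) -!nmM.
have -> : xi_fac s * xi_den s = xi_fac s * Hs s + dxi s by rewrite /xi_den /dxi; ring.
have := dxi_imag x; have := xi_real x; rewrite -/s => i0 r0.
apply: le_trans (_ : `|ReC (xi_fac s * Hs s + dxi s)| <= _); last exact: Re_le_nm.
rewrite ReCD r0 addr0; apply: le_trans (nm_le _) _.
by rewrite i0 normr0 addr0.
Qed.

Lemma near_crit_arg (P : C -> Prop) z : (\forall s \near crit_arg z, P s) -> \forall w \near z, P (crit_arg w).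
Proof. by have /ccontP H := @crit_arg_cont z; move=> h; exact: (H P h). Qed.

Lemma near_ccont f z (e : R) : ccont f z -> 0 < e -> \forall w \near z, nm (f w - f z) < e.
Proof. by move=> cf e0; apply/nbhsC_P; have [d d0 H] := cf e e0; exists d. Qed.

Lemma nearI (z : C) (P Q : C -> Prop) : (\forall w \near z, P w) -> (\forall w \near z, Q w) ->
  \forall w \near z, P w /\ Q w.
Proof. exact: filterI. Qed.

(** The limit W of 1 + Theta at a real point. Write Hs = (s - s0)^m h with
h(s0) != 0. If m = 0 the quotient 2 Hs / xi_den is continuous. If m >= 1 the
denominator is (s - s0)^(m-1) (m h + O(s - s0)), so the limit is 0. Near the
point, but off it, no denominator vanishes: the value of the meromorphic
functions is given there by the formulas. *)
Lemma Theta_lim x : exists W : C, nm W <= 2 /\ forall e : R, 0 < e ->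
  exists2 d : R, 0 < d & forall w, w != toC x -> nm (w - toC x) < d ->
    [/\ Hs (crit_arg w) != 0, xi_den (crit_arg w) != 0 & nm (1 + Theta w - W) < e].
Proof.
set s0 := crit_arg (toC x); have h0 : strip s0 := strip_crit_arg_real x.
have HsN : exists s, Hs s != 0 :> C by exists 1; rewrite Hs1 oner_neq0.
have [m [h [eh hs0 Hf]]] := ent_order s0 (@ent_Hs R) HsN.
have NS := near_crit_arg (strip_near h0).
case: m Hf => [|k] Hf.
  have H0 : Hs s0 != 0 by rewrite Hf expr0 mul1r.
  have D0 : xi_den s0 != 0.
    by rewrite -nm_gt0; apply: lt_le_trans (xi_den_ge x); rewrite nm_gt0.
  exists (2 * Hs s0 / xi_den s0); split.
    rewrite !nmM nmV nm_nat ler_pdivrMr ?nm_gt0 // ler_pM2l //; exact: xi_den_ge.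
  move=> e e0.
  have cR : ccont (fun s => 2 * Hs s / xi_den s) s0.
    apply: ccontM; first by apply: ccontM; [exact: ccont_cst|exact: ent_cont (@ent_Hs R)].
    by apply: ccontV; [exact: D0|exact: xi_den_cont].
  have N1 := near_crit_arg (cont_neq0 (@ent_cont R _ s0 (@ent_Hs R)) H0).
  have N2 := near_crit_arg (cont_neq0 (xi_den_cont h0) D0).
  have N3 := near_crit_arg (near_ccont cR e0).
  have F := nearI NS (nearI N1 (nearI N2 N3)).
  have [d d0 Hd] := (nbhsC_P (toC x) _).1 F.
  exists d => [|w _ /Hd [w0 [w1 [w2 w3]]]]; first exact: d0.
  by split; [exact: w1|exact: w2|rewrite (Theta_strip w0 w2)].
have [dh [edh Hdh]] := ent_deriv eh.
have dHE s : dHs s = k.+1%:R * (s - s0) ^+ k * h s + (s - s0) ^+ k.+1 * dh s.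
  have D := cderivM (cderiv_pow s0 k s) (Hdh s).
  have D2 : cderiv (@Hs R) s _ := cderiv_ext (fun w => esym (Hf w)) D.
  exact: cderiv_uniq (cderiv_Hs s) D2.
(* xi_den divided by (s - s0)^k. *)
pose D1 s : C := (s - s0) * ((1 + xi_fac_dlog s) * h s + dh s) + k.+1%:R * h s.
have DE s : xi_den s = (s - s0) ^+ k * D1 s.
  by rewrite /xi_den dHE Hf /D1 exprS; ring.
have ch : ccont h s0 := @ent_cont R h s0 eh.
have cs : ccont (fun s => s - s0) s0 by apply: ccontB; [exact: ccont_id|exact: ccont_cst].
have cD1 : ccont D1 s0.
  apply: ccontD; last by apply: ccontM; [exact: ccont_cst|exact: ch].
  apply: ccontM; first exact: cs.
  apply: ccontD; last exact: ent_cont edh.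
  by apply: ccontM; [apply: ccontD; [exact: ccont_cst|exact: xi_fac_dlog_cont]|exact: ch].
have D10 : D1 s0 != 0.
  by rewrite /D1 subrr mul0r add0r mulf_neq0 // pnatr_eq0.
have cR : ccont (fun s => 2 * (s - s0) * h s / D1 s) s0.
  apply: ccontM; last by apply: ccontV; [exact: D10|exact: cD1].
  by apply: ccontM; [apply: ccontM; [exact: ccont_cst|exact: cs]|exact: ch].
exists 0; split; first by rewrite nm0.
move=> e e0.
have N1 := near_crit_arg (cont_neq0 ch hs0).
have N2 := near_crit_arg (cont_neq0 cD1 D10).
have N3 := near_crit_arg (near_ccont cR e0).
have F := nearI NS (nearI N1 (nearI N2 N3)).
  have [d d0 Hd] := (nbhsC_P (toC x) _).1 F.
exists d => [|w wx /Hd [w0 [w1 [w2 w3]]]]; first exact: d0.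
have ds : crit_arg w - s0 != 0.
  by rewrite crit_arg_diff mulf_neq0 ?subr_eq0 // oppr_eq0 neq0Ci.
have H0 : Hs (crit_arg w) != 0 by rewrite Hf mulf_neq0 // expf_neq0.
have D0 : xi_den (crit_arg w) != 0 by rewrite DE mulf_neq0 // expf_neq0.
split; [exact: H0|exact: D0|].
rewrite (Theta_strip w0 D0) subr0.
move: w3; rewrite subrr mulr0 !mul0r subr0.
congr (nm _ < _); rewrite DE Hf exprS.
have dk : (crit_arg w - s0) ^+ k != 0 by rewrite expf_neq0.
by move: dk w2; move: (_ ^+ k) (D1 _) => A B A0 B0; field; rewrite A0 B0.
Qed.

Definition opTheta x : C := projT1 (cid (Theta_lim x)).

Lemma opTheta_le x : nm (opTheta x) <= 2.
Proof. by rewrite /opTheta; case: cid => ? []. Qed.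

Lemma opTheta_lim x (e : R) : 0 < e ->
  exists2 d : R, 0 < d & forall w, w != toC x -> nm (w - toC x) < d ->
    [/\ Hs (crit_arg w) != 0, xi_den (crit_arg w) != 0 & nm (1 + Theta w - opTheta x) < e].
Proof. by rewrite /opTheta; case: cid => W [W2 H] e0; exact: H. Qed.

(** Punctured limits that exist at every point vary continuously. *)
Lemma opTheta_cont x (e : R) : 0 < e -> exists2 d : R, 0 < d & forall y, `|y - x| < d -> nm (opTheta y - opTheta x) <= e.
Proof.
move=> e0; have e2 : 0 < e / 2 by lra.
have [d d0 Hd] := opTheta_lim x e2; exists d => // y yx.
have [->|nyx] := eqVneq y x; first by rewrite subrr nm0 ltW.
have [d' d'0 Hd'] := opTheta_lim y e2.
(* The point y + r is close to y, still close to x, and different from both.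
*)
pose r := Num.min (d' / 2) (Num.min ((d - `|y - x|) / 2) (`|y - x| / 2)).
have yx0 : 0 < `|y - x| by rewrite normr_gt0 subr_eq0.
have r0 : 0 < r by rewrite /r !lt_min; apply/and3P; split; lra.
have r1 : r <= d' / 2 by rewrite /r ge_min lexx.
have r2 : r <= (d - `|y - x|) / 2 by rewrite /r !ge_min lexx orbT.
have r3 : r <= `|y - x| / 2 by rewrite /r !ge_min lexx !orbT.
pose w : C := toC (y + r).
have wy : nm (w - toC y) = r by rewrite /w -(rmorphB (@toC R)) nm_toC addrC addKr gtr0_norm.
have wxn : nm (w - toC x) = `|y - x + r|.
  by rewrite /w -(rmorphB (@toC R)) nm_toC; congr `|_|; ring.
have wx : nm (w - toC x) < d.
  rewrite wxn; apply: le_lt_trans (ler_normD _ _) _; rewrite (gtr0_norm r0); lra.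
have ny : w != toC y by rewrite -subr_eq0 -nm_gt0 wy.
have nx : w != toC x.
  rewrite -subr_eq0 -nm_gt0 wxn; have := lerB_normD (y - x) r; rewrite (gtr0_norm r0); lra.
have [_ _ A] := Hd w nx wx.
have [|_ _ B] := Hd' w ny; first by rewrite wy; lra.
have -> : opTheta y - opTheta x = (1 + Theta w - opTheta x) - (1 + Theta w - opTheta y) by ring.
by apply: le_trans (nmB _ _) _; lra.
Qed.

End ThetaLimit.

(** * The Lerch kernel *)

Section LerchKernel.
Variable R : realType.
Local Notation C := (Cx R).
Implicit Types (x y t q : R) (s z w : C) (f : C -> C).

(** (e^z - 1)/z. *)
Lemma E1_ex : exists E : C -> C, entire E /\ forall z, cexp z - 1 = z * E z.
Proof.
have e0 : cexp (0 : C) - 1 = 0 by rewrite cexp0 subrr.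
have [E [eE HE _]] := @ent_div R (fun z => cexp z - 1) 0 (entB (@ent_cexp R) (ent_cst 1)) e0.
by exists E; split=> [|z]; [exact: eE|rewrite HE subr0].
Qed.

Definition E1 : C -> C := projT1 (cid E1_ex).
Lemma ent_E1 : entire E1.
Proof. by rewrite /E1; case: cid => ? []. Qed.
Lemma E1E z : cexp z - 1 = z * E1 z.
Proof. by rewrite /E1; case: cid => ? []. Qed.

(** (e^(izc) - 1)/(iz), extended to z = 0 through the entire function (e^z -
1)/z. *)
Definition e1 c z : C := toC c * E1 ('i * z * toC c).

Lemma e1E c z : z != 0 -> (cexp ('i * z * toC c) - 1) / ('i * z) = e1 c z.
Proof.
move=> z0; rewrite E1E /e1; move: (E1 _) => A.
by field; rewrite z0 neq0Ci.
Qed.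

Lemma e1_0 z : e1 0 z = 0.
Proof. by rewrite /e1 (rmorph0 (@toC R)) mul0r. Qed.

Lemma e1_ccont c z : ccont (e1 c) z.
Proof.
apply: ccontM; first exact: ccont_cst.
apply: (@ccont_comp R (fun w => 'i * w * toC c)); last exact: ent_cont ent_E1.
apply: ccontM; last exact: ccont_cst.
by apply: ccontM; [exact: ccont_cst|exact: ccont_id].
Qed.

(** (1 + x^2)^(-3/8). *)
Definition decay x : R := expR (- (3 / 8 * ln (1 + x ^+ 2))).

Lemma decay_gt0 x : 0 < decay x. Proof. exact: expR_gt0. Qed.

Lemma one_sqr x : 1 <= 1 + x ^+ 2. Proof. by have := sqr_ge0 x; lra. Qed.

(** The exponent -3/8 lies above -1/2, so every decay of order 1/|x| is good
enough. *)
Lemma decay_ge x y : 0 < y -> 1 + x ^+ 2 <= y ^+ 2 -> y^-1 <= decay x.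
Proof.
move=> y0 xy; have o := one_sqr x.
have l0 : 0 <= ln (1 + x ^+ 2) := ln_ge0 o.
have h : ln (1 + x ^+ 2) <= 2 * ln y.
  have -> : 2 * ln y = ln (y ^+ 2) by rewrite lnXn // mulr_natl.
  by rewrite ler_ln ?posrE ?exprn_gt0 //; lra.
have -> : y^-1 = expR (- ln y) by rewrite expRN lnK.
by rewrite ler_expR; lra.
Qed.

(** For |x| <= 1 by compactness, for |x| >= 1 because the numerator has
modulus at most 2. *)
Lemma e1_bound (T : R) : 0 <= T -> exists2 B, 0 <= B & forall c x, `|c| <= T -> nm (e1 c (toC x)) <= B * decay x.
Proof.
move=> T0; have [M M0 HM] := ent_bound ent_E1 T.
exists (2 * T * M + 4) => [|c x cT]; first by rewrite addr_ge0 // !mulr_ge0 // ltW.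
have d0 := decay_gt0 x; have TM : 0 <= T * M by rewrite mulr_ge0 // ltW.
have [x1|x1] := lerP `|x| 1.
  have h : nm ('i * toC x * toC c) <= T.
    by rewrite !nmM nmi !nm_toC mul1r; have := ler_pM (normr_ge0 x) (normr_ge0 c) x1 cT; rewrite mul1r.
  have e : nm (e1 c (toC x)) <= T * M.
    by rewrite /e1 nmM nm_toC; apply: ler_pM => //; [exact: nm_ge0|exact: HM].
  have dh : 2^-1 <= decay x.
    apply: decay_ge => //; have : x ^+ 2 <= 1 by move: x1; rewrite ler_norml => /andP[? ?]; nra.
    by move=> h2; apply: le_trans (_ : 2 <= _); [lra|rewrite expr2; lra].
  apply: le_trans e _; have := ler_wpM2l TM dh.
  rewrite -[2 * T * M]mulrA.
  by move: d0 TM; move: (decay x) (T * M) => d K d0 K0 h2; nra.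
have x0 : 0 < `|x| by lra.
have xn0 : toC x != 0 by rewrite -nm_gt0 nm_toC.
rewrite -e1E // nmM nmV nmM nmi mul1r nm_toC.
have n2 : nm (cexp ('i * toC x * toC c) - 1) <= 2.
  apply: le_trans (nmB _ _) _; rewrite nm_cexp nm1.
  have -> : ReC ('i * toC x * toC c) = 0 by rewrite !ReImE; ring.
  by rewrite expR0; lra.
have dd : (2 * `|x|)^-1 <= decay x.
  apply: decay_ge; first by rewrite mulr_gt0.
  have hx2 : 1 <= `|x| ^+ 2 by rewrite exprn_ege1 // ltW.
  rewrite -(real_normK (num_real x)) exprMn; move: (`|x| ^+ 2) hx2 => X hX.
  by rewrite expr2; lra.
apply: le_trans (_ : 4 * decay x <= _); last by rewrite ler_wpM2r ?(ltW d0) //; lra.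
apply: le_trans (_ : 2 / `|x| <= _); first by rewrite ler_wpM2r // invr_ge0 ltW.
apply: le_trans (_ : 4 * (2 * `|x|)^-1 <= _); last by rewrite ler_wpM2l.
by rewrite invfM; move: (`|x|^-1) => v; lra.
Qed.

Lemma root4_le_id (r : R) : 1 <= r -> root4 r <= r.
Proof.
move=> r1; have := root4K (le_trans ler01 r1); have := root4_ge1 r1.
by move: (root4 r) => u u1 <-; rewrite -{1}[u]expr1 ler_weXn2l.
Qed.

Lemma inv_le_tau (n : nat) : n.+1%:R^-1 <= tau R n.
Proof.
rewrite /tau lef_pV2 ?posrE ?ltr0n //; last by apply: lt_le_trans (root4_ge1 _) => //; rewrite ler1n.
by apply: root4_le_id; rewrite ler1n.
Qed.

Definition an (n : nat) : C := n%:R + 4^-1.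
Definition bn (n : nat) z : C := n%:R + (4^-1 + 'i * z / 2).

Lemma fourC : 4^-1 = toC 4^-1 :> C.
Proof. by rewrite (fmorphV (@toC R)) (rmorph_nat (@toC R)). Qed.

Lemma Re_bn n z : ReC (bn n z) = n%:R + 4^-1 - ImC z / 2.
Proof. by rewrite /bn fourC halfC !ReImE; field. Qed.

Lemma Im_bn n z : ImC (bn n z) = ReC z / 2.
Proof. by rewrite /bn fourC halfC !ReImE; field. Qed.

Lemma an_ge n : n.+1%:R / 4 <= nm (an n).
Proof.
have -> : an n = toC (n%:R + 4^-1) by rewrite /an fourC (rmorphD (@toC R)) (rmorph_nat (@toC R)).
have n0 : 0 <= n%:R :> R by [].
rewrite nm_toC ger0_norm; last by lra.
by rewrite -[n.+1%:R]natr1; move: n%:R n0 => u u0; lra.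
Qed.

Lemma an_inv n : nm (an n)^-1 <= 4 / n.+1%:R.
Proof.
have n0 : 0 < n.+1%:R :> R by rewrite ltr0n.
rewrite nmV; apply: le_trans (_ : (n.+1%:R / 4)^-1 <= _); last by rewrite invf_div.
by rewrite lef_pV2 ?posrE ?an_ge ?divr_gt0 //; apply: lt_le_trans (an_ge n); rewrite divr_gt0.
Qed.

Lemma an_neq0 n : an n != 0.
Proof. by rewrite -nm_gt0; apply: lt_le_trans (an_ge n); rewrite divr_gt0 // ltr0n. Qed.

Lemma bn_ge n z : `|ImC z| <= 4^-1 -> n.+1%:R / 8 <= nm (bn n z).
Proof.
rewrite ler_norml => /andP[h1 h2]; apply: le_trans (Re_le_nm _); apply: le_trans (ler_norm _).
rewrite Re_bn -[n.+1%:R]natr1; have : 0 <= n%:R :> R by [].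
by move: n%:R => u u0; lra.
Qed.

Lemma bn_neq0 n z : `|ImC z| <= 4^-1 -> bn n z != 0.
Proof. by move=> h; rewrite -nm_gt0; apply: lt_le_trans (bn_ge n h); rewrite divr_gt0 // ltr0n. Qed.

Lemma bn_inv n z : `|ImC z| <= 4^-1 -> nm (bn n z)^-1 <= 8 * tau R n.
Proof.
move=> h; have n0 : 0 < n.+1%:R :> R by rewrite ltr0n.
rewrite nmV; apply: le_trans (_ : (n.+1%:R / 8)^-1 <= _).
  by rewrite lef_pV2 ?posrE ?bn_ge ?divr_gt0 //; apply: lt_le_trans (bn_ge n h); rewrite divr_gt0.
by rewrite invf_div ler_wpM2l // inv_le_tau.
Qed.

(** With r = (n+1)^(1/4) and v = (1 + x^2)^(1/4) the claim is r^2 v^3 <= r^8 +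
v^4 - 1 up to a constant, which is clear on comparing v with r^2. *)
Lemma bn_inv_real n x : nm (bn n (toC x))^-1 <= 4 * decay x * tau R n.
Proof.
set r := root4 (n.+1%:R : R).
have r1 : 1 <= r by apply: root4_ge1; rewrite ler1n.
have r4 : r ^+ 4 = n.+1%:R by apply: root4K.
pose v : R := expR (4^-1 * ln (1 + x ^+ 2)).
have o := one_sqr x; have l0 : 0 <= ln (1 + x ^+ 2) := ln_ge0 o.
have v4 : v ^+ 4 = 1 + x ^+ 2.
  by rewrite /v -expRM_natl mulrA divff // mul1r lnK // posrE; lra.
have v1 : 1 <= v by rewrite /v -[leLHS]expR0 ler_expR mulr_ge0.
have dv : (decay x)^-1 ^+ 2 = v ^+ 3.
  by rewrite /decay /v expRN invrK -!expRM_natl; congr expR; field.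
rewrite nmV /tau -/r.
have b0 : 0 < nm (bn n (toC x)).
  by rewrite nm_gt0; apply: bn_neq0; rewrite Im_toC normr0.
have d0 := decay_gt0 x; have r0 : 0 < r by lra.
have -> : 4 * decay x * r^-1 = ((4 * (decay x)^-1^-1 * r^-1)^-1)^-1 by rewrite !invrK.
rewrite lef_pV2 ?posrE // ?invr_gt0 ?mulr_gt0 ?invr_gt0 //.
rewrite -(@ler_pXn2r _ 2) ?nnegrE ?invr_ge0 ?mulr_ge0 ?invr_ge0 ?(ltW d0) ?(ltW r0) ?(ltW b0) //.
rewrite nm_sqr Re_bn Im_bn Re_toC Im_toC mul0r subr0.
have -> : (4 * (decay x)^-1^-1 / r)^-1 ^+ 2 = r ^+ 2 * v ^+ 3 / 16.
  have h (d u : R) : 0 < d -> 0 < u -> (4 * d / u)^-1 ^+ 2 = u ^+ 2 * (d^-1 ^+ 2) / 16.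
    by move=> d1 u1; field; lra.
  by rewrite -dv invrK h.
have m0 : 0 <= n%:R :> R by [].
have e : r ^+ 4 = n%:R + 1 by rewrite r4 natr1.
have key : r ^+ 2 * v ^+ 3 <= r ^+ 8 + v ^+ 4 - 1.
  have [h|h] := lerP (r ^+ 2) v.
    have a : r ^+ 2 * v ^+ 3 <= v ^+ 4 by rewrite [v ^+ 4]exprS ler_wpM2r // exprn_ge0 // ltW //; lra.
    have : 1 <= r ^+ 8 by rewrite exprn_ege1.
    lra.
  have a : r ^+ 2 * v ^+ 3 <= r ^+ 8.
    rewrite (_ : r ^+ 8 = r ^+ 2 * (r ^+ 2) ^+ 3); last by ring.
    rewrite ler_wpM2l ?sqr_ge0 // lerXn2r ?nnegrE ?sqr_ge0 //; lra.
  have : 1 <= v ^+ 4 by rewrite exprn_ege1.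
  lra.
have e8 : r ^+ 8 = (n%:R + 1) ^+ 2 by rewrite -e -exprM.
move: key; rewrite v4 e8; move: (r ^+ 2 * v ^+ 3) (n%:R : R) m0 => A m m0 h.
have := sqr_ge0 x; move: h; rewrite !expr2; nra.
Qed.

Definition lerchK_term q z (n : nat) : C := toC q ^+ n / (an n * bn n z).
(** The sum of q^n / ((n + 1/4)(n + 1/4 + iz/2)), which carries both the
digamma and the Hurwitz-Lerch differences. *)
Definition lerchK q z : C := lim (series (lerchK_term q z) @ \oo).

(** A tail bound uniform in q, whatever lower bound on |n + 1/4 + iz/2| is
available. *)
Lemma lerchK_rate z (B : R) : 0 <= B -> (forall n, nm (bn n z)^-1 <= B * tau R n) ->
  forall q, 0 <= q <= 1 -> forall N, nm (series (lerchK_term q z) N - lerchK q z) <= 128 * B * tau R N.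
Proof.
move=> B0 H q /andP[q0 q1].
have T n : nm (lerchK_term q z n) <= (4 * B) * (tau R n / n.+1%:R).
  rewrite /lerchK_term invfM !nmM nmX nm_toC (ger0_norm q0).
  have a : q ^+ n <= 1 by rewrite exprn_ile1.
  have h := ler_pM (nm_ge0 _) (nm_ge0 _) (an_inv n) (H n).
  apply: le_trans (_ : 1 * (nm (an n)^-1 * nm (bn n z)^-1) <= _).
    by rewrite ler_wpM2r // mulr_ge0 ?nm_ge0.
  rewrite mul1r; apply: le_trans h _; rewrite le_eqVlt; apply/orP; left; apply/eqP; ring.
have [l Hl] := tau_cvg_series T.
have -> : lerchK q z = l by apply: lim_seqC; exact: rate_cvg Hl.
by move=> N; apply: le_trans (Hl N) _; rewrite le_eqVlt; apply/orP; left; apply/eqP; ring.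
Qed.

Lemma lerchK_cvg q z : `|ImC z| <= 4^-1 -> 0 <= q <= 1 -> series (lerchK_term q z) n @[n --> \oo] --> (lerchK q z : C).
Proof.
move=> hz q01; apply: rate_cvg; apply: (@lerchK_rate z 8) => //.
by move=> n; exact: bn_inv.
Qed.

Lemma lerchK_bound q x : 0 <= q <= 1 -> nm (lerchK q (toC x)) <= 512 * decay x.
Proof.
move=> q01; have d0 := decay_gt0 x.
have := @lerchK_rate (toC x) (4 * decay x) _ (fun n => bn_inv_real n x) q q01 0.
rewrite /series /= big_geq // sub0r nmN tau0 mulr1.
move=> h; apply: le_trans (h _) _; first by rewrite mulr_ge0 // ltW.
by rewrite mulrA; lra.
Qed.

(** 1/(a + k) - 1/(a + d + k) = d / ((a + k)(a + d + k)), summed over k. *)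
Lemma psi_lerchK z : `|ImC z| <= 4^-1 ->
  psi (4^-1 + 'i * z / 2) = psi 4^-1 + 'i * z / 2 * lerchK 1 z.
Proof.
move=> hz; have /[!ler_norml] /andP[h1 h2] := hz.
have s1 : 0 < ReC (4^-1 : C) <= 1 by rewrite fourC Re_toC; lra.
have s2 : 0 < ReC (4^-1 + 'i * z / 2) <= 1.
  by rewrite fourC halfC !ReImE; lra.
have q01 : 0 <= (1 : R) <= 1 by rewrite ler01 lexx.
apply: (@lim_uniqC R (fun n => - dign n.+1 (4^-1 + 'i * z / 2))); first exact: psi_cvg.
have A := psi_cvg s1; have B := lerchK_cvg hz q01.
have B2 : (fun n => series (lerchK_term 1 z) n.+2) n @[n --> \oo] --> (lerchK 1 z : C).
  move/cvg_seqC : B => B; apply/cvg_seqC => e /B [N HN]; exists N => n Nn; apply: HN; lia.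
have D := seqcD A (seqcM (@seqc_cst R ('i * z / 2)) B2).
have E n : - dign n.+1 4^-1 + 'i * z / 2 * series (lerchK_term 1 z) n.+2 = - dign n.+1 (4^-1 + 'i * z / 2).
  have S : 'i * z / 2 * series (lerchK_term 1 z) n.+2 =
      \sum_(0 <= k < n.+2) (4^-1 + k%:R)^-1 - \sum_(0 <= k < n.+2) (4^-1 + 'i * z / 2 + k%:R)^-1; last first.
    by rewrite S /dign; ring.
  rewrite /series /= mulr_sumr -sumrB; apply: eq_bigr => k _.
  rewrite /lerchK_term (rmorph1 (@toC R)) expr1n.
  have a0 := an_neq0 k; have b0 := bn_neq0 k hz.
  have -> : 4^-1 + k%:R = an k by rewrite addrC.
  have -> : 4^-1 + 'i * z / 2 + k%:R = bn k z by rewrite addrC.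
  have e : 'i * z / 2 = bn k z - an k by rewrite /bn /an; ring.
  rewrite e; move: (an k) (bn k z) a0 b0 => a b a0 b0.
  by field; rewrite a0 b0.
by under eq_fun do rewrite -E.
Qed.

End LerchKernel.

(** * Continuity of the Lerch kernel *)

Section KernelFormula.
Variable R : realType.
Local Notation C := (Cx R).
Implicit Types (x y t q : R) (s z w : C) (f : C -> C) (h k : R -> C).

Definition rcont h := forall x, {for x, continuous h}.

Lemma rcontP h x : {for x, continuous h} <-> forall e : R, 0 < e ->
  exists2 d : R, 0 < d & forall y, `|y - x| < d -> nm (h y - h x) < e.
Proof.
split=> [H|H].
  move/(@cvgC_P R _ (nbhs x) _ h (h x)) : H => H e /H /nbhs_ballP[d d0 Hd].
  exists d; [exact: d0|move=> y yx; apply: Hd; rewrite /ball /= distrC; exact: yx].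
apply/(@cvgC_P R _ (nbhs x) _ h (h x)) => e /H [d d0 Hd].
apply/nbhs_ballP; exists d; [exact: d0|move=> y; rewrite /ball /= distrC; exact: Hd].
Qed.

Lemma rcont_cst c : rcont (fun=> c).
Proof. by move=> x; exact: cst_continuous. Qed.
Lemma rcontD h k : rcont h -> rcont k -> rcont (fun x => h x + k x).
Proof. by move=> H K x; exact: (continuousD (H x) (K x)). Qed.
Lemma rcontB h k : rcont h -> rcont k -> rcont (fun x => h x - k x).
Proof. by move=> H K x; exact: (continuousB (H x) (K x)). Qed.
Lemma rcontM h k : rcont h -> rcont k -> rcont (fun x => h x * k x).
Proof. by move=> H K x; exact: (continuousM (H x) (K x)). Qed.
Lemma rcont_ext h k : (forall x, h x = k x) -> rcont h -> rcont k.
Proof. by move=> /funext ->. Qed.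
Lemma rcont_toC (u : R -> R) : cont u -> rcont (fun x => toC (u x)).
Proof.
move=> cu x; apply/rcontP => e e0.
have /cvgrPdist_lt/(_ e e0)/nbhs_ballP[d d0 Hd] := cu x.
exists d; [exact: d0|move=> y yx; rewrite -(rmorphB (@toC R)) nm_toC distrC].
by apply: Hd; rewrite /ball /= distrC.
Qed.
Lemma rcont_comp h f : rcont h -> (forall x, ccont f (h x)) -> rcont (fun x => f (h x)).
Proof. by move=> H F x; apply: (continuous_comp (H x)); apply/ccontP. Qed.
Lemma rcontX h n : rcont h -> rcont (fun x => h x ^+ n).
Proof.
move=> H; elim: n => [|n IH]; first exact: rcont_cst.
by apply: rcont_ext (rcontM H IH) => x; rewrite exprS.
Qed.
Lemma rcont_sum (F : nat -> R -> C) (a b : nat) : (forall n, rcont (F n)) ->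
  rcont (fun x => \sum_(a <= n < b) F n x).
Proof.
move=> H; rewrite /index_iota; elim: (iota _ _) => [|n s IH].
  by apply: rcont_ext (@rcont_cst 0) => x; rewrite big_nil.
rewrite (_ : (fun x => _) = (fun x => F n x + \sum_(j <- s) F j x)); first exact: (rcontD (H n) IH).
by apply/funext => x; rewrite big_cons.
Qed.
(** Uniform limits at the rate tau. *)
Lemma rcont_unif (u : nat -> R -> C) h (B : R) : (forall n, rcont (u n)) ->
  (forall n x, nm (u n x - h x) <= B * tau R n) -> rcont h.
Proof.
move=> cu H x; apply/rcontP => e e0.
have B1 : 0 < `|B| + 1 by have := normr_ge0 B; lra.
have e3 : 0 < e / 3 / (`|B| + 1) by rewrite !divr_gt0.
have [N HN] := tau_small e3.
have small y : nm (u N y - h y) <= e / 3.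
  have t0 := tau_gt0 R N; have := HN N (leqnn N); rewrite ltr_pdivlMr // => h1.
  have := H N y; have := ler_norm B; move: (tau R N) h1 t0 => T; nra.
have e30 : 0 < e / 3 by lra.
have /rcontP/(_ _ e30)[d d0 Hd] := cu N x.
exists d; [exact: d0|move=> y /Hd h1].
have -> : h y - h x = (u N x - h x) - (u N y - h y) + (u N y - u N x) by ring.
have := nmD (u N x - h x - (u N y - h y)) (u N y - u N x).
have := nmB (u N x - h x) (u N y - h y); have := small x; have := small y; lra.
Qed.

Lemma rcont_Re h : rcont h -> cont (fun x => ReC (h x)).
Proof.
move=> H x; apply/cvgrPdist_lt => e e0; have /rcontP/(_ e e0)[d d0 Hd] := H x.
apply/nbhs_ballP; exists d; [exact: d0|move=> y; rewrite /ball /= distrC => /Hd].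
by rewrite distrC; apply: le_lt_trans; rewrite -ReCN -ReCD; exact: Re_le_nm.
Qed.
Lemma rcont_Im h : rcont h -> cont (fun x => ImC (h x)).
Proof.
move=> H x; apply/cvgrPdist_lt => e e0; have /rcontP/(_ e e0)[d d0 Hd] := H x.
apply/nbhs_ballP; exists d; [exact: d0|move=> y; rewrite /ball /= distrC => /Hd].
by rewrite distrC; apply: le_lt_trans; rewrite -ImCN -ImCD; exact: Im_le_nm.
Qed.

Lemma ccont_unif (u : nat -> C -> C) f z (B r : R) : 0 < r -> (forall n, ccont (u n) z) ->
  (forall n w, nm (w - z) < r -> nm (u n w - f w) <= B * tau R n) -> ccont f z.
Proof.
move=> r0 cu H e e0.
have B1 : 0 < `|B| + 1 by have := normr_ge0 B; lra.
have e3 : 0 < e / 3 / (`|B| + 1) by rewrite !divr_gt0.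
have [N HN] := tau_small e3.
have small w : nm (w - z) < r -> nm (u N w - f w) <= e / 3.
  move=> wr; have t0 := tau_gt0 R N; have := HN N (leqnn N); rewrite ltr_pdivlMr // => h1.
  have := H N w wr; have := ler_norm B; move: (tau R N) h1 t0 => T; nra.
have e30 : 0 < e / 3 by lra.
have [d d0 Hd] := cu N _ e30.
exists (Num.min d r); first by rewrite lt_min d0.
move=> w; rewrite lt_min => /andP[/Hd h1 /small h2].
have zz : nm (z - z) < r by rewrite subrr nm0.
have -> : f w - f z = (u N z - f z) - (u N w - f w) + (u N w - u N z) by ring.
have := nmD (u N z - f z - (u N w - f w)) (u N w - u N z).
have := nmB (u N z - f z) (u N w - f w); have := small z zz; lra.
Qed.

Lemma Im_near x w (r : R) : nm (w - toC x) < r -> `|ImC w| < r.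
Proof.
by apply: le_lt_trans; have := Im_le_nm (w - toC x); rewrite ImCD ImCN Im_toC subr0.
Qed.

Lemma bn_ccont n z : ccont (bn n) z.
Proof.
apply: ccontD; first exact: ccont_cst.
apply: ccontD; first exact: ccont_cst.
apply: ccontM; last exact: ccont_cst.
by apply: ccontM; [exact: ccont_cst|exact: ccont_id].
Qed.

Lemma lerchK_ccont q x : 0 <= q <= 1 -> ccont (lerchK q) (toC x).
Proof.
move=> q01; have r0 : 0 < (4^-1 : R) by lra.
apply: (@ccont_unif (fun n w => series (lerchK_term q w) n) _ _ (128 * 8) _ r0) => [n|n w /Im_near h].
  elim: n => [|n IH].
    by rewrite (_ : (fun w => _) = (fun=> 0)); [exact: ccont_cst|apply/funext => w; rewrite /series /= big_geq].
  rewrite (_ : (fun w => _) = (fun w => series (lerchK_term q w) n + lerchK_term q w n)); last first.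
    by apply/funext => w; rewrite /series /= big_nat_recr.
  apply: ccontD; first exact: IH.
  apply: ccontM; first exact: ccont_cst.
  apply: ccontV.
    by rewrite mulf_neq0 ?an_neq0 // bn_neq0 // Im_toC normr0; lra.
  by apply: ccontM; [exact: ccont_cst|exact: bn_ccont].
apply: lerchK_rate => //; first by move=> k; apply: bn_inv; exact: ltW.
Qed.

(** The Lerch kernel at q = e^(-2|t|); the absolute value makes it continuous
on the whole line. *)
Definition lerchT t z : C := lerchK (expR (- (2 * `|t|))) z.

Lemma lerchT_arg t : 0 <= expR (- (2 * `|t|)) <= (1 : R).
Proof. by rewrite expR_ge0 expR_le1 oppr_le0 mulr_ge0. Qed.

Lemma cont_abs : cont (fun t : R => `|t|).
Proof. by move=> x; exact: norm_continuous. Qed.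

Lemma lerchT_rcont z : `|ImC z| <= 4^-1 -> rcont (fun t => lerchT t z).
Proof.
move=> hz.
apply: (@rcont_unif (fun n t => series (lerchK_term (expR (- (2 * `|t|))) z) n) _ (128 * 8)) => [n|n t].
  apply: (@rcont_sum (fun n t => lerchK_term (expR (- (2 * `|t|))) z n) 0 n) => j.
  apply: rcontM; last exact: rcont_cst.
  apply: rcontX; apply: rcont_toC; apply: cont_exp; apply: contN; apply: contZ; exact: cont_abs.
apply: lerchK_rate => //; last exact: lerchT_arg.
by move=> j; exact: bn_inv.
Qed.

(** A polynomial bound on the geometric terms for fixed t > 0, from y e^(-y)
<= 1. *)
Lemma exp_decay (t : R) n : 0 < t -> expR (- (2 * t)) ^+ n <= expR (2 * t) / t ^+ 2 / n.+1%:R ^+ 2.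
Proof.
move=> t0; have n0 : 0 < n.+1%:R :> R by rewrite ltr0n.
set y := n.+1%:R * t; have y0 : 0 < y by rewrite mulr_gt0.
have -> : expR (- (2 * t)) ^+ n = expR (2 * t) * expR (- y) ^+ 2.
  rewrite -!expRM_natl -expRD /y -[n.+1%:R]natr1; congr expR; ring.
have h : y * expR (- y) <= 1.
  rewrite expRN ler_pdivrMr ?expR_gt0 // mul1r; apply: le_trans (expR_ge1Dx y); lra.
have h2 : expR (- y) <= y^-1 by rewrite -[leRHS]mul1r ler_pdivlMr // mulrC.
rewrite -!mulrA ler_wpM2l ?expR_ge0 //.
have -> : (t ^+ 2)^-1 * (n.+1%:R ^+ 2)^-1 = y^-1 ^+ 2.
  by rewrite /y exprVn exprMn [RHS]invfM mulrC.
by rewrite lerXn2r ?nnegrE ?expR_ge0 ?invr_ge0 // ltW.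
Qed.

Lemma lerch_cvg (t : R) z : 0 < t -> `|ImC z| <= 4^-1 ->
  series (fun n => toC (expR (- (2 * t))) ^+ n / (n%:R + (4^-1 + 'i * z / 2)) ^+ 1) n @[n --> \oo] -->
    (lerch (toC (expR (- (2 * t)))) 1 (4^-1 + 'i * z / 2) : C).
Proof.
move=> t0 hz.
pose u n : C := toC (expR (- (2 * t))) ^+ n / (n%:R + (4^-1 + 'i * z / 2)) ^+ 1; set A := expR (2 * t) / t ^+ 2.
have A0 : 0 <= A by rewrite divr_ge0 ?expR_ge0 ?sqr_ge0.
have U n : nm (u n) <= 8 * A * (tau R n / n.+1%:R).
  have n0 : 0 < n.+1%:R :> R by rewrite ltr0n.
  rewrite /u expr1 nmM nmX nm_toC (ger0_norm (expR_ge0 _)).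
  have h := ler_pM (exprn_ge0 n (expR_ge0 (- (2 * t)))) (nm_ge0 _) (exp_decay n t0) (bn_inv n hz).
  apply: le_trans h _; rewrite -/A.
  have i1 : n.+1%:R^-1 <= 1 :> R by rewrite invf_le1 // ler1n.
  have i0 : 0 <= n.+1%:R^-1 :> R by rewrite invr_ge0.
  have T := tau_gt0 R n.
  rewrite -exprVn expr2; move: (n.+1%:R^-1 : R) i0 i1 => i i0 i1.
  have -> : A * (i * i) * (8 * tau R n) = (8 * A * (tau R n * i)) * i by ring.
  rewrite -[leRHS]mulr1; apply: ler_wpM2l => //.
  by apply: mulr_ge0; apply: mulr_ge0 => //; exact: ltW.
have [l Hl] := tau_cvg_series U.
have C1 : series u n @[n --> \oo] --> (l : C) := rate_cvg Hl.
by rewrite /lerch (lim_seqC C1).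
Qed.

(** For t > 0 the two Lerch series converge separately, and their difference
is summed termwise. *)
Lemma lerch_pos (t : R) z : 0 < t -> `|ImC z| <= 4^-1 -> lerch_bracket_pos t z = 'i * z / 2 * lerchT t z.
Proof.
move=> t0 hz; have h0 : `|ImC (0 : C)| <= 4^-1 by rewrite ImC0 normr0; lra.
have C1 := lerch_cvg t0 h0; have C2 := lerch_cvg t0 hz.
have e0 : 4^-1 + 'i * 0 / 2 = 4^-1 :> C by rewrite mulr0 mul0r addr0.
rewrite e0 in C1.
rewrite /lerch_bracket_pos.
have -> : 2^-1 * (2^-1 + 'i * z) = 4^-1 + 'i * z / 2 :> C by field.
have C3 := lerchK_cvg hz (lerchT_arg t); rewrite (gtr0_norm t0) in C3.
have -> : lerchT t z = lerchK (expR (- (2 * t))) z by rewrite /lerchT (gtr0_norm t0).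
apply: (lim_uniqC (seqcD C1 (seqcN C2))).
have E n : series (fun n => toC (expR (- (2 * t))) ^+ n / (n%:R + 4^-1) ^+ 1) n +
   - series (fun n => toC (expR (- (2 * t))) ^+ n / (n%:R + (4^-1 + 'i * z / 2)) ^+ 1) n =
   'i * z / 2 * series (lerchK_term (expR (- (2 * t))) z) n.
  rewrite /series /= -sumrB mulr_sumr; apply: eq_bigr => k _; rewrite !expr1 /lerchK_term.
  rewrite -/(an R k) -/(bn k z); have a0 := an_neq0 R k; have b0 := bn_neq0 k hz.
  have e : 'i * z / 2 = bn k z - an R k by rewrite /bn /an; ring.
  rewrite e; move: (an R k) (bn k z) a0 b0 (_ ^+ k) => a b a0 b0 D.
  by field; rewrite a0 b0.
rewrite (_ : (fun n => _) = (fun n => 'i * z / 2 * series (lerchK_term (expR (- (2 * t))) z) n)); last by apply/funext.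
exact: (seqcM (@seqc_cst R ('i * z / 2)) C3).
Qed.

(** At t = 0 the two series diverge, but their difference is continuous in t,
so the one-sided limit has the same expression. *)
Lemma lerch_E (t : R) z : 0 <= t -> `|ImC z| <= 4^-1 -> lerch_bracket t z = 'i * z / 2 * lerchT t z.
Proof.
move=> t0 hz; rewrite /lerch_bracket; case: eqVneq => [->|tn]; last first.
  by apply: lerch_pos => //; rewrite lt_neqAle eq_sym tn.
have c : rcont (fun t => 'i * z / 2 * lerchT t z) := rcontM (@rcont_cst _) (lerchT_rcont hz).
have c0 : 'i * z / 2 * lerchT u z @[u --> (0 : R)^'+] --> 'i * z / 2 * lerchT 0 z.
  by apply: cvg_at_right_filter; exact: (c 0).
apply: cvg_lim; first exact: norm_hausdorff.
apply: cvg_trans c0; apply: near_eq_cvg; near=> u.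
by rewrite lerch_pos.
Unshelve. all: by end_near. Qed.

End KernelFormula.

(** * A formula for S_t on the real line *)

Section FrakFormula.
Variable R : realType.
Local Notation C := (Cx R).
Implicit Types (x y t q : R) (s z w : C) (f : C -> C).

(** The constant part of the bracket, obtained from psi(1/4 + iz/2) = psi(1/4)
+ (iz/2) K(1, z). *)
Definition psi_const : C := - (2^-1 * toC (ln pi)) + 2^-1 * psi 4^-1.

Definition exp_poles t z : C :=
  4 * toC (expR (t / 2) - 1) / (1 - 2 * 'i * z) + 4 * toC (expR (- (t / 2)) - 1) / (1 + 2 * 'i * z).

Definition Lambda_sum t z : C := \sum_(1 <= n < (Num.truncn (expR t)).+1)
      toC (vonMangoldt R n / Num.sqrt n%:R) * e1 (t - ln n%:R) z.

(** P_t without the term containing the logarithmic derivative of Z. *)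
Definition regular_part t z : C := exp_poles t z - Lambda_sum t z + e1 t z * (psi_const + 'i * z / 4 * lerchK 1 z)
  + lerchK 1 z / 4 - toC (expR (- (t / 2))) * lerchT t z / 4.

(** All quotients by iz disappear once the digamma and Lerch brackets are
written as iz/2 times the kernel. *)
Lemma frakP_formula (t : R) z : 0 <= t -> z != 0 -> `|ImC z| <= 4^-1 ->
  frakP t z = regular_part t z + e1 t z * logderiv (@Zcompleted R) (crit_arg z).
Proof.
move=> t0 z0 hz; rewrite /frakP /regular_part (lerch_E t0 hz) -/(psi (4^-1)) -/(psi (4^-1 + 'i * z / 2)) (psi_lerchK hz).
have -> : 'i * toC t * z = 'i * z * toC t by ring.
rewrite (e1E t z0) -/(crit_arg z) /exp_poles /Lambda_sum /psi_const.
under eq_bigr do rewrite (e1E _ z0).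
have i0 : 'i != 0 :> C := neq0Ci _.
set S := \sum_(_ <= _ < _) _.
move: (4 * toC (expR (t / 2) - 1) / _) (4 * toC (expR (- (t / 2)) - 1) / _) => p1 p2.
move: S (e1 t z) (logderiv _ _) (psi 4^-1) (toC (ln pi)) (lerchK 1 z) (toC (expR _)) (lerchT t z) => S e L p l k E kt.
by field; rewrite i0 z0.
Qed.

Lemma den_real (x : R) : 1 - 2 * 'i * toC x != 0 :> C.
Proof. by apply: Re_neq0; rewrite !ReImE; lra. Qed.
Lemma den_real2 (x : R) : 1 + 2 * 'i * toC x != 0 :> C.
Proof. by apply: Re_neq0; rewrite !ReImE; lra. Qed.

Lemma ccont_bigsum (F : nat -> C -> C) z (a b : nat) : (forall n, ccont (F n) z) ->
  ccont (fun w => \sum_(a <= n < b) F n w) z.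
Proof.
move=> H; rewrite /index_iota; elim: (iota _ _) => [|n s IH].
  have -> : (fun w => \sum_(j <- [::]) F j w) = (fun=> 0) by apply/funext => w; rewrite big_nil.
  exact: ccont_cst.
have -> : (fun w => \sum_(j <- n :: s) F j w) = (fun w => F n w + \sum_(j <- s) F j w).
  by apply/funext => w; rewrite big_cons.
exact: (ccontD (H n) IH).
Qed.

Lemma ccont_lin (a : C) z : ccont (fun w => a * w) z.
Proof. by apply: ccontM; [exact: ccont_cst|exact: ccont_id]. Qed.

Lemma regular_part_ccont (t x : R) : ccont (regular_part t) (toC x).
Proof.
have q1 : 0 <= (1 : R) <= 1 by rewrite ler01 lexx.
have k1 := lerchK_ccont x q1.
apply: ccontB; last first.
  apply: ccontM; last exact: ccont_cst.
  by apply: ccontM; [exact: ccont_cst|exact: lerchK_ccont x (lerchT_arg t)].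
apply: ccontD; last by apply: ccontM; [exact: k1|exact: ccont_cst].
apply: ccontD; last first.
  apply: ccontM; first exact: e1_ccont.
  apply: ccontD; first exact: ccont_cst.
  apply: ccontM; last exact: k1.
  by apply: ccontM; [exact: ccont_lin|exact: ccont_cst].
apply: ccontB.
  apply: ccontD; apply: ccontM; try exact: ccont_cst; apply: ccontV.
  - exact: den_real.
  - by apply: ccontB; [exact: ccont_cst|exact: ccont_lin].
  - exact: den_real2.
  - by apply: ccontD; [exact: ccont_cst|exact: ccont_lin].
by apply: ccont_bigsum => n; apply: ccontM; [exact: ccont_cst|exact: e1_ccont].
Qed.

(** The scalar in front of (1 + Theta) P_t. *)
Definition S_scale : C := 'i / (2 * toC (Num.sqrt pi)).
(** 1 plus the logarithmic derivative of s (s - 1), from [Theta_logderiv]. *)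
Definition pole_fac z : C := 1 + (crit_arg z)^-1 + (crit_arg z - 1)^-1.
(** S_t(x) in terms of the bounded quantity 1 + Theta alone. *)
Definition S_formula t x : C :=
  S_scale * (opTheta x * regular_part t (toC x) + e1 t (toC x) * (2 - opTheta x * pole_fac (toC x))).

Lemma pole_fac_ccont x : ccont pole_fac (toC x).
Proof.
have h := strip_crit_arg_real x.
apply: ccontD.
  apply: ccontD; first exact: ccont_cst.
  by apply: ccontV; [exact: strip_neq0|exact: crit_arg_cont].
apply: ccontV; first exact: strip_neq1.
by apply: ccontB; [exact: crit_arg_cont|exact: ccont_cst].
Qed.

Lemma punct_ccont f z : ccont f z -> f w @[w --> z^'] --> f z.
Proof.
move=> cf; apply/cvg_punctC => e e0; have [d d0 H] := cf e e0.
by exists d; [exact: d0|move=> w _ /H].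
Qed.

(** Near a real point, but off it, [frakP_formula] and [Theta_logderiv] apply;
every factor of the resulting expression has a limit. *)
Lemma frakS_formula t x : frakS t (toC x) = S_formula `|t| x.
Proof.
have t0 := normr_ge0 t; set T := `|t| in t0 *.
have W : 1 + Theta w @[w --> (toC x)^'] --> opTheta x.
  apply/cvg_punctC => e e0; have [d d0 H] := opTheta_lim x e0.
  by exists d; [exact: d0|move=> w wx /(H w wx) []].
have L : S_scale * ((1 + Theta w) * regular_part T w + e1 T w * (2 - (1 + Theta w) * pole_fac w)) @[w --> (toC x)^'] --> S_formula T x.
  apply: cvgM; first exact: cvg_cst.
  apply: cvgD; first by apply: cvgM; [exact: W|exact: punct_ccont (regular_part_ccont T x)].
  apply: cvgM; first exact: punct_ccont (e1_ccont T (toC x)).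
  apply: cvgB; first exact: cvg_cst.
  by apply: cvgM; [exact: W|exact: punct_ccont (pole_fac_ccont x)].
move/cvg_punctC : L => L.
rewrite /frakS; apply: lim_punctC => e e0.
have [d1 d10 H1] := L e e0; have [d2 d20 H2] := opTheta_lim x e0.
(* The formula for P_t needs w != 0; this excludes w = 0 in both cases. *)
pose d3 := if x == 0 then 1 else `|x|.
have d30 : 0 < d3 by rewrite /d3; case: eqVneq => // xn; rewrite normr_gt0.
exists (Num.min (Num.min d1 d2) (Num.min d3 4^-1)).
  by rewrite !lt_min d10 d20 d30 /=; lra.
move=> w wx; rewrite !lt_min => /andP[/andP[w1 w2] /andP[w3 w4]].
have wn0 : w != 0.
  apply/eqP => w0; move: w3 wx; rewrite w0 sub0r nmN nm_toC /d3.
  case: eqVneq => [->|_]; last by rewrite ltxx.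
  by rewrite (rmorph0 (@toC R)) eqxx.
have im : `|ImC w| <= 4^-1 := ltW (Im_near w4).
have [h1 h2 _] := H2 w wx w2.
have st : strip (crit_arg w) by apply: strip_crit_arg; lra.
have := H1 w wx w1; congr (nm (_ - _) < _).
rewrite (frakP_formula t0 wn0 im).
have TL := Theta_logderiv st h1 h2; rewrite -/(pole_fac w) in TL.
rewrite -TL /S_scale.
have p0 : toC (Num.sqrt pi) != 0 :> C by rewrite -nm_gt0 nm_toC normr_gt0 gt_eqF // sqrtr_gt0 pi_gt0.
move: (Theta w) (regular_part T w) (e1 T w) (logderiv _ _) (toC (Num.sqrt pi)) p0 => A B D F p p0.
by field; rewrite p0.
Qed.

End FrakFormula.

(** * A square integrable majorant *)

Section SquareIntegrable.
Variable R : realType.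
Local Notation C := (Cx R).
Implicit Types (x y t : R) (f : R -> R) (h : R -> C).

Lemma one_sqr_gt0 x : 0 < 1 + x ^+ 2. Proof. by have := one_sqr x; lra. Qed.

(** (1 + x^2)^(-1/4). *)
Definition pw x : R := expR (- (4^-1 * ln (1 + x ^+ 2))).

Lemma decay_pw x : decay x ^+ 2 = pw x ^+ 3.
Proof. by rewrite /decay /pw -!expRM_natl; congr expR; field. Qed.

Lemma pw4 x : pw x ^+ 4 * (1 + x ^+ 2) = 1.
Proof.
have h := one_sqr_gt0 x.
rewrite /pw -expRM_natl -{2}[1 + x ^+ 2]lnK ?posrE // -expRD -[RHS]expR0; congr expR; by field.
Qed.

(** The derivative of atan (x (1 + x^2)^(-1/4)): a bounded primitive of a
function comparable with (1 + x^2)^(-3/4). *)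
Definition datan_pw x : R := (pw x - x * (pw x * (4^-1 * (2 * x / (1 + x ^+ 2))))) / (1 + (x * pw x) ^+ 2).

Lemma drv_ln_sqr x : is_derive x (1 : R) (fun y => ln (1 + y ^+ 2)) (2 * x / (1 + x ^+ 2)).
Proof.
have D := drvD (drv_cst 1 x) (drvM (drv_id x) (drv_id x)).
have D2 : is_derive x (1 : R) (fun y => 1 + y ^+ 2) (2 * x).
  by apply: (drv_eq D) => [t|]; [rewrite expr2|ring].
apply: (drv_eq (drv_comp (f := @ln R) (g := fun y => 1 + y ^+ 2) (is_derive1_ln (one_sqr_gt0 x)) D2)) => //.
by rewrite mulrC.
Qed.

Lemma drv_pw x : is_derive x (1 : R) pw (- (pw x * (4^-1 * (2 * x / (1 + x ^+ 2))))).
Proof.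
have D := drv_exp (drvZ (- 4^-1) (drv_ln_sqr x)).
by apply: (drv_eq D) => [t|]; rewrite /pw ?mulNr // mulrN.
Qed.

Lemma drv_atan_pw x : is_derive x (1 : R) (fun y => atan (y * pw y)) (datan_pw x).
Proof.
have D := drvM (drv_id x) (drv_pw x).
have := drv_comp (f := @atan R) (g := fun y => y * pw y) (is_derive1_atan (x * pw x)) D.
move=> D2; apply: (drv_eq D2) => // ; rewrite /datan_pw; rewrite mulrC; congr (_ * _); ring.
Qed.

(** With p = (1 + x^2)^(-1/4), so that p^4 (1 + x^2) = 1, the claim becomes
p^3 + p - p^5 <= 2p + 2p/(1 + x^2). *)
Lemma datan_pw_ge x : decay x ^+ 2 <= 4 * datan_pw x.
Proof.
have p0 : 0 < pw x := expR_gt0 _; have o := one_sqr_gt0 x.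
have x2 := sqr_ge0 x.
have e := pw4 x; rewrite decay_pw /datan_pw.
set p := pw x in p0 e *.
have d0 : 0 < 1 + (x * p) ^+ 2 by have := sqr_ge0 (x * p); lra.
have -> : p - x * (p * (4^-1 * (2 * x / (1 + x ^+ 2)))) = p / 2 + p / 2 * (1 + x ^+ 2)^-1.
  by field; lra.
rewrite mulrA ler_pdivlMr //.
have i0 : 0 <= (1 + x ^+ 2)^-1 by rewrite invr_ge0 ltW.
have -> : 4 * (p / 2 + p / 2 * (1 + x ^+ 2)^-1) = 2 * p + 2 * (p * (1 + x ^+ 2)^-1).
  by move: ((1 + x ^+ 2)^-1) => i; field.
have -> : p ^+ 3 * (1 + (x * p) ^+ 2) = p ^+ 3 + p * (p ^+ 4 * (1 + x ^+ 2)) - p ^+ 5 by ring.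
rewrite e mulr1.
have p1 : p <= 1 by rewrite /p /pw -[leRHS]expR0 ler_expR oppr_le0 mulr_ge0 // ln_ge0 // one_sqr.
have p31 : p ^+ 3 <= p by rewrite -[leRHS]mulr1 exprS ler_wpM2l ?(ltW p0) // exprn_ile1 // ltW.
have p5 : 0 <= p ^+ 5 by rewrite exprn_ge0 // ltW.
have : 0 <= p * (1 + x ^+ 2)^-1 by rewrite mulr_ge0 // ltW.
move: (p * _^-1) (p ^+ 3) (p ^+ 5) p31 p5 => A B D p31 p5 A0; lra.
Qed.

Lemma atan_pw_ndecr a b : a <= b -> atan (a * pw a) <= atan (b * pw b).
Proof.
move=> ab; have dF0 x : 0 <= datan_pw x by have := datan_pw_ge x; have := sqr_ge0 (decay x); lra.
have [||c] := @MVT_segment R (fun y => atan (y * pw y)) datan_pw a b ab.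
- by move=> y _; exact: drv_atan_pw.
- apply: derivable_within_continuous => y _; by have [] := drv_atan_pw y.
- by move=> c0 e; rewrite -subr_ge0 e mulr_ge0 // subr_ge0.
Qed.

Lemma cont_pw : cont pw.
Proof. exact: drv_cont drv_pw. Qed.

Lemma cont_datan_pw : cont datan_pw.
Proof.
have c1 : cont (fun x : R => 1 + x ^+ 2) := contD (@cont_cst R 1) (contX (n := 2) (@cont_id R)).
apply: contM.
  apply: (contB cont_pw); apply: (contM (@cont_id R)); apply: (contM cont_pw).
  apply: contZ; apply: contM; first exact: cont_lin.
  by apply: (contV _ c1) => x; rewrite gt_eqF // one_sqr_gt0.
apply: contV => [x|]; first by rewrite gt_eqF // one_sqr_gt0.
exact (contD (@cont_cst R 1) (contX (n := 2) (contM (@cont_id R) cont_pw))).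
Qed.

Lemma cont_decay2 : cont (fun x => decay x ^+ 2).
Proof. by apply: (cont_ext (fun x => esym (decay_pw x))); exact: (contX (n := 3) cont_pw). Qed.

(** The primitive is monotone and bounded by pi/2. *)
Lemma hasI_decay2 : exists v, hasI (fun x => decay x ^+ 2) v.
Proof.
pose F (y : R) := atan (y * pw y).
have nd : nondecreasing_seq (fun n : nat => F n.+1%:R).
  by move=> m n mn; apply: atan_pw_ndecr; rewrite ler_nat.
have ub : has_ubound (range (fun n : nat => F n.+1%:R)).
  by exists (pi / 2) => _ [n _ <-]; apply: ltW; exact: atan_ltpi2.
have /cvg_ex[/= l Hl] := nondecreasing_is_cvgn nd ub.
have FN y : F (- y) = - F y.
  by rewrite /F /pw sqrrN mulNr atanN.
have Hl2 : F (- n.+1%:R) @[n --> \oo] --> - l.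
  under eq_fun do rewrite FN.
  exact: cvgN Hl.
have d0 x : 0 <= datan_pw x by have := datan_pw_ge x; have := sqr_ge0 (decay x); lra.
have H := hasI_FTC cont_datan_pw d0 drv_atan_pw Hl Hl2.
have f0 : 0 <= 4 :> R by lra.
apply: (hasI_dom cont_decay2 _ (hasI_scale f0 H)) => x.
by rewrite sqr_ge0 datan_pw_ge.
Qed.
End SquareIntegrable.

(** * Bounds on S_t that are uniform in t *)

Section Bound.
Variable R : realType.
Local Notation C := (Cx R).
Implicit Types (x y t : R) (s z w : C) (h k : R -> C).

Definition ppart y : R := (y + `|y|) / 2.

Lemma ppart_pos y : 0 <= y -> ppart y = y.
Proof. by move=> y0; rewrite /ppart ger0_norm //; lra. Qed.
Lemma ppart_neg y : y <= 0 -> ppart y = 0.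
Proof. by move=> y0; rewrite /ppart ler0_norm //; lra. Qed.
Lemma ppart_le y (T : R) : 0 <= T -> y <= T -> `|ppart y| <= T.
Proof.
move=> T0 yT; case: (lerP 0 y) => y0; first by rewrite ppart_pos // ger0_norm.
by rewrite ppart_neg ?normr0 // ltW.
Qed.

Definition Lambda_coef (n : nat) : C := toC (vonMangoldt R n / Num.sqrt n%:R).

(** A sum over a range of n that does not depend on t: terms with n > e^t
contribute 0 because e1 vanishes at 0. This shows that the sum over n <= e^t
is continuous in t. *)
Definition Lambda_sum_upto (M : nat) t z : C := \sum_(1 <= n < M.+1) Lambda_coef n * e1 (ppart (t - ln n%:R)) z.

Lemma Lambda_sumE t (T : R) z : 0 <= t <= T -> Lambda_sum t z = Lambda_sum_upto (Num.truncn (expR T)) t z.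
Proof.
move=> /andP[t0 tT]; rewrite /Lambda_sum_upto.
set m := Num.truncn (expR t); set M := Num.truncn _.
have mM : (m <= M)%N by apply: le_truncn; rewrite ler_expR.
rewrite (@big_cat_nat _ _ _ m.+1) //=.
rewrite [X in _ = _ + X]big1_seq ?addr0.
  apply: eq_big_nat => n /andP[n1 nm]; rewrite /Lambda_coef ppart_pos // subr_ge0 -ler_expR lnK ?posrE ?ltr0n //.
  apply: le_trans (_ : m%:R <= _); first by rewrite ler_nat -ltnS.
  by rewrite truncn_le // expR_ge0.
move=> n /andP[_]; rewrite mem_index_iota => /andP[n1 _].
rewrite ppart_neg ?e1_0 ?mulr0 //.
have n0 : (0 < n)%N by apply: leq_trans n1.
rewrite subr_le0 -ler_expR lnK ?posrE ?ltr0n //.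
by apply: ltW; apply: lt_le_trans (truncnS_gt _) _; rewrite ler_nat.
Qed.

(** S_t(x) for |t| <= T, with the range of summation fixed by T and extended
to all real t as an even function. *)
Definition S_formula_upto (M : nat) t x : C :=
  S_scale R * (opTheta x * (exp_poles `|t| (toC x) - Lambda_sum_upto M `|t| (toC x) + e1 `|t| (toC x) * (psi_const R + 'i * toC x / 4 * lerchK 1 (toC x))
  + lerchK 1 (toC x) / 4 - toC (expR (- (`|t| / 2))) * lerchT t (toC x) / 4)
  + e1 `|t| (toC x) * (2 - opTheta x * pole_fac (toC x))).

Lemma frakS_formula_upto t x (T : R) : `|t| <= T -> frakS t (toC x) = S_formula_upto (Num.truncn (expR T)) t x.
Proof.
move=> tT; have h : 0 <= `|t| <= T by rewrite normr_ge0.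
have eK : lerchT `|t| (toC x) = lerchT t (toC x) by rewrite /lerchT normr_id.
rewrite frakS_formula /S_formula /regular_part (Lambda_sumE (toC x) h) eK; reflexivity.
Qed.

Lemma rcont_e1 (u : R -> R) z : cont u -> rcont (fun t => e1 (u t) z).
Proof.
move=> cu; have c1 := rcont_toC cu; apply: rcontM; first exact: c1.
apply: (@rcont_comp R (fun t => 'i * z * toC (u t)) (@E1 R)) => [|t]; last exact: ent_cont (@ent_E1 R).
by apply: rcontM; [exact: rcont_cst|exact: c1].
Qed.

Lemma cont_half_abs (d : R) : cont (fun t => expR (d * (`|t| / 2))).
Proof.
apply: cont_exp; apply: contZ.
exact (contM (@cont_abs R) (@cont_cst R 2^-1)).
Qed.

Lemma S_formula_upto_rcont M x : rcont (fun t => S_formula_upto M t x).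
Proof.
have ce : rcont (fun t => e1 `|t| (toC x)) := @rcont_e1 _ (toC x) (@cont_abs R).
have cp : cont (fun t : R => expR (`|t| / 2)).
  by apply: (cont_ext _ (@cont_half_abs 1)) => t; rewrite mul1r.
have cn : cont (fun t : R => expR (- (`|t| / 2))).
  by apply: (cont_ext _ (@cont_half_abs (-1))) => t; rewrite mulN1r.
have hx : `|ImC (toC x)| <= 4^-1 by rewrite Im_toC normr0; lra.
apply: rcontM; first exact: rcont_cst.
apply: rcontD; last by apply: rcontM; [exact: ce|exact: rcont_cst].
apply: rcontM; first exact: rcont_cst.
apply: rcontB; last first.
  apply: rcontM; last exact: rcont_cst.
  by apply: rcontM; [exact: rcont_toC cn|exact: lerchT_rcont].
apply: rcontD; last exact: rcont_cst.
apply: rcontD; last by apply: rcontM; [exact: ce|exact: rcont_cst].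
apply: rcontB.
  apply: rcontD; (apply: rcontM; last exact: rcont_cst); (apply: rcontM; first exact: rcont_cst).
    exact: (rcont_toC (contB cp (@cont_cst R 1))).
  exact: (rcont_toC (contB cn (@cont_cst R 1))).
apply: (@rcont_sum R (fun n t => Lambda_coef n * e1 (ppart (`|t| - ln n%:R)) (toC x)) 1 M.+1) => n.
apply: rcontM; first exact: rcont_cst.
apply: rcont_e1.
have c1 : cont (fun t : R => `|t| - ln n%:R) := contB (@cont_abs R) (@cont_cst R _).
exact (contM (contD c1 (cont_comp c1 (@cont_abs R))) (@cont_cst R 2^-1)).
Qed.

Lemma frakS_rcont_t x : rcont (fun t => frakS t (toC x)).
Proof.
move=> t; apply/rcontP => e e0.
have /rcontP/(_ e e0)[d d0 Hd] := @S_formula_upto_rcont (Num.truncn (expR (`|t| + 1))) x t.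
exists (Num.min d 1); first by rewrite lt_min d0 ltr01.
move=> y; rewrite lt_min => /andP[yd y1].
rewrite (@frakS_formula_upto y x (`|t| + 1)); last first.
  have := ler_normD (y - t) t; rewrite subrK; lra.
rewrite (@frakS_formula_upto t x (`|t| + 1)); last by lra.
exact: Hd.
Qed.

Lemma exp_poles_bound t x (T : R) : 0 <= t <= T -> nm (exp_poles t (toC x)) <= 8 * (expR T + 1) * decay x.
Proof.
move=> /andP[t0 tT].
have o := one_sqr x; have x2 := sqr_ge0 x.
have inv (a : R) : a ^+ 2 = 4 -> nm (1 + toC a * 'i * toC x)^-1 <= decay x.
  move=> a2; have h : 1 + x ^+ 2 <= nm (1 + toC a * 'i * toC x) ^+ 2.
    rewrite nm_sqr !ReImE.
    have -> : (1 + ((a * 0 - 0 * 1) * x - (a * 1 + 0 * 0) * 0)) ^+ 2 + (0 + ((a * 0 - 0 * 1) * 0 + (a * 1 + 0 * 0) * x)) ^+ 2 = 1 + a ^+ 2 * x ^+ 2 by ring.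
    by rewrite a2; lra.
  rewrite nmV; apply: decay_ge => //; rewrite nm_gt0; apply/eqP => e; move: h; rewrite e nm0 expr0n /=; lra.
have e1 : nm (1 - 2 * 'i * toC x)^-1 <= decay x.
  have := inv (-2); rewrite (rmorphN (@toC R)) (rmorph_nat (@toC R)) !mulNr; apply; ring.
have e2 : nm (1 + 2 * 'i * toC x)^-1 <= decay x.
  have := inv 2; rewrite (rmorph_nat (@toC R)); apply; ring.
have E0 := expR_gt0 T.
have b1 : `|expR (t / 2) - 1| <= expR T + 1.
  have := expR_gt0 (t / 2); have : expR (t / 2) <= expR T by rewrite ler_expR; lra.
  by rewrite ler_norml; lra.
have b2 : `|expR (- (t / 2)) - 1| <= expR T + 1.
  have := expR_gt0 (- (t / 2)); have : expR (- (t / 2)) <= expR T by rewrite ler_expR; lra.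
  by rewrite ler_norml; lra.
apply: le_trans (nmD _ _) _; rewrite !nmM !nm_toC nm_nat.
have h1 := ler_pM (normr_ge0 _) (nm_ge0 _) b1 e1.
have h2 := ler_pM (normr_ge0 _) (nm_ge0 _) b2 e2.
move: h1 h2; move: `|expR (t / 2) - 1| `|expR (- (t / 2)) - 1| (nm (1 - 2 * 'i * toC x)^-1) (nm (1 + 2 * 'i * toC x)^-1) => a b c d.
rewrite -!mulrA; move: (a * c) (b * d) ((expR T + 1) * _) => ac bd X; lra.
Qed.

(** The factor z is absorbed by z e1 = (e^(izt) - 1)/i, which is bounded. *)
Lemma e1_lerchK_bound t q x : 0 <= q <= 1 ->
  nm (e1 t (toC x) * ('i * toC x / 4 * lerchK q (toC x))) <= 256 * decay x.
Proof.
move=> q01; have kb := lerchK_bound x q01.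
have -> : e1 t (toC x) * ('i * toC x / 4 * lerchK q (toC x)) = (cexp ('i * toC x * toC t) - 1) / 4 * lerchK q (toC x).
  rewrite E1E /e1; ring.
have n2 : nm (cexp ('i * toC x * toC t) - 1) <= 2.
  apply: le_trans (nmB _ _) _; rewrite nm_cexp nm1.
  have -> : ReC ('i * toC x * toC t) = 0 by rewrite !ReImE; ring.
  by rewrite expR0; lra.
rewrite !nmM nmV nm_nat.
have := ler_pM (nm_ge0 _) (nm_ge0 _) n2 kb.
move: (nm (cexp _ - 1)) (nm (lerchK _ _)) (decay x) => a b d; rewrite mulrAC; move: (a * b) => ab; lra.
Qed.

Lemma pole_fac_bound x : nm (pole_fac (toC x)) <= 5.
Proof.
have h := strip_crit_arg_real x.
have a : nm (crit_arg (toC x))^-1 <= 2.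
  have r : 2^-1 <= nm (crit_arg (toC x)).
    apply: le_trans (Re_le_nm _); rewrite Re_crit_arg Im_toC addr0; exact: ler_norm.
  rewrite nmV -[leRHS]invrK lef_pV2 ?posrE ?nm_gt0 ?strip_neq0 //.
have b : nm (crit_arg (toC x) - 1)^-1 <= 2.
  have r : 2^-1 <= nm (crit_arg (toC x) - 1).
    apply: le_trans (Re_le_nm _); rewrite ReCD ReCN ReC1 Re_crit_arg Im_toC addr0.
    by rewrite -normrN; apply: le_trans (ler_norm _); lra.
  by rewrite nmV -[leRHS]invrK lef_pV2 ?posrE ?nm_gt0 ?strip_neq1.
apply: le_trans (nmD _ _) _; apply: le_trans (lerD (nmD _ _) (lexx _)) _.
rewrite nm1; lra.
Qed.

(** Each summand is bounded by a multiple of [decay]; the factor 1 + Theta is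
bounded by 2 and [pole_fac] by 5. *)
Lemma frakS_bound (T : R) : 0 <= T ->
  exists2 B, 0 <= B & forall t x, `|t| <= T -> nm (frakS t (toC x)) <= B * decay x.
Proof.
move=> T0; have [Be Be0 HBe] := e1_bound T0.
set M := Num.truncn (expR T).
pose V := \sum_(1 <= n < M.+1) nm (Lambda_coef n) * Be.
have V0 : 0 <= V by apply: sumr_ge0 => n _; rewrite mulr_ge0 ?nm_ge0.
pose Br := 8 * (expR T + 1) + V + (Be * nm (psi_const R) + 256) + 128 + 128.
have E0 := expR_gt0 T.
have c00 := nm_ge0 (psi_const R).
have Bc : 0 <= Be * nm (psi_const R) by rewrite mulr_ge0.
have Br0 : 0 <= Br by rewrite /Br; move: (Be * _) (V) Bc V0 => X Y X0 Y0; lra.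
exists (nm (S_scale R) * (2 * Br + Be * 12)) => [|t x tT].
  by rewrite mulr_ge0 ?nm_ge0 //; lra.
have d0 := decay_gt0 x.
have q1 : 0 <= (1 : R) <= 1 by rewrite ler01 lexx.
have t0 := normr_ge0 t.
have tt : 0 <= `|t| <= T by rewrite t0.
have be : nm (e1 `|t| (toC x)) <= Be * decay x by apply: HBe; rewrite normr_id.
rewrite (frakS_formula_upto x tT) /S_formula_upto -/M nmM -[leRHS]mulrA; apply: ler_wpM2l; first exact: nm_ge0.
have b1 := exp_poles_bound x tt.
have b2 : nm (Lambda_sum_upto M `|t| (toC x)) <= V * decay x.
  apply: le_trans (nm_sum _ _ _) _; rewrite /V mulr_suml big_seq [leRHS]big_seq; apply: ler_sum => n.
  rewrite mem_index_iota => /andP[n1 _]; rewrite nmM -mulrA; apply: ler_wpM2l; first exact: nm_ge0.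
  apply: HBe; apply: ppart_le => //.
  by have : 0 <= ln (n%:R : R) by [apply: ln_ge0; rewrite ler1n]; lra.
have b3 : nm (e1 `|t| (toC x) * (psi_const R + 'i * toC x / 4 * lerchK 1 (toC x))) <= (Be * nm (psi_const R) + 256) * decay x.
  rewrite mulrDr; apply: le_trans (nmD _ _) _.
  rewrite [leRHS]mulrDl; apply: lerD; last exact: e1_lerchK_bound.
  by rewrite nmM mulrAC; apply: ler_wpM2r => //; exact: nm_ge0.
have b4 : nm (lerchK 1 (toC x) / 4) <= 128 * decay x.
  have := lerchK_bound x q1; rewrite nmM nmV nm_nat; move: (nm _) (decay x) => a d; lra.
have b5 : nm (toC (expR (- (`|t| / 2))) * lerchT t (toC x) / 4) <= 128 * decay x.
  have kb := lerchK_bound x (lerchT_arg t); rewrite !nmM nmV nm_nat nm_toC (ger0_norm (expR_ge0 _)).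
  have el : expR (- (`|t| / 2)) <= 1 by rewrite expR_le1; lra.
  have := ler_pM (expR_ge0 _) (nm_ge0 _) el kb.
  by rewrite mul1r -/(lerchT t (toC x)); move: (expR _ * nm _) (decay x) => a d; lra.
set P := exp_poles _ _; set S := Lambda_sum_upto _ _ _; set A := e1 _ _ * (psi_const R + _); set D := _ / 4; set F := _ / 4.
have br : nm (P - S + A + D - F) <= Br * decay x.
  apply: le_trans (nmB _ _) _; rewrite /Br [leRHS]mulrDl; apply: lerD; last exact: b5.
  apply: le_trans (nmD _ _) _; rewrite [leRHS]mulrDl; apply: lerD; last exact: b4.
  apply: le_trans (nmD _ _) _; rewrite [leRHS]mulrDl; apply: lerD; last exact: b3.
  apply: le_trans (nmB _ _) _; rewrite [leRHS]mulrDl; apply: lerD; [exact: b1|exact: b2].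
have bw : nm (2 - opTheta x * pole_fac (toC x)) <= 12.
  apply: le_trans (nmB _ _) _; rewrite nm_nat nmM.
  have := ler_pM (nm_ge0 _) (nm_ge0 _) (opTheta_le x) (pole_fac_bound x).
  by move: (nm _ * nm _) => a; lra.
apply: le_trans (nmD _ _) _; rewrite (nmM (opTheta x)) (nmM (e1 _ _)).
have h1 := ler_pM (nm_ge0 _) (nm_ge0 _) (opTheta_le x) br.
have h2 := ler_pM (nm_ge0 _) (nm_ge0 _) be bw.
have -> : (2 * Br + Be * 12) * decay x = 2 * (Br * decay x) + Be * decay x * 12 by ring.
exact: (lerD h1 h2).
Qed.

End Bound.

(** * The transform of a test function *)

Section MainProof.
Variable R : realType.
Local Notation C := (Cx R).
Local Notation mu := (@lebesgue_measure R).
Implicit Types (x y t : R).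

(** A continuous function on the compact interval [-T, T], extended by 0. *)
Lemma csupp_integrable (f : R -> R) (T : R) : cont f -> (forall t, T < `|t| -> f t = 0) ->
  mu.-integrable setT (EFin \o f).
Proof.
move=> cf f0.
have H : mu.-integrable `[- T, T]%classic (EFin \o f).
  apply: continuous_compact_integrable; first exact: segment_compact.
  by apply: continuous_subspaceT; exact: cf.
have -> : EFin \o f = (EFin \o f) \_ `[- T, T]%classic.
  apply/funext => t; rewrite patchE; case: ifPn => // tn.
  rewrite /= f0 //; rewrite ltNge; apply/negP => tT; move/negP: tn; apply.
  by rewrite inE /= in_itv /= -ler_norml.
have [K _] := @integrable_mkcond _ _ R mu `[- T, T]%classic (EFin \o f) (measurable_itv _).
exact: (K H).
Qed.

Lemma test_rcont (phi : R -> C) : test_function phi -> rcont phi.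
Proof.
move=> [sr si _].
have c (u : R -> R) : smooth u -> cont u.
  by move=> su x; apply/differentiable_continuous/derivable1_diffP; exact: (su 0%N x).
apply: (@rcont_ext R (fun t => toC (re_part phi t) + 'i * toC (im_part phi t))).
  by move=> t; rewrite [RHS]decompC.
apply: rcontD; first exact: rcont_toC (c _ sr).
by apply: rcontM; [exact: rcont_cst|exact: rcont_toC (c _ si)].
Qed.

Lemma test_support (phi : R -> C) : test_function phi ->
  exists2 T, 0 <= T & forall t, T < `|t| -> phi t = 0.
Proof.
move=> [_ _ /compact_bounded[M [_ HM]]]; exists (`|M| + 1) => [|t tM]; first by rewrite addr_ge0.
apply/eqP; apply: contraTT tM => p0; rewrite -leNgt.
apply: (HM (`|M| + 1)); first by have := ler_norm M; lra.
exact: subset_closure.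
Qed.

Section TestFunction.
Variable phi : R -> C.
Hypothesis hphi : test_function phi.

Let h x t : C := frakS t (toC x) * phi t.
Let w t : R := `|re_part phi t| + `|im_part phi t|.

Lemma h_rcont x : rcont (h x).
Proof. by apply: rcontM; [exact: frakS_rcont_t|exact: test_rcont]. Qed.

Lemma frakS_rcont_x t : rcont (fun x => frakS t (toC x)).
Proof.
have ct : rcont (fun x : R => toC x) := rcont_toC (@cont_id R).
have cW : rcont (@opTheta R).
  move=> x; apply/rcontP => e e0; have e2 : 0 < e / 2 by lra.
  have [d d0 Hd] := opTheta_cont x e2; exists d; [exact: d0|move=> y /Hd]; lra.
apply: (@rcont_ext R (fun x => S_formula `|t| x)) => [x|]; first by rewrite frakS_formula.
have cc (F : C -> C) : (forall x, ccont F (toC x)) -> rcont (fun x => F (toC x)).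
  by move=> H; exact: (rcont_comp ct H).
apply: rcontM; first exact: rcont_cst.
apply: rcontD.
  by apply: rcontM; [exact: cW|apply: cc => x; exact: regular_part_ccont].
apply: rcontM; first by apply: cc => x; exact: e1_ccont.
apply: rcontB; first exact: rcont_cst.
by apply: rcontM; [exact: cW|apply: cc => x; exact: pole_fac_ccont].
Qed.

Lemma h_cont_x t : rcont (fun x => h x t).
Proof. by apply: rcontM; [exact: frakS_rcont_x|exact: rcont_cst]. Qed.

Lemma h_dom : exists2 B, 0 <= B & forall x t, nm (h x t) <= decay x * (B * w t).
Proof.
have [T T0 HT] := test_support hphi.
have [B B0 HB] := frakS_bound T0; exists B => // x t.
have w0 : 0 <= w t by rewrite addr_ge0.
have d0 := decay_gt0 x.
case: (lerP `|t| T) => tT; last first.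
  rewrite /h HT // mulr0 nm0; apply: mulr_ge0; first exact: ltW.
  exact: mulr_ge0.
rewrite /h nmM mulrA [decay x * B]mulrC.
by apply: ler_pM; rewrite ?nm_ge0 ?HB //; exact: nm_le.
Qed.

Lemma w_integrable (B : R) : mu.-integrable setT (EFin \o (fun t => B * w t)).
Proof.
have [T T0 HT] := test_support hphi.
have cp := test_rcont hphi.
apply: (@csupp_integrable _ T) => [|t tT].
  apply: contZ; apply: contD.
    exact: (cont_comp (rcont_Re cp) (@cont_abs R)).
  exact: (cont_comp (rcont_Im cp) (@cont_abs R)).
by rewrite /w /re_part /im_part HT // normr0 add0r mulr0.
Qed.

Lemma part_integrable (P : C -> R) x : cont (fun t => P (h x t)) -> P 0 = 0 ->
  mu.-integrable setT (EFin \o (fun t => P (h x t))).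
Proof.
move=> cP P0; have [T T0 HT] := test_support hphi.
by apply: (@csupp_integrable _ T) => // t tT; rewrite /h HT // mulr0 P0.
Qed.

(** Domination by B w(t), which does not depend on x, gives continuity in x;
the factor [decay] is kept for the bound. *)
Lemma part_transform (P : C -> R) : (forall k : R -> C, rcont k -> cont (fun x => P (k x))) ->
  P 0 = 0 -> (forall z, `|P z| <= nm z) ->
  cont (fun x => Rintegral mu setT (fun t => P (h x t))) /\
  exists J, forall x, `|Rintegral mu setT (fun t => P (h x t))| <= J * decay x.
Proof.
move=> cP P0 Pn.
have [B B0 HB] := h_dom.
have ih x : mu.-integrable setT (EFin \o (fun t => P (h x t))).
  by apply: part_integrable => //; apply: cP; exact: h_rcont.
have d1 x : decay x <= 1.
  by rewrite /decay -[leRHS]expR0 ler_expR oppr_le0 mulr_ge0 // ln_ge0 // one_sqr.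
have dom x t : `|P (h x t)| <= decay x * (B * w t) by apply: le_trans (Pn _) (HB x t).
have w0 t : 0 <= w t by rewrite addr_ge0.
split.
  move=> a.
  apply: (@continuity_under_integral R _ _ mu (fun x t => P (h x t)) setT measurableT (a - 1) (a + 1)
    _ _ (fun t => B * w t)) => //.
  - apply: aeW => t _ x _; exact: (cP _ (@h_cont_x t)).
  - exact: w_integrable.
  - move=> x _; apply: aeW => t _; apply: le_trans (dom x t) _.
    by rewrite -[leRHS]mul1r ler_wpM2r // mulr_ge0.
  - by rewrite inE /= in_itv /=; lra.
exists (Rintegral mu setT (fun t => B * w t)) => x.
apply: le_trans (le_normr_Rintegral _ (ih x)) _ => //.
rewrite mulrC -RintegralZl //; last exact: w_integrable.
apply: le_Rintegral => //.
- exact: (integrable_norm (ih x)).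
- by have := @integrableZl _ _ _ mu setT measurableT (decay x) _ (w_integrable B).
Qed.

End TestFunction.
End MainProof.

(* The first conjunct says that the integral defining [hatP phi] on the real
   line converges absolutely. *)
Theorem proposition1p2 (R : realType) (phi : R -> Cx R)
    (hphi : test_function phi) :
  (forall x : R, Cintegrable (fun t : R => frakS t (toC x) * phi t))
  /\ in_L2 (fun x : R => hatP phi (toC x)).
Proof.
split=> [x|].
  by split; [apply: (part_integrable hphi (P := @ReC R))|apply: (part_integrable hphi (P := @ImC R))] => //;
    [apply: rcont_Re|apply: rcont_Im]; exact: h_rcont.
have [c1 [J1 H1]] := part_transform hphi (@rcont_Re R) (erefl : @ReC R 0 = 0) (@Re_le_nm R).
have [c2 [J2 H2]] := part_transform hphi (@rcont_Im R) (erefl : @ImC R 0 = 0) (@Im_le_nm R).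
split; [exact: (cont_meas c1)|exact: (cont_meas c2)|].
set I1 := (fun x => Rintegral _ _ _) in c1 H1; set I2 := (fun x => Rintegral _ _ _) in c2 H2.
have [v Hv] := hasI_decay2 R.
have JJ : 0 <= J1 ^+ 2 + J2 ^+ 2 by rewrite addr_ge0 ?sqr_ge0.
have HJ := hasI_scale JJ Hv.
have [cJ J0 eJ] := HJ.
have nE x : ComplexField.Normc.normc (hatP phi (toC x)) ^+ 2 = I1 x ^+ 2 + I2 x ^+ 2.
  by rewrite -/(nm _) nm_sqr.
have cI : cont (fun x => I1 x ^+ 2 + I2 x ^+ 2) := contD (contX (n := 2) c1) (contX (n := 2) c2).
apply: (@le_lt_trans _ _ (\int[@lebesgue_measure R]_x ((J1 ^+ 2 + J2 ^+ 2) * decay x ^+ 2)%:E)%E).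
  apply: ge0_le_integral => //.
  - by move=> x _; rewrite lee_fin sqr_ge0.
  - by apply: (cont_measE (cont_ext _ cI)) => x; rewrite nE.
  - exact: cont_measE cJ.
  - move=> x _; rewrite lee_fin nE mulrDl -!exprMn; have d0 := decay_gt0 x.
    apply: lerD; rewrite -[leLHS]real_normK ?num_real // lerXn2r ?nnegrE //.
    - exact: le_trans (normr_ge0 _) (H1 x).
    - exact: H1.
    - exact: le_trans (normr_ge0 _) (H2 x).
    - exact: H2.
by rewrite eJ ltry.
Qed.
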